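(* For some genus $g$ large enough, there exist quasi-Fuchsian representations $\rho:\Gamma_g\to \mathrm{SL}(2,\mathbb{C})$ of the fundamental group $\Gamma_g$ of a closed oriented surface $S_g$ of genus $g$ that admit no $\rho$-equivariant fitting immersion $u:\widetilde{S_g}\to \mathcal{G}$, where $\mathcal{G}$ is the space of (unoriented) geodesics of hyperbolic space $\mathbb{H}^3$.
   Context: $\widetilde{S_g}$ is the universal cover of $S_g$. A representation $\rho:\Gamma_g\to\mathrm{SL}(2,\mathbb{C})$ is quasi-Fuchsian if it is a quasi-isometric embedding (equivalently, orbit maps $\Gamma_g\to\mathbb{H}^3$ are quasi-isometric embeddings). Fitting immersions: a smooth immersion $u:S\to\mathcal{G}$ of a surface $S$ is fitting if the corresponding geodesics (together with their endpoints) locally define a smooth fibration of $\mathbb{H}^3\cup\partial\mathbb{H}^3$. In infinitesimal terms: let $\mathcal{H}$ be the real $4$-dimensional vector space of Hermitian forms on $\mathbb{C}^2$. A plane $P\subset\mathcal{H}$ is mixed if it contains no non-zero positive semi-definite form. Let $\mathrm{Gr}_2^{\mathrm{mix}}(\mathcal{H})$ be the space of mixed planes; it is identified with $\mathcal{G}$ by sending $P$ to the geodesic given by the annihilator of $P$ in the projective Klein model of $\mathbb{H}^3$ inside $\mathbb{P}(\mathcal{H}^* )$ (the two endpoints in $\mathbb{CP}^1$ of this geodesic are the common isotropic lines of the forms in $P$). With $T_P\mathrm{Gr}_2(\mathcal{H})=\mathrm{Hom}(P,\mathcal{H}/P)$, a tangent vector $\mathrm{v}$ is fitting if its image contains a class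 $[q]\in \mathcal{H}/P$ of some positive definite $q\in\mathcal{H}$; the immersion $u$ is fitting if $\mathrm{d}u(w)$ is fitting for every non-zero tangent vector $w$. *)

(* Defs.v *)
From HB Require Import structures.
From mathcomp Require Import all_boot all_order all_algebra.
From mathcomp Require Import spectral generic_quotient complex.
From mathcomp Require Import all_classical all_reals all_analysis.

Set Implicit Arguments.
Unset Strict Implicit.
Unset Printing Implicit Defensive.

Import Order.TTheory GRing.Theory Num.Theory numFieldNormedType.Exports.
Local Open Scope classical_set_scope.
Local Open Scope ring_scope.
Local Open Scope quotient_scope.

(** * The surface group
    Gamma_g = < a_i, b_i (i < g) | \prod_i [a_i, b_i] >. *)

(* [(i, false, e)] stands for a_i^(+-1) and [(i, true, e)] for b_i^(+-1);
   the exponent is -1 when [e] is [true]. *)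
Definition letter (g : nat) : Type := ('I_g * bool * bool)%type.
HB.instance Definition _ g := Choice.on (letter g).

Definition linv g (l : letter g) : letter g := (l.1, ~~ l.2).
Definition winv g (w : seq (letter g)) : seq (letter g) := rev (map (@linv g) w).

Definition relator g : seq (letter g) :=
  flatten [seq [:: (i, false, false); (i, true, false);
                   (i, false, true); (i, true, true)] | i <- enum 'I_g].

Inductive word_equiv g : seq (letter g) -> seq (letter g) -> Prop :=
| we_refl w : word_equiv w w
| we_sym v w : word_equiv v w -> word_equiv w v
| we_trans u v w : word_equiv u v -> word_equiv v w -> word_equiv u w
| we_cancel l v w : word_equiv (v ++ l :: linv l :: w) (v ++ w)
| we_relator v w : word_equiv (v ++ relator g ++ w) (v ++ w).

Definition word_equivb g : rel (seq (letter g)) :=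
  fun v w => `[< word_equiv v w >].

Lemma word_equivb_refl g : reflexive (@word_equivb g).
Proof. by move=> w; apply/asboolP; exact: we_refl. Qed.

Lemma word_equivb_sym g : symmetric (@word_equivb g).
Proof. by move=> v w; apply/asboolP/asboolP; exact: we_sym. Qed.

Lemma word_equivb_trans g : transitive (@word_equivb g).
Proof.
by move=> v u w /asboolP uv /asboolP vw; apply/asboolP; exact: we_trans uv vw.
Qed.

Canonical word_equiv_rel g := EquivRel (@word_equivb g)
  (@word_equivb_refl g) (@word_equivb_sym g) (@word_equivb_trans g).

Definition surface_group (g : nat) : Type := {eq_quot (word_equiv_rel g)}.
HB.instance Definition _ g := Choice.on (surface_group g).

Section SurfaceGroup.
Variable g : nat.
Implicit Types (u v w : seq (letter g)) (x y z : surface_group g).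

Definition class_of w : surface_group g := \pi_{eq_quot (word_equiv_rel g)} w.

Lemma class_ofP v w : class_of v = class_of w <-> word_equiv v w.
Proof.
split=> [/eqquotP/asboolP //|vw].
by apply/eqquotP/asboolP.
Qed.

Lemma class_of_repr x : class_of (repr x) = x.
Proof. exact: reprK. Qed.

Lemma word_equiv_cat v v' w w' :
  word_equiv v v' -> word_equiv w w' -> word_equiv (v ++ w) (v' ++ w').
Proof.
have catr (t s s' : seq (letter g)) : word_equiv s s' -> word_equiv (t ++ s) (t ++ s').
  elim=> {s s'} [s|s s' _ /we_sym //|r s s' _ rs _ ss|l s s'|s s'].
  - exact: we_refl.
  - exact: we_trans rs ss.
  - by rewrite !(catA t); exact: we_cancel.
  - by rewrite !(catA t); exact: we_relator.
have catl (t s s' : seq (letter g)) : word_equiv s s' -> word_equiv (s ++ t) (s' ++ t).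
  elim=> {s s'} [s|s s' _ /we_sym //|r s s' _ rs _ ss|l s s'|s s'].
  - exact: we_refl.
  - exact: we_trans rs ss.
  - by rewrite -!catA; exact: we_cancel.
  - by rewrite -!catA; exact: we_relator.
by move=> vv ww; apply: we_trans (catl _ _ _ vv) (catr _ _ _ ww).
Qed.

Lemma linvK : involutive (@linv g).
Proof. by case=> l e; rewrite /linv /= negbK. Qed.

Lemma winvK : involutive (@winv g).
Proof. by move=> w; rewrite /winv map_rev revK mapK //; exact: linvK. Qed.

Lemma word_equiv_mulV w : word_equiv (w ++ winv w) [::].
Proof.
elim: w => [|l w IH]; first exact: we_refl.
rewrite /winv map_cons rev_cons -cats1 -/(winv w) cat_cons catA.
apply: we_trans (we_cancel l [::] [::]).
exact: (word_equiv_cat (we_refl [:: l]) (word_equiv_cat IH (we_refl [:: linv l]))).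
Qed.

Lemma word_equiv_Vmul w : word_equiv (winv w ++ w) [::].
Proof. by have := word_equiv_mulV (winv w); rewrite winvK. Qed.

Lemma word_equiv_inv v w : word_equiv v w -> word_equiv (winv v) (winv w).
Proof.
move=> vw.
have h1 : word_equiv (winv v) (winv v ++ (w ++ winv w)).
  rewrite -{1}[winv v]cats0.
  exact: word_equiv_cat (we_refl _) (we_sym (word_equiv_mulV w)).
apply: (we_trans h1); rewrite catA -[X in word_equiv _ X]cat0s.
apply: word_equiv_cat (we_refl _).
apply: we_trans (word_equiv_Vmul v).
exact: word_equiv_cat (we_refl _) (we_sym vw).
Qed.

Definition sg_mul x y : surface_group g := class_of (repr x ++ repr y).
Definition sg_inv x : surface_group g := class_of (winv (repr x)).

Lemma repr_class_of w : word_equiv (repr (class_of w)) w.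
Proof. by apply/class_ofP; rewrite class_of_repr. Qed.

Lemma sg_mulE v w : sg_mul (class_of v) (class_of w) = class_of (v ++ w).
Proof. by apply/class_ofP/word_equiv_cat; exact: repr_class_of. Qed.

Lemma sg_invE w : sg_inv (class_of w) = class_of (winv w).
Proof. by apply/class_ofP/word_equiv_inv; exact: repr_class_of. Qed.

Lemma sg_mulA : associative sg_mul.
Proof.
move=> x y z; rewrite -(class_of_repr x) -(class_of_repr y) -(class_of_repr z).
by rewrite !sg_mulE catA.
Qed.

Lemma sg_mul1g : left_id (class_of [::]) sg_mul.
Proof. by move=> x; rewrite -(class_of_repr x) sg_mulE. Qed.

Lemma sg_mulg1 : right_id (class_of [::]) sg_mul.
Proof. by move=> x; rewrite -(class_of_repr x) sg_mulE cats0. Qed.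

Lemma sg_mulVg : left_inverse (class_of [::]) sg_inv sg_mul.
Proof.
move=> x; rewrite -(class_of_repr x) sg_invE sg_mulE.
by apply/class_ofP; exact: word_equiv_Vmul.
Qed.

Lemma sg_mulgV : right_inverse (class_of [::]) sg_inv sg_mul.
Proof.
move=> x; rewrite -(class_of_repr x) sg_invE sg_mulE.
by apply/class_ofP; exact: word_equiv_mulV.
Qed.

HB.instance Definition _ := isGroup.Build (surface_group g)
  sg_mulA sg_mul1g sg_mulg1 sg_mulVg sg_mulgV.

Lemma word_length_subproof x :
  exists n, `[< exists2 w, size w = n & class_of w = x >].
Proof.
exists (size (repr x)); apply/asboolP.
by exists (repr x) => //; exact: class_of_repr.
Qed.

Definition word_length x : nat := ex_minn (word_length_subproof x).

End SurfaceGroup.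

Definition word_dist (R : realType) g (x y : surface_group g) : R :=
  (word_length (x^-1 * y)%g)%:R.

(** * Hermitian forms, hyperbolic space and quasi-Fuchsian representations *)

Section Hermitian.
Variable R : realType.
Local Notation C := R[i].
Local Open Scope sesquilinear_scope.
Local Open Scope complex_scope.

(* Linear coordinates (p, r, s, t) on the real vector space of Hermitian forms
   on C^2; the form with Hermitian matrix A is z |-> z^* A z, for z a column. *)
Local Notation Herm := 'rV[R]_4.

Definition herm_mx (q : Herm) : 'M[C]_2 := \matrix_(i, j)
  if i == 0 then if j == 0 then (q 0 0)%:C else q 0 2%:R +i* q 0 3%:R
  else if j == 0 then q 0 2%:R -i* q 0 3%:R else (q 0 1)%:C.

Definition herm_coord (A : 'M[C]_2) : Herm :=
  \row_k [:: complex.Re (A 0 0); complex.Re (A 1 1);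
             complex.Re (A 0 1); complex.Im (A 0 1)]`_k.

Definition posdef (A : 'M[C]_2) : Prop :=
  forall z : 'cV[C]_2, z != 0 -> 0 < (z^t* *m A *m z) 0 0.

Definition possemidef (A : 'M[C]_2) : Prop :=
  forall z : 'cV[C]_2, 0 <= (z^t* *m A *m z) 0 0.

(* The action (h . q)(z) = q (h^-1 z) of SL(2,C) on Hermitian forms. *)
Definition herm_act (h : 'M[C]_2) (q : Herm) : Herm :=
  herm_coord ((invmx h)^t* *m herm_mx q *m invmx h).

(* H^3 as the hyperboloid of positive definite Hermitian matrices of
   determinant 1, on which SL(2,C) acts by h . M = h M h^*. *)
Definition hyp3 (M : 'M[C]_2) : Prop :=
  [/\ M^t* = M, posdef M & \det M = 1].

Definition hyp3_act (h M : 'M[C]_2) : 'M[C]_2 := h *m M *m h^t*.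

Definition arcosh (x : R) : R := ln (x + Num.sqrt (x ^+ 2 - 1)).

(* Curvature -1: diag(e^d, e^-d) is at distance d from the identity. *)
Definition hyp3_dist (M N : 'M[C]_2) : R :=
  arcosh (complex.Re (\tr (invmx M *m N)) / 2%:R).

Record SL2_representation (G : groupType) := SL2Representation {
  rep_mx :> G -> 'M[C]_2;
  rep_det : forall a, \det (rep_mx a) = 1;
  rep_mul : forall a b, rep_mx (a * b)%g = rep_mx a *m rep_mx b
}.

Definition quasi_isometric_embedding (T U : Type) (dT : T -> T -> R)
    (dU : U -> U -> R) (f : T -> U) : Prop :=
  exists K c : R, [/\ 1 <= K, 0 <= c & forall x y,
    dT x y / K - c <= dU (f x) (f y) /\ dU (f x) (f y) <= K * dT x y + c].

Definition quasi_fuchsian g (rho : SL2_representation (surface_group g)) : Prop :=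
  forall M, hyp3 M ->
    quasi_isometric_embedding (@word_dist R g) hyp3_dist
      (fun a => hyp3_act (rho a) M).

(** * The space of geodesics, as the space of mixed planes *)

Definition mixed (P : {vspace Herm}) : Prop :=
  \dim P = 2 /\
  forall q, q \in P -> q != 0 -> ~ possemidef (herm_mx q).

(* A mixed plane stands for the geodesic of H^3 joining the two lines of C^2
   which are isotropic for all the forms of the plane. *)
Record geodesic := Geodesic {
  plane :> {vspace Herm};
  plane_mixed : mixed plane
}.

End Hermitian.

(** * Smooth maps and smooth surfaces *)

Section Smooth.
Variable R : realType.
Local Notation plane2 := 'rV[R]_2.
Local Notation Herm := 'rV[R]_4.

Fixpoint Ck_on (W : normedModType R) (k : nat) (O : set plane2)
    (f : plane2 -> W) : Prop :=
  if k is k'.+1 then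
    (forall y, O y -> differentiable f y) /\
    (forall v : plane2, Ck_on k' O (fun y => 'D_v f y))
  else forall y, O y -> {for y, continuous f}.

Definition smooth_on (W : normedModType R) (O : set plane2) (f : plane2 -> W) :
  Prop := forall k, Ck_on k O f.

Section Surface.
Variable T : topologicalType.

(* The value of the coordinate map outside of the domain is irrelevant. *)
Record chart := Chart {
  chart_dom : set T;
  chart_map : T -> plane2
}.

Definition chart_image (c : chart) : set plane2 :=
  chart_map c @` chart_dom c.

Definition is_chart (c : chart) : Prop :=
  [/\ open (chart_dom c),
      {in chart_dom c &, injective (chart_map c)},
      (forall x, chart_dom c x -> {for x, continuous (chart_map c)}) &
      (forall O, open O -> O `<=` chart_dom c -> open (chart_map c @` O))].

Definition oriented_compatible (c d : chart) : Prop :=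
  exists tau : plane2 -> plane2,
    [/\ (forall x, chart_dom c x -> chart_dom d x ->
           tau (chart_map c x) = chart_map d x),
        smooth_on (chart_map c @` (chart_dom c `&` chart_dom d)) tau &
        (forall x, chart_dom c x -> chart_dom d x ->
           0 < \det (jacobian tau (chart_map c x)))].

Definition oriented_smooth_atlas (A : set chart) : Prop :=
  [/\ (forall c, A c -> is_chart c),
      (forall x, exists2 c, A c & chart_dom c x) &
      (forall c d, A c -> A d -> oriented_compatible c d)].

Definition closed_oriented_surface (A : set chart) : Prop :=
  [/\ hausdorff_space T, compact [set: T], connected [set: T] &
      oriented_smooth_atlas A].

Definition simply_connected : Prop :=
  [/\ [set: T] !=set0,
      (forall x y : T, exists c : R -> T,
         [/\ {within `[0, 1], continuous c}, c 0 = x & c 1 = y]) &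
      (forall c : R -> T, {within `[0, 1], continuous c} -> c 0 = c 1 ->
         exists H : R * R -> T,
           [/\ {within `[0, 1] `*` `[0, 1], continuous H},
               (forall t, 0 <= t <= 1 -> H (0, t) = c t),
               (forall t, 0 <= t <= 1 -> H (1, t) = c 0) &
               (forall s, 0 <= s <= 1 -> H (s, 0) = c 0 /\ H (s, 1) = c 0)])].

End Surface.

Section Cover.
Variables (X S : topologicalType) (p : X -> S).

(* [F] is the set of sheets over [V]. *)
Definition evenly_covered (V : set S) : Prop :=
  exists F : set (set X),
    [/\ \bigcup_(W in F) W = p @^-1` V,
        trivIset F id &
        forall W, F W ->
          [/\ open W, {in W &, injective p}, p @` W = V &
              forall O, open O -> O `<=` W -> open (p @` O)]].

Definition covering_map : Prop :=
  [/\ continuous p, (forall s, exists x, p x = s) &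
      forall s, exists V, [/\ open V, V s & evenly_covered V]].

Definition universal_cover : Prop := covering_map /\ simply_connected X.

(* [act] identifies G with the group of deck transformations of the universal
   cover [p], hence with the fundamental group of [S]; a closed oriented surface
   [S] has genus g exactly when this is possible for G = Gamma_g. *)
Definition deck_action (G : groupType) (act : G -> X -> X) : Prop :=
  [/\ (forall x, act 1%g x = x) /\
        (forall a b x, act (a * b)%g x = act a (act b x)),
      (forall a, continuous (act a)),
      (forall x y, p x = p y <-> exists a, act a x = y) &
      (forall a x, act a x = x -> a = 1%g)].

(* The smooth structure on [X] for which [p] is a local diffeomorphism. *)
Definition lift_atlas (A : set (chart S)) : set (chart X) :=
  [set c | [/\ open (chart_dom c), {in chart_dom c &, injective p} &
     exists2 d, A d & p @` chart_dom c `<=` chart_dom d /\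
                      chart_map c = chart_map d \o p]].

End Cover.

(** * Fitting immersions *)

(* Smoothness of a map into the Grassmannian of planes of the space of
   Hermitian forms. *)
Definition smooth_gr_on (O : set plane2) (U : plane2 -> {vspace Herm}) :
    Prop :=
  forall y, O y -> exists (N : set plane2) (e f : plane2 -> Herm),
    [/\ open N, N y, smooth_on N e, smooth_on N f &
        forall z, N z -> \dim (U z) = 2 /\ U z = (<[e z]> + <[f z]>)%VS].

(* The differential dU_y(w), seen in Hom(P, H/P) with P = U y, maps v to [q]:
   it is computed by differentiating a local section of U through v. *)
Definition gr_differential (U : plane2 -> {vspace Herm}) (y w : plane2)
    (v q : Herm) : Prop :=
  exists (N : set plane2) (e : plane2 -> Herm),
    [/\ open N /\ N y, smooth_on N e, (forall z, N z -> e z \in U z),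
        e y = v & 'D_w e y - q \in U y].

Definition fitting_vector (U : plane2 -> {vspace Herm}) (y w : plane2) :
    Prop :=
  exists v q : Herm, posdef (herm_mx q) /\ gr_differential U y w v q.

Definition fitting_immersion_on (O : set plane2)
    (U : plane2 -> {vspace Herm}) : Prop :=
  [/\ smooth_gr_on O U,
      (forall y w, O y -> w != 0 ->
         ~ (forall v, v \in U y -> gr_differential U y w v 0)) &
      (forall y w, O y -> w != 0 -> fitting_vector U y w)].

Definition fitting_immersion (X : topologicalType) (A : set (chart X))
    (u : X -> geodesic R) : Prop :=
  forall c, A c -> exists U : plane2 -> {vspace Herm},
    (forall x, chart_dom c x -> U (chart_map c x) = plane (u x)) /\
    fitting_immersion_on (chart_image c) U.

Definition equivariant (X : Type) (G : groupType) (act : G -> X -> X)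
    (rho : SL2_representation R G) (u : X -> geodesic R) : Prop :=
  forall a x q, (herm_act (rho a) q \in plane (u (act a x))) =
                (q \in plane (u x)).

End Smooth.

(* Main.v *)
Require Import Defs.
From HB Require Import structures.
From mathcomp Require Import all_boot all_order all_algebra.
From mathcomp Require Import spectral generic_quotient complex.
From mathcomp Require Import all_classical all_reals all_analysis.
From mathcomp Require Import ring lra.

(* Let rho be the restriction of the reflection group of a necklace of N = 2g + 2 circles,
   consecutive ones orthogonal and the others disjoint, to a surface group of index 4.
   Words in the reflections have reduced forms along which the Lorentz form grows
   exponentially, so rho is quasi-Fuchsian; its two domains of discontinuity are the
   translates of the two sides of the necklace.

   Let u be an equivariant fitting immersion.  A point o of H^3 lies on the geodesic u(x)
   when the positive definite form o is orthogonal to the plane of x.  The fitting condition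
   makes these two equations in x nondegenerate, uniformly in o by compactness of the surface
   and equivariance, so the pairs (o, x) form a covering of the cone of positive definite
   forms.  The cone is convex and the space of pairs connected, hence every o lies on exactly
   one geodesic u(L o), with L continuous: the geodesics fiber H^3.  Their endpoints lie in the
   domains of discontinuity, by proper discontinuity of the deck action, and by connectedness
   each geodesic has one endpoint on each side of the limit set, both depending continuously
   on o.

   Apply this to the points o = diag(e, 1) of the axis from 0 to infinity: the endpoints z, w
   satisfy w = - e z / |z|^2.  The necklace follows the boundary of a band around a spiral
   polyline, with 0 in the middle of the spiral, and z moves continuously from 0 to infinity
   without touching the polyline, whereas w never lies in the fundamental region outside the
   band.  To get out of the spiral, z has to walk around the end of the polyline; on its way it
   is at a place where w is confined to the free room on the opposite side of 0, which is
   impossible. *)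

Set Implicit Arguments.
Unset Strict Implicit.
Unset Printing Implicit Defensive.

Import Order.TTheory GRing.Theory Num.Theory numFieldNormedType.Exports.
Local Open Scope classical_set_scope.
Local Open Scope ring_scope.

(** * Lorentz geometry of Hermitian forms *)

(** A point of the closed ball is a positive semidefinite form up to scale: [v v^*] is the boundary
    point given by the line of [v], and pairing it with a form q yields q(v). Lying on a geodesic is
    thus a linear condition on [o], whose solutions are convex and whose isotropic solutions are the
    endpoints. The obstacle is that the immersion is arbitrary: of a geodesic one knows only on
    which side of the limit set each endpoint lies. For a point of the axis the two endpoints
    moreover lie on opposite rays from 0, with |z||w| = e, and the spiral is sized for this
    relation. On its way out, z passes a gate at distance 20 on the left of 0 and later a door at
    distance at most sqrt(160). At the gate w lies about e / 20 to the right of 0, where the free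
    room extends to 24, so e must exceed 480; at the door the boundedness of the band keeps e below
    480. As e increases along the path, this is absurd. The genus is read off the drawing: the
    boundary of the band has 92 corners, each followed by an edge midpoint, and 2g + 2 = 184 gives g
    = 91. *)

Section Lorentz.
Variable R : realType.
Local Notation V := 'rV[R]_4.
Implicit Types (o a b v m : V).

Definition cp o : R := o 0 0.
Definition cr o : R := o 0 1.
Definition cs o : R := o 0 2%:R.
Definition ct o : R := o 0 3%:R.
Definition vec (p r s t : R) : V := \row_k [:: p; r; s; t]`_k.

Lemma cp_vec p r s t : cp (vec p r s t) = p. Proof. by rewrite /cp mxE. Qed.
Lemma cr_vec p r s t : cr (vec p r s t) = r. Proof. by rewrite /cr mxE. Qed.
Lemma cs_vec p r s t : cs (vec p r s t) = s. Proof. by rewrite /cs mxE. Qed.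
Lemma ct_vec p r s t : ct (vec p r s t) = t. Proof. by rewrite /ct mxE. Qed.
Definition vecE := (cp_vec, cr_vec, cs_vec, ct_vec).

Lemma cpD a b : cp (a + b) = cp a + cp b. Proof. by rewrite /cp mxE. Qed.
Lemma crD a b : cr (a + b) = cr a + cr b. Proof. by rewrite /cr mxE. Qed.
Lemma csD a b : cs (a + b) = cs a + cs b. Proof. by rewrite /cs mxE. Qed.
Lemma ctD a b : ct (a + b) = ct a + ct b. Proof. by rewrite /ct mxE. Qed.
Lemma cpN a : cp (- a) = - cp a. Proof. by rewrite /cp mxE. Qed.
Lemma crN a : cr (- a) = - cr a. Proof. by rewrite /cr mxE. Qed.
Lemma csN a : cs (- a) = - cs a. Proof. by rewrite /cs mxE. Qed.
Lemma ctN a : ct (- a) = - ct a. Proof. by rewrite /ct mxE. Qed.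
Lemma cpZ k a : cp (k *: a) = k * cp a. Proof. by rewrite /cp mxE. Qed.
Lemma crZ k a : cr (k *: a) = k * cr a. Proof. by rewrite /cr mxE. Qed.
Lemma csZ k a : cs (k *: a) = k * cs a. Proof. by rewrite /cs mxE. Qed.
Lemma ctZ k a : ct (k *: a) = k * ct a. Proof. by rewrite /ct mxE. Qed.
Lemma cp0 : cp 0 = 0. Proof. by rewrite /cp mxE. Qed.
Lemma cr0 : cr 0 = 0. Proof. by rewrite /cr mxE. Qed.
Lemma cs0 : cs 0 = 0. Proof. by rewrite /cs mxE. Qed.
Lemma ct0 : ct 0 = 0. Proof. by rewrite /ct mxE. Qed.
Definition coordE := (cpD, crD, csD, ctD, cpN, crN, csN, ctN,
  cpZ, crZ, csZ, ctZ, cp0, cr0, cs0, ct0, vecE).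

Lemma ord4P (i : 'I_4) : [\/ i = 0, i = 1, i = 2%:R | i = 3%:R].
Proof.
case: i => -[|[|[|[|//]]]] h.
- by constructor 1; apply/val_inj.
- by constructor 2; apply/val_inj.
- by constructor 3; apply/val_inj.
- by constructor 4; apply/val_inj.
Qed.

Lemma vec_ext a b : cp a = cp b -> cr a = cr b -> cs a = cs b -> ct a = ct b ->
  a = b.
Proof. by move=> ? ? ? ?; apply/rowP => i; case: (ord4P i) => ->. Qed.

(* The polarization of twice the determinant. *)
Definition bil a b : R := cp a * cr b + cr a * cp b - 2 * cs a * cs b
  - 2 * ct a * ct b.
Definition tr o : R := cp o + cr o.

Lemma bilC a b : bil a b = bil b a. Proof. rewrite /bil; ring. Qed.
Lemma bilDl a b v : bil (a + b) v = bil a v + bil b v.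
Proof. rewrite /bil !coordE; ring. Qed.
Lemma bilDr a b v : bil v (a + b) = bil v a + bil v b.
Proof. rewrite /bil !coordE; ring. Qed.
Lemma bilZl k a v : bil (k *: a) v = k * bil a v.
Proof. rewrite /bil !coordE; ring. Qed.
Lemma bilZr k a v : bil v (k *: a) = k * bil v a.
Proof. rewrite /bil !coordE; ring. Qed.
Lemma bilNl a v : bil (- a) v = - bil a v.
Proof. rewrite /bil !coordE; ring. Qed.
Lemma bilNr a v : bil v (- a) = - bil v a.
Proof. rewrite /bil !coordE; ring. Qed.
Lemma trD a b : tr (a + b) = tr a + tr b. Proof. rewrite /tr !coordE; ring. Qed.
Lemma trZ k a : tr (k *: a) = k * tr a. Proof. rewrite /tr !coordE; ring. Qed.

Definition psd o := [/\ 0 <= cp o, 0 <= cr o & 0 <= bil o o].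
Definition pd o := [/\ 0 < cp o, 0 < cr o & 0 < bil o o].

Lemma pd_psd o : pd o -> psd o.
Proof. by case=> *; split; apply: ltW. Qed.

Lemma ler_of_sqr (x y : R) : 0 <= x -> y ^+ 2 <= x ^+ 2 -> y <= x.
Proof.
move=> x0 h; case: (leP y 0) => [y0|y0]; first exact: le_trans y0 x0.
by rewrite -(@ler_pXn2r _ 2) // nnegrE // ltW.
Qed.

(** Cauchy-Schwarz in the last two coordinates, followed by the inequality between the arithmetic
    and geometric means of [cp a * cr b] and [cr a * cp b]. *)
Lemma psd_bil a b : psd a -> psd b -> 0 <= bil a b.
Proof.
case=> p r d [p' r' d'].
suff : 2 * cs a * cs b + 2 * ct a * ct b <= cp a * cr b + cr a * cp b.
  by rewrite /bil; lra.
apply: ler_of_sqr; first by apply: addr_ge0; apply: mulr_ge0.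
have h1 : (cs a * cs b + ct a * ct b) ^+ 2 <=
  (cs a ^+ 2 + ct a ^+ 2) * (cs b ^+ 2 + ct b ^+ 2).
  rewrite -subr_ge0.
  have -> : (cs a ^+ 2 + ct a ^+ 2) * (cs b ^+ 2 + ct b ^+ 2) -
    (cs a * cs b + ct a * ct b) ^+ 2 = (cs a * ct b - ct a * cs b) ^+ 2 by ring.
  exact: sqr_ge0.
have h2 : (cs a ^+ 2 + ct a ^+ 2) * (cs b ^+ 2 + ct b ^+ 2) <=
   (cp a * cr a) * (cp b * cr b).
  apply: ler_pM; rewrite ?addr_ge0 ?sqr_ge0 //.
    by move: d; rewrite /bil; lra.
  by move: d'; rewrite /bil; lra.
have h3 : 0 <= (cp a * cr b - cr a * cp b) ^+ 2 by exact: sqr_ge0.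
have -> : (2 * cs a * cs b + 2 * ct a * ct b) ^+ 2 =
  4 * (cs a * cs b + ct a * ct b) ^+ 2 by ring.
have : (cp a * cr b + cr a * cp b) ^+ 2 = (cp a * cr b - cr a * cp b) ^+ 2 +
   4 * (cp a * cr a * (cp b * cr b)) by ring.
lra.
Qed.

Lemma psdD a b : psd a -> psd b -> psd (a + b).
Proof.
move=> ha hb; have := psd_bil ha hb; case: ha => p r d; case: hb => p' r' d' h.
split; [by rewrite coordE addr_ge0|by rewrite coordE addr_ge0|].
by rewrite bilDl !bilDr (bilC b a); lra.
Qed.

Lemma psdZ k a : 0 <= k -> psd a -> psd (k *: a).
Proof.
by move=> k0 [p r d]; split; rewrite ?bilZl ?bilZr ?coordE; do ?apply: mulr_ge0.
Qed.

Lemma pdZ k a : 0 < k -> pd a -> pd (k *: a).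
Proof.
by move=> k0 [p r d]; split; rewrite ?bilZl ?bilZr ?coordE; do ?apply: mulr_gt0.
Qed.

Lemma pdDl a b : pd a -> psd b -> pd (a + b).
Proof.
move=> ha hb; have := psd_bil (pd_psd ha) hb; case: ha => p r d; case: hb => p' r' d' h.
split; [by rewrite coordE ltr_wpDr|by rewrite coordE ltr_wpDr|].
by rewrite bilDl !bilDr (bilC b a); lra.
Qed.

Lemma pdDr a b : psd a -> pd b -> pd (a + b).
Proof. by move=> ha hb; rewrite addrC; apply: pdDl. Qed.

(** On the cone the trace dominates every coordinate and serves as a norm. *)
Lemma psd_coord o : psd o -> [/\ cp o <= tr o, cr o <= tr o,
  `|cs o| <= tr o & `|ct o| <= tr o].
Proof.
move=> [p r d]; rewrite /tr; move: d; rewrite /bil => d.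
have h : cs o ^+ 2 + ct o ^+ 2 <= (cp o + cr o) ^+ 2 by nra.
have s0 := sqr_ge0 (cs o); have t0 := sqr_ge0 (ct o).
split; [lra|lra| |]; apply: ler_of_sqr; rewrite ?addr_ge0 // real_normK ?num_real //; lra.
Qed.

Lemma psd_tr o : psd o -> 0 <= tr o.
Proof. by case=> p r _; rewrite /tr addr_ge0. Qed.

Lemma psd_tr0 o : psd o -> tr o = 0 -> o = 0.
Proof.
move=> h t0; have [h1 h2 h3 h4] := psd_coord h; case: h => p r _.
rewrite t0 in h1 h2 h3 h4.
apply: vec_ext; rewrite !coordE; try lra; apply/eqP;
  by rewrite -normr_eq0 eq_le normr_ge0 andbT.
Qed.

Lemma psd_tr_gt0 o : psd o -> o != 0 -> 0 < tr o.
Proof.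
move=> h n0; rewrite lt_neqAle psd_tr // andbT eq_sym.
by apply: contraNneq n0 => /(psd_tr0 h) ->.
Qed.

Lemma pd_tr o : pd o -> 0 < tr o.
Proof. by case=> p r _; rewrite /tr addr_gt0. Qed.

Lemma pd_neq0 o : pd o -> o != 0.
Proof. by case=> p _ _; apply: contraTneq p => ->; rewrite coordE ltxx. Qed.

Definition idv : V := vec 1 1 0 0.

Lemma bil_idv o : bil o idv = tr o.
Proof. rewrite /bil /tr /idv !coordE; ring. Qed.

Lemma pd_idv : pd idv.
Proof. by split; rewrite /idv /bil !coordE ?ltr01 //; lra. Qed.

Lemma pd_lower m : pd m -> exists2 c, 0 < c & psd (m - c *: idv).
Proof.
(* Determinant over trace: for eigenvalues x and y this is xy / (x + y), which is below both of
   them. *)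
case=> p r d; exists (bil m m / 2 / tr m).
  by rewrite !divr_gt0 // /tr addr_gt0.
have t0 : 0 < tr m by rewrite /tr addr_gt0.
set c := _ / _; have hc : c * tr m = bil m m / 2 by rewrite /c divfK // gt_eqF.
have c0 : 0 < c by rewrite /c !divr_gt0.
have s0 := sqr_ge0 (cs m); have u0 := sqr_ge0 (ct m).
have hb : bil m m / 2 <= cp m * cr m by rewrite /bil; lra.
split.
- rewrite /idv !coordE -(ler_pM2r t0) mul0r mulr1 mulrBl hc /tr.
  have := sqr_ge0 (cp m); nra.
- rewrite /idv !coordE -(ler_pM2r t0) mul0r mulr1 mulrBl hc /tr.
  have := sqr_ge0 (cr m); nra.
- rewrite bilDl !bilDr !bilNl !bilNr !bilZl !bilZr (bilC idv m) !bil_idv hc.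
  have -> : tr idv = 2 :> R by rewrite /tr /idv !coordE; lra.
  have : 0 < c * c by rewrite mulr_gt0.
  lra.
Qed.

Lemma pd_bil_lower m : pd m ->
  exists2 c, 0 < c & forall b, psd b -> c * tr b <= bil m b.
Proof.
move=> /pd_lower [c c0 h]; exists c => // b hb.
have := psd_bil h hb; rewrite bilDl bilNl bilZl (bilC idv) bil_idv; lra.
Qed.

Lemma pd_bil_upper m : pd m ->
  exists2 c, 0 < c & forall b, psd b -> bil m b <= c * tr b.
Proof.
move=> h; exists (5 * tr m); first by rewrite mulr_gt0 ?pd_tr.
move=> b hb; have [h1 h2 h3 h4] := psd_coord hb.
have [g1 g2 g3 g4] := psd_coord (pd_psd h).
have e1 : - (cs m * cs b) <= tr m * tr b.
  by apply: le_trans (ler_norm _) _; rewrite normrN normrM ler_pM.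
have e2 : - (ct m * ct b) <= tr m * tr b.
  by apply: le_trans (ler_norm _) _; rewrite normrN normrM ler_pM.
case: h => p r _; case: hb => p' r' _.
have e3 : cp m * cr b + cr m * cp b <= tr m * tr b.
  rewrite -subr_ge0 /tr.
  have -> : (cp m + cr m) * (cp b + cr b) - (cp m * cr b + cr m * cp b) =
    cp m * cp b + cr m * cr b by ring.
  by rewrite addr_ge0 // mulr_ge0 // ltW.
rewrite /bil; lra.
Qed.

Lemma pd_lower_pd m : pd m -> exists2 c, 0 < c & pd (m - c *: idv).
Proof.
move=> /pd_lower [c c0 h]; exists (c / 2); first by rewrite divr_gt0.
have -> : m - (c / 2) *: idv = (c / 2) *: idv + (m - c *: idv).
  by apply: vec_ext; rewrite !coordE; lra.
by apply: pdDl => //; apply: pdZ; [rewrite divr_gt0|exact: pd_idv].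
Qed.

(* The trace-normalized positive semidefinite forms make up a round ball, whence
   the quadratic lower bound. *)
Lemma psd_bil_dist a b : tr a = tr b -> psd a -> psd b ->
  (cp a - cp b) ^+ 2 + (cs a - cs b) ^+ 2 + (ct a - ct b) ^+ 2 <= bil a b.
Proof.
move=> e [_ _ d] [_ _ d'].
have : cr b = cp a + cr a - cp b by move: e; rewrite /tr; lra.
move: d d'; rewrite /bil => d d' h; move: d'; rewrite h => d'; nra.
Qed.

End Lorentz.

(** * Necklaces of circles and their reflection groups *)

Section Reflections.
Variable R : realType.
Local Notation V := 'rV[R]_4.

Record circle := Circle { ccx : R; ccy : R; csq : R }.

(** The spacelike vector dual to the plane of H^3 above the circle. At the isotropic vector with
    coordinates (x^2 + y^2, 1, x, y), which represents the point (x, y), [power] is the squared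
    radius minus the squared distance to the centre; it is positive inside the disc. *)
Definition normal (c : circle) : V :=
  vec (csq c - ccx c ^+ 2 - ccy c ^+ 2) (-1) (- ccx c) (- ccy c).

Definition power (c : circle) (o : V) : R := bil o (normal c).

(** As [normal c] has norm [- 2 * csq c], this is the Lorentz reflection o - 2 <o, n> / <n, n> n; on
    isotropic vectors it is the inversion in the circle. *)
Definition refl (c : circle) (o : V) : V := o + (power c o / csq c) *: normal c.

Lemma bil_normal c c' : bil (normal c) (normal c') =
  (ccx c - ccx c') ^+ 2 + (ccy c - ccy c') ^+ 2 - csq c - csq c'.
Proof. rewrite /bil /normal !vecE; ring. Qed.

Lemma powerE c o : power c o = csq c * cr o -
  (cp o - 2 * ccx c * cs o - 2 * ccy c * ct o + (ccx c ^+ 2 + ccy c ^+ 2) * cr o).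
Proof. rewrite /power /bil /normal !vecE; ring. Qed.

Lemma powerD c a b : power c (a + b) = power c a + power c b.
Proof. exact: bilDl. Qed.
Lemma powerZ c k a : power c (k *: a) = k * power c a.
Proof. exact: bilZl. Qed.

Section OneCircle.
Variables (c : circle) (c0 : 0 < csq c).

Lemma bil_normal_self : bil (normal c) (normal c) = - 2 * csq c.
Proof. rewrite bil_normal; ring. Qed.

Lemma power_refl c' o : power c' (refl c o) =
  power c' o + power c o / csq c * bil (normal c) (normal c').
Proof. by rewrite /refl powerD powerZ. Qed.

Lemma power_refl_self o : power c (refl c o) = - power c o.
Proof. rewrite power_refl bil_normal_self; field; exact: lt0r_neq0. Qed.

Lemma reflK : involutive (refl c).
Proof.
move=> o; rewrite {1}/refl power_refl_self /refl -addrA -scalerDl -mulrDl subrr.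
by rewrite mul0r scale0r addr0.
Qed.

Lemma reflD a b : refl c (a + b) = refl c a + refl c b.
Proof. by rewrite /refl powerD mulrDl scalerDl addrACA. Qed.

Lemma reflZ k a : refl c (k *: a) = k *: refl c a.
Proof. by rewrite /refl powerZ scalerDr scalerA mulrA. Qed.

Lemma bil_refl a b : bil (refl c a) (refl c b) = bil a b.
Proof.
rewrite /refl bilDl !bilDr !bilZl !bilZr (bilC (normal c) b) bil_normal_self /power.
field; exact: lt0r_neq0.
Qed.

Lemma bil_refl_move a b : bil a (refl c b) = bil a b + power c a * power c b / csq c.
Proof. rewrite /refl bilDr bilZr -/(power c a); ring. Qed.

Lemma refl_id o : power c o = 0 -> refl c o = o.
Proof. by move=> h; rewrite /refl h mul0r scale0r addr0. Qed.

(** An isometry preserves the cone or exchanges it with its opposite. The pairing with a positive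
    definite [b] tells the two cases apart, and [b] is taken on the mirror, where the reflection
    does not affect the pairing. *)
Lemma psd_refl o : psd o -> psd (refl c o).
Proof.
move=> h; have [p r d] := h.
have e : bil (refl c o) (refl c o) = bil o o by rewrite bil_refl.
have key b : psd b -> pd b -> 0 <= bil b (refl c o) -> psd (refl c o).
  move=> _ hb hn.
  have d' : 0 <= bil (refl c o) (refl c o) by rewrite e.
  have : ~ (cp (refl c o) < 0 \/ cr (refl c o) < 0).
    move=> hneg; set v := refl c o in d' hn hneg.
    have [k k0 hk] := pd_bil_lower hb.
    have : psd (- v).
      have d2 : 0 <= cp v * cr v.
        by move: d'; rewrite /bil; have := sqr_ge0 (cs v); have := sqr_ge0 (ct v); lra.
      have d3 : cs v ^+ 2 + ct v ^+ 2 <= cp v * cr v by move: d'; rewrite /bil; lra.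
      split; rewrite ?cpN ?crN.
      - case: hneg => hneg; first lra.
        by rewrite oppr_ge0 leNgt; apply/negP => hp; move: d2; rewrite leNgt nmulr_llt0 ?hp.
      - case: hneg => hneg; last lra.
        by rewrite oppr_ge0 leNgt; apply/negP => hp; move: d2; rewrite leNgt nmulr_rlt0 ?hp.
      - by rewrite bilNl bilNr opprK.
    move=> hnv; have := hk _ hnv; rewrite bilNr.
    have : 0 < tr (- v).
      apply: psd_tr_gt0 => //; apply/eqP => v0.
      have : v = 0 by rewrite -(opprK v) v0 oppr0.
      by move=> v00; case: hneg; rewrite v00 coordE ltxx.
    by move=> t0; have := mulr_gt0 k0 t0; lra.
  by move=> hn'; split => //; rewrite leNgt; apply/negP => hl; apply: hn'; auto.
(* The top of the hemisphere above the circle, a point of the mirror. *)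
pose b : V := vec (ccx c ^+ 2 + ccy c ^+ 2 + csq c) 1 (ccx c) (ccy c).
have hb : pd b.
  split; rewrite /b ?vecE.
  - have := sqr_ge0 (ccx c); have := sqr_ge0 (ccy c); move: c0; lra.
  - exact: ltr01.
  - rewrite /bil !vecE; move: c0; lra.
apply: (key b) => //; first exact: pd_psd.
rewrite bil_refl_move.
have -> : power c b = 0 by rewrite powerE /b !vecE; ring.
by rewrite !mul0r addr0; apply: psd_bil => //; exact: pd_psd.
Qed.

Lemma pd_refl o : pd o -> pd (refl c o).
Proof.
move=> h; have [p r d] := psd_refl (pd_psd h).
have d' : 0 < bil (refl c o) (refl c o) by rewrite bil_refl; case: h.
have : 0 < cp (refl c o) * cr (refl c o).
  by move: d'; rewrite /bil; have := sqr_ge0 (cs (refl c o)); have := sqr_ge0 (ct (refl c o)); nra.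
by move=> h1; split => //; rewrite lt_neqAle ?p ?r andbT eq_sym;
  apply: contraTneq h1 => ->; rewrite ?mul0r ?mulr0 ltxx.
Qed.

Lemma refl_neq0 o : o != 0 -> refl c o != 0.
Proof.
apply: contraNneq => h; rewrite -(reflK o) h /refl /power /bil !coordE.
by rewrite !(mul0r, mulr0, subr0, addr0, scale0r).
Qed.

End OneCircle.

Lemma refl_comm c c' o : bil (normal c) (normal c') = 0 ->
  refl c (refl c' o) = refl c' (refl c o).
Proof.
move=> h; rewrite /refl !powerD !powerZ /power (bilC (normal c')) h !mulr0 !addr0.
by rewrite addrAC.
Qed.

(* Two circles with disjoint interiors: [normal c' + a normal c] is timelike for
   the ratio [a] of the radii. *)
Lemma power_far c c' : 0 < csq c -> 0 < csq c' ->
  0 < bil (normal c) (normal c') ->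
  4 * csq c * csq c' < bil (normal c) (normal c') ^+ 2 ->
  exists2 k, 0 < k & forall o, psd o -> 0 <= power c o -> power c' o <= - k * tr o.
Proof.
move=> c0 c0' b0 b1; set b := bil _ _ in b0 b1.
pose a := Num.sqrt (csq c' / csq c).
have a0 : 0 < a by rewrite sqrtr_gt0 divr_gt0.
have a2 : a ^+ 2 * csq c = csq c'.
  by rewrite sqr_sqrtr ?divfK ?gt_eqF // ltW // divr_gt0.
pose m : V := - (normal c' + a *: normal c).
have mm : bil m m = 2 * (a * b - 2 * csq c').
  rewrite /m bilNl bilNr opprK bilDl !bilDr !bilZl !bilZr (bilC (normal c')) -/b.
  rewrite !bil_normal_self -a2; ring.
have ab : 2 * csq c' < a * b.
  rewrite -(@ltr_pXn2r _ 2) ?nnegrE ?mulr_ge0 ?ltW //.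
  have -> : (2 * csq c') ^+ 2 = a ^+ 2 * (4 * csq c * csq c').
    by rewrite (_ : a ^+ 2 * _ = 4 * (a ^+ 2 * csq c) * csq c'); [rewrite a2; ring|ring].
  by rewrite exprMn ltr_pM2l // exprn_gt0.
have m0 : 0 < bil m m by rewrite mm mulr_gt0 // subr_gt0.
have r0 : 0 < cr m by rewrite /m !coordE; lra.
have hm : pd m.
  split => //; rewrite -(pmulr_lgt0 _ r0).
  by move: m0; rewrite /bil; have := sqr_ge0 (cs m); have := sqr_ge0 (ct m); nra.
have [k k0 hk] := pd_bil_lower hm; exists k => // o ho p0.
have := hk _ ho; rewrite bilC /m bilNr bilDr bilZr -!/(power _ _).
have : 0 <= a * power c o by rewrite mulr_ge0 // ltW.
lra.
Qed.

Lemma fin_pos_min (I : finType) (P : I -> R -> Prop) :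
  (forall i, exists2 k, 0 < k & P i k) ->
  (forall i k k', 0 < k' -> k' <= k -> P i k -> P i k') ->
  exists2 k, 0 < k & forall i, P i k.
Proof.
move=> h mono.
have [f hf] : {f : I -> R & forall i, 0 < f i /\ P i (f i)}.
  by apply: (choice (P := fun i k => 0 < k /\ P i k)) => i; have [k] := h i; exists k.
exists (\big[Order.min/1]_i f i).
  by elim/big_ind : _ => // [x y x0 y0|i _]; [rewrite lt_min x0|case: (hf i)].
move=> i; apply: (mono _ (f i)); last by case: (hf i).
  by elim/big_ind : _ => // [x y x0 y0|j _]; [rewrite lt_min x0|case: (hf j)].
by rewrite (bigD1 i) //= ge_min lexx.
Qed.

End Reflections.

(** * The right-angled Coxeter group of a necklace: normal forms, growth, tame vectors *)

Section ReflectionGroup.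
Variable R : realType.
Local Notation V := 'rV[R]_4.

(* [next_orth]: neighbours are orthogonal; [next_far]: all other pairs of closed discs
   are disjoint. *)
Record necklace (L : finType) := Necklace {
  bead :> L -> circle R;
  nextto : rel L;
  base : V;
  csq_gt0 : forall i, 0 < csq (bead i);
  next_sym : symmetric nextto;
  next_irr : irreflexive nextto;
  next_trig : forall i j k, nextto i j -> nextto j k -> ~~ nextto i k;
  next_orth : forall i j, nextto i j -> bil (normal (bead i)) (normal (bead j)) = 0;
  next_far : forall i j, i != j -> ~~ nextto i j ->
    0 < bil (normal (bead i)) (normal (bead j)) /\
    4 * csq (bead i) * csq (bead j) < bil (normal (bead i)) (normal (bead j)) ^+ 2;
  base_pd : pd base;
  base_out : forall i, power (bead i) base < 0
}.

(** The defining relations of the right-angled Coxeter group of the graph [nx]. *)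
Inductive weq (L : finType) (nx : rel L) : seq L -> seq L -> Prop :=
| weq_refl w : weq nx w w
| weq_sym v w : weq nx v w -> weq nx w v
| weq_trans u v w : weq nx u v -> weq nx v w -> weq nx u w
| weq_cancel i v w : weq nx (v ++ i :: i :: w) (v ++ w)
| weq_swap i j v w : nx i j -> weq nx (v ++ i :: j :: w) (v ++ j :: i :: w).

Lemma weq_cons (L : finType) (nx : rel L) i v w : weq nx v w -> weq nx (i :: v) (i :: w).
Proof.
elim=> {v w} [w|v w _ IH|u v w _ IH _ IH'|j v w|j k v w h].
- exact: weq_refl.
- exact: weq_sym.
- exact: weq_trans IH IH'.
- exact: (weq_cancel nx j (i :: v) w).
- exact: (weq_swap (i :: v) w h).
Qed.

Variables (L : finType) (C : necklace L).
Local Notation "i ~~> j" := (nextto C i j) (at level 70).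
Local Notation o0 := (base C).
Implicit Types (i j l : L) (w : seq L) (o v x : V).

Definition act w o : V := foldr (fun i => refl (C i)) o w.

Lemma act_cat w w' o : act (w ++ w') o = act w (act w' o).
Proof. exact: foldr_cat. Qed.

Lemma act_revK w o : act (rev w) (act w o) = o.
Proof.
elim: w o => //= i w IH o; rewrite rev_cons -cats1 act_cat /= reflK ?IH //.
exact: csq_gt0.
Qed.

Lemma act_Krev w o : act w (act (rev w) o) = o.
Proof. by rewrite -{1}(revK w) act_revK. Qed.

Lemma actD w a b : act w (a + b) = act w a + act w b.
Proof. by elim: w => //= i w ->; rewrite reflD. Qed.

Lemma actZ w k a : act w (k *: a) = k *: act w a.
Proof. by elim: w => //= i w ->; rewrite reflZ. Qed.

Lemma bil_act w a b : bil (act w a) (act w b) = bil a b.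
Proof. by elim: w => //= i w <-; rewrite bil_refl //; exact: csq_gt0. Qed.

Lemma psd_act w o : psd o -> psd (act w o).
Proof. by move=> h; elim: w => //= i w IH; apply: psd_refl => //; exact: csq_gt0. Qed.

Lemma pd_act w o : pd o -> pd (act w o).
Proof. by move=> h; elim: w => //= i w IH; apply: pd_refl => //; exact: csq_gt0. Qed.

Lemma act_neq0 w o : o != 0 -> act w o != 0.
Proof. by move=> h; elim: w => //= i w IH; apply: refl_neq0 => //; exact: csq_gt0. Qed.

Lemma weq_act w w' o : weq (nextto C) w w' -> act w o = act w' o.
Proof.
elim=> {w w'} [w|w w' _ IH|u w w' _ IH _ IH'|i w w'|i j w w' h] //.
- by rewrite IH IH'.
- by rewrite !act_cat /= reflK //; exact: csq_gt0.
- by rewrite !act_cat /= refl_comm //; exact: next_orth.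
Qed.

Lemma power_next i j o : i ~~> j -> power (C i) (refl (C j) o) = power (C i) o.
Proof.
by move=> h; rewrite power_refl next_orth ?mulr0 ?addr0 // next_sym.
Qed.

Lemma power_self i o : power (C i) (refl (C i) o) = - power (C i) o.
Proof. by rewrite power_refl_self //; exact: csq_gt0. Qed.

Lemma far_bound : exists2 k, 0 < k & forall i j o, i != j -> ~~ (i ~~> j) ->
  psd o -> 0 <= power (C i) o -> power (C j) o <= - k * tr o.
Proof.
have [] := @fin_pos_min R (L * L)%type (fun ij k => ij.1 != ij.2 -> ~~ (ij.1 ~~> ij.2) ->
  forall o, psd o -> 0 <= power (C ij.1) o -> power (C ij.2) o <= - k * tr o).
- move=> [i j] /=; have [->|ij] := eqVneq i j; first by exists 1.
  have [h|h] := boolP (i ~~> j); first by exists 1.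
  have [b0 b1] := next_far ij h.
  by have [k k0 hk] := power_far (csq_gt0 C i) (csq_gt0 C j) b0 b1; exists k.
- move=> [i j] k k' k0 kk' h ij nij o ho hp.
  apply: (le_trans (h ij nij o ho hp)); rewrite !mulNr lerN2.
  by rewrite ler_wpM2r ?psd_tr.
- by move=> k k0 h; exists k => // i j o ij nij; exact: (h (i, j)).
Qed.

Lemma far_neg i j o : i != j -> ~~ (i ~~> j) -> psd o -> o != 0 ->
  0 <= power (C i) o -> power (C j) o < 0.
Proof.
move=> ij nij ho o_0 hp; have [k k0 h] := far_bound.
apply: le_lt_trans (h _ _ _ ij nij ho hp) _.
by rewrite mulNr oppr_lt0 mulr_gt0 // psd_tr_gt0.
Qed.

Lemma far_neg_refl i j o : i != j -> ~~ (i ~~> j) -> psd o -> o != 0 ->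
  power (C i) o <= 0 -> power (C j) (refl (C i) o) < 0.
Proof.
have g := csq_gt0 C; move=> ij nij ho o_0 hp.
apply: (far_neg ij nij (psd_refl (g i) ho) (refl_neq0 (g i) o_0)).
by rewrite power_self oppr_ge0.
Qed.

Definition chamber v := forall i, power (C i) v <= 0.

(* Every reflection moves the base point across one more wall. *)
Fixpoint good w : Prop :=
  if w is i :: w' then good w' /\ power (C i) (act w' o0) < 0 else True.

Let base_psd : psd o0. Proof. exact/pd_psd/base_pd. Qed.
Let base_neq0 : o0 != 0. Proof. exact/pd_neq0/base_pd. Qed.

(** The exchange property of Coxeter groups. Against the first letter [j] of [w], a letter [i]
    adjacent to [j] commutes past it; if it is neither equal nor adjacent to [j], the image of the
    base point lies in the disc of [j], which is disjoint from that of [i]. The first alternative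
    locates the image of the whole chamber, as [chamber_fixed] requires. *)
Lemma good_dichotomy w i : good w ->
  (power (C i) (act w o0) < 0 /\
   forall v, psd v -> v != 0 -> chamber v -> power (C i) (act w v) <= 0) \/
  exists w', [/\ weq (nextto C) w (i :: w'), good w', (size w' < size w)%N &
    power (C i) (act w' o0) < 0].
Proof.
elim: w i => [|j w IH] i /=.
  by move=> _; left; split; [exact: base_out|move=> v _ _; exact].
move=> [gw hj]; have [->|ij] := eqVneq i j.
  by right; exists w; split => //; exact: weq_refl.
have [aij|nij] := boolP (i ~~> j).
  case: (IH i gw) => [[h1 h2]|[w' [e gw' sw' h]]].
    by left; split=> [|v hv v0 cv]; rewrite power_next //; apply: h2.
  right; exists (j :: w'); split => //=.
  - apply: (weq_trans (weq_cons _ e)); apply: (@weq_swap _ _ j i [::]).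
    by rewrite next_sym.
  - split=> //; move: hj; rewrite (weq_act _ e) /= power_next // next_sym //.
  - by rewrite power_next.
left; have nji : ~~ (j ~~> i) by rewrite next_sym.
have ji : j != i by rewrite eq_sym.
split.
  by apply: (far_neg_refl ji nji (psd_act w base_psd) (act_neq0 w base_neq0) (ltW hj)).
move=> v hv v0 cv; apply/ltW/(far_neg_refl ji nji (psd_act w hv) (act_neq0 w v0)).
case: (IH j gw) => [[_ h2]|[w' [e gw' sw' h]]]; first exact: h2.
by move: hj; rewrite (weq_act _ e) /= power_self oppr_lt0 => /(lt_trans h); rewrite ltxx.
Qed.

Lemma good_word w : exists w', [/\ weq (nextto C) w w', good w' & (size w' <= size w)%N].
Proof.
elim: w => [|i w [w' [e g s]]]; first by exists [::]; split => //; exact: weq_refl.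
case: (good_dichotomy i g) => [[h _]|[v [e' g' s' h]]].
  by exists (i :: w'); split => //; exact: weq_cons.
exists v; split => //; last by rewrite /= ltnW // ltnS (leq_trans (ltnW s')).
apply: weq_trans (weq_cons i (weq_trans e e')) _.
exact: (@weq_cancel _ _ i [::]).
Qed.

Lemma chamber_fixed w v : psd v -> v != 0 -> chamber v -> chamber (act w v) ->
  act w v = v.
Proof.
move=> hv v0 cv; have [w' [e g _]] := good_word w; rewrite (weq_act _ e).
elim: w' g {w e} => //= i w IH [gw hi] cw.
case: (good_dichotomy i gw) => [[_ h]|[w' [e gw' sw' h]]]; last first.
  by move: hi; rewrite (weq_act _ e) /= power_self oppr_lt0 => /(lt_trans h); rewrite ltxx.
have := h _ hv v0 cv => h1; have := cw i; rewrite power_self oppr_le0 => h2.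
have h3 : power (C i) (act w v) = 0 by apply/eqP; rewrite eq_le h1.
by move: cw; rewrite refl_id // => cw; apply: IH.
Qed.

Lemma base_step i x : power (C i) x <= 0 -> bil o0 x <= bil o0 (refl (C i) x).
Proof.
move=> h; rewrite bil_refl_move ler_wpDr // divr_ge0 //; last exact/ltW/csq_gt0.
by apply: mulr_le0 => //; exact/ltW/base_out.
Qed.

(** A point inside the disc [i] is far outside any disc [j] disjoint from it, so the reflection in
    [j] takes it away from the base point by a definite factor. *)
Lemma base_growth : exists2 k, 0 < k & forall i j x, i != j -> ~~ (i ~~> j) ->
  psd x -> 0 <= power (C i) x -> (1 + k) * bil o0 x <= bil o0 (refl (C j) x).
Proof.
have [k k0 hk] := far_bound.
have [c c0 hc] := pd_bil_upper (base_pd C).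
have [i|i x y _ yx h|d d0 hd] :=
  @fin_pos_min R L (fun i d => d <= - power (C i) o0 / csq (C i)).
- exists (- power (C i) o0 / csq (C i)) => //.
  by rewrite divr_gt0 ?csq_gt0 // oppr_gt0 base_out.
- exact: le_trans h.
exists (k * d / c); first by rewrite divr_gt0 // mulr_gt0.
move=> i j x ij nij hx hp; have h1 := hk _ _ _ ij nij hx hp.
rewrite bil_refl_move mulrDl mul1r lerD2l.
have -> : power (C j) o0 * power (C j) x / csq (C j) =
  (- power (C j) o0 / csq (C j)) * (- power (C j) x) by field; rewrite gt_eqF ?csq_gt0.
apply: le_trans (_ : d * (k * tr x) <= _); last first.
  by apply: ler_pM => //; [exact: ltW|by rewrite mulr_ge0 ?psd_tr ?(ltW k0)|by rewrite lerNr -mulNr].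
rewrite -(ler_pM2r c0) (_ : k * d / c * bil o0 x * c = d * k * bil o0 x); last first.
  by field; rewrite gt_eqF.
rewrite (_ : d * (k * tr x) * c = d * k * (c * tr x)); last by ring.
by rewrite ler_wpM2l ?hc // mulr_ge0 // ltW.
Qed.

(** Two adjacent letters in succession may bring no definite gain, hence the halved exponent.
    Letters are taken off by two: in [i :: j :: l :: w] one of the pairs (l, j), (j, i), (l, i) is
    not adjacent, as the graph has no triangle, and [base_growth] applies to that pair. *)
Lemma good_growth : exists2 k, 0 < k & forall w, good w ->
  (1 + k) ^+ ((size w).-1)./2 * bil o0 o0 <= bil o0 (act w o0).
Proof.
have [k k0 hk] := base_growth; exists k => // w.
have n0 : 0 <= bil o0 o0 by case: base_psd.
have step w' : good w' -> bil o0 o0 <= bil o0 (act w' o0).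
  by elim: w' => //= i w' IH [g h]; apply: le_trans (IH g) _; apply: base_step; exact: ltW.
have [n] := ubnP (size w); elim: n w => // n IH [|i [|j [|l w]]] /= sw.
- by rewrite expr0 mul1r.
- by rewrite expr0 mul1r => -[g h]; apply: (step [:: i]).
- by rewrite expr0 mul1r => g; apply: (step [:: i; j]).
move=> [[[g hl] hj] hi].
have IHl : (1 + k) ^+ (size w)./2 * bil o0 o0 <= bil o0 (act (l :: w) o0).
  by apply: (IH (l :: w)) => //; rewrite -ltnS (leq_trans _ sw) // ltnS.
rewrite exprS -mulrA; apply: le_trans (_ : (1 + k) * bil o0 (act (l :: w) o0) <= _).
  by rewrite ler_wpM2l // addr_ge0 // ltW.
rewrite /=; set x := refl (C l) _ in IHl hi hj *.
have px : 0 <= power (C l) x by rewrite /x power_self oppr_ge0 ltW.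
have hx : psd x by apply: psd_refl; [exact: csq_gt0|exact: psd_act].
have hjx : psd (refl (C j) x) by apply: psd_refl; [exact: csq_gt0|].
have pjx : 0 <= power (C j) (refl (C j) x) by rewrite power_self oppr_ge0 ltW.
have lj : l != j by apply: contraTneq hj => <-; rewrite -leNgt.
have [alj|nlj] := boolP (l ~~> j); last first.
  by apply: le_trans (hk _ _ _ lj nlj hx px) _; apply/base_step/ltW.
have ji : j != i by apply: contraTneq hi => <-; rewrite -leNgt.
have grow y : psd y -> bil o0 x <= bil o0 y -> (1 + k) * bil o0 y <= bil o0 (refl (C i) y) ->
   (1 + k) * bil o0 x <= bil o0 (refl (C i) y).
  by move=> hy h1 h2; apply: le_trans h2; rewrite ler_wpM2l // addr_ge0 // ltW.
have up := base_step (ltW hj).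
have [aji|nji] := boolP (j ~~> i); last by apply: grow => //; exact: hk ji nji hjx pjx.
have li : l != i.
  by apply: contraTneq hi => <-; rewrite -leNgt power_next.
have nli := next_trig alj aji.
by apply: grow => //; apply: hk li nli hjx _; rewrite power_next.
Qed.

(** For isotropic vectors this is the domain of discontinuity, tiled by the ideal part of the
    chamber. *)
Definition tame v := exists w, chamber (act w v).

Lemma tame_act w v : tame (act w v) -> tame v.
Proof. by case=> w' h; exists (w' ++ w); rewrite act_cat. Qed.

(* At a word [w] of this kind a half-space contains [act w o] and a disjoint one
   contains [act w v], so that the segment between them meets a fixed compact set. *)
Definition crossing o v w := exists i j, [/\ i != j, ~~ (i ~~> j),
  0 <= power (C i) (act w o) & 0 <= power (C j) (act w v)].

(** Scaled to trace 1, the two forms are kept apart by the gap between disjoint discs, and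
    [psd_bil_dist] turns the distance into a lower bound for the pairing. *)
Lemma crossing_bil : exists2 k, 0 < k & forall o v w, psd o -> psd v ->
  crossing o v w -> k * (tr (act w o) * tr (act w v)) <= bil (act w o) (act w v).
Proof.
have [k k0 hk] := far_bound.
have [||m m0 hm] := @fin_pos_min R L (fun i m => forall a b, psd a -> psd b ->
   tr a = tr b -> k <= power (C i) a - power (C i) b -> m <= bil a b).
- move=> i; set c := C i.
  (* The difference of powers is a linear form in (d1, d2, d3); [M] bounds the squared norm of its
     coefficients, for Cauchy-Schwarz. *)
  pose M := 1 + (csq c - ccx c ^+ 2 - ccy c ^+ 2 + 1) ^+ 2 + 4 * ccx c ^+ 2 + 4 * ccy c ^+ 2.
  have M0 : 0 < M.
    have := sqr_ge0 (csq c - ccx c ^+ 2 - ccy c ^+ 2 + 1); have := sqr_ge0 (ccx c).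
    by have := sqr_ge0 (ccy c); rewrite /M; lra.
  exists (k ^+ 2 / M); first by rewrite divr_gt0 // exprn_gt0.
  move=> a b ha hb e hab; apply: le_trans (psd_bil_dist e ha hb).
  rewrite ler_pdivrMr //.
  set d1 := cp a - cp b; set d2 := cs a - cs b; set d3 := ct a - ct b.
  have ee : power c a - power c b = - (csq c - ccx c ^+ 2 - ccy c ^+ 2 + 1) * d1 +
      2 * ccx c * d2 + 2 * ccy c * d3.
    have -> : d1 = - (cr a - cr b) by move: e; rewrite /tr /d1; lra.
    have e1 : cp a - cp b = - (cr a - cr b) by move: e; rewrite /tr /d1; lra.
    have -> : power c a - power c b = (csq c - ccx c ^+ 2 - ccy c ^+ 2) * (cr a - cr b) - (cp a - cp b)
       + 2 * ccx c * d2 + 2 * ccy c * d3 by rewrite !powerE /d2 /d3; ring.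
    by rewrite e1; ring.
  have kk : k ^+ 2 <= (power c a - power c b) ^+ 2.
    by rewrite ler_pXn2r // nnegrE ?(ltW k0) // (le_trans _ hab) // ltW.
  apply: le_trans kk _; rewrite ee /M.
  set u := csq c - ccx c ^+ 2 - ccy c ^+ 2 + 1.
  have := sqr_ge0 d1; have := sqr_ge0 d2; have := sqr_ge0 d3.
  have := sqr_ge0 (u * d2 + 2 * ccx c * d1); have := sqr_ge0 (u * d3 + 2 * ccy c * d1).
  have := sqr_ge0 (2 * ccx c * d3 - 2 * ccy c * d2).
  lra.
- by move=> i x y y0 yx h a b ha hb e hab; apply: le_trans (h a b ha hb e hab).
- exists m => // o v w ho hv [i [j [ij nij h1 h2]]].
  have [a0|ta] := eqVneq (tr (act w o)) 0.
    by rewrite a0 mul0r mulr0; apply: psd_bil; apply: psd_act.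
  have [b0|tb] := eqVneq (tr (act w v)) 0.
    by rewrite b0 !mulr0; apply: psd_bil; apply: psd_act.
  set a := act w o in ta h1 *; set b := act w v in tb h2 *.
  have ha : psd a by exact: psd_act.
  have hb : psd b by exact: psd_act.
  have ta0 : 0 < tr a by rewrite lt_neqAle eq_sym ta psd_tr.
  have tb0 : 0 < tr b by rewrite lt_neqAle eq_sym tb psd_tr.
  have hZ x : psd x -> 0 < tr x -> psd ((tr x)^-1 *: x).
    by move=> hx x0; apply: psdZ => //; rewrite invr_ge0 ltW.
  have := hm i _ _ (hZ a ha ta0) (hZ b hb tb0).
  rewrite !trZ !mulVf // !powerZ bilZl bilZr.
  have -> : (tr a)^-1 * ((tr b)^-1 * bil a b) = bil a b / (tr a * tr b).
    by field; rewrite ta tb.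
  rewrite ler_pdivlMr ?mulr_gt0 //; apply=> //.
  have ji : j != i by rewrite eq_sym.
  have nji : ~~ (j ~~> i) by rewrite next_sym.
  have h3 := hk _ _ _ ji nji hb h2.
  have : (tr b)^-1 * power (C i) b <= - k by rewrite mulrC ler_pdivrMr.
  have : 0 <= (tr a)^-1 * power (C i) a by rewrite mulr_ge0 // invr_ge0 ltW.
  lra.
Qed.

(** Chase [v]: no translate of it is in the chamber, so there is always a disc that contains it, and
    reflecting in this disc drives [o] away from the base point. *)
Lemma untame_crossing : exists2 k, 0 < k & forall o v, psd o -> o != 0 -> psd v ->
  chamber o -> ~ tame v -> forall n, exists w, crossing o v w /\
    (1 + k) ^+ n * bil o0 o <= bil o0 (act w o).
Proof.
have [k k0 hk] := base_growth; exists k => // o v ho o_0 hv co tv.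
have g := csq_gt0 C.
(* No disc with [v] in its interior has [o] in its interior, so that the chosen reflections never
   bring [o] closer. *)
pose inv w := forall i, 0 < power (C i) (act w v) -> power (C i) (act w o) <= 0.
have out w : exists i, 0 < power (C i) (act w v).
  apply: contrapT => h; apply: tv; exists w => i; rewrite leNgt; apply/negP => hi.
  by apply: h; exists i.
have inv_step w i : inv w -> 0 < power (C i) (act w v) -> inv (i :: w).
  move=> iw hi j /= hj; have hio := iw i hi.
  have [e|ij] := eqVneq i j; first by move: hj; rewrite -e power_self oppr_gt0 ltNge (ltW hi).
  have [aji|nji] := boolP (j ~~> i).
    by move: hj; rewrite !power_next //; exact: iw.
  have nij : ~~ (i ~~> j) by rewrite next_sym.
  exact/ltW/(far_neg_refl ij nij (psd_act w ho) (act_neq0 w o_0)).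
pose state w i := inv w /\ 0 <= power (C i) (act w o) /\ power (C i) (act w v) < 0.
have state_step w i : inv w -> 0 < power (C i) (act w v) -> state (i :: w) i.
  move=> iw hi; split; first exact: inv_step.
  by rewrite /= !power_self oppr_ge0 oppr_lt0; split => //; exact: iw.
(* If the disc [i] of [v] is adjacent to [j], there is no crossing yet. After the reflection in [i],
   the image of [o] is in both discs [i] and [j]; the disc [l] that then contains [v] cannot be
   adjacent to both, and forms a crossing with one of them. *)
have macro w j : state w j -> exists w' w'' i, [/\ crossing o v w', state w'' i,
    bil o0 (act w o) <= bil o0 (act w' o) & (1 + k) * bil o0 (act w o) <= bil o0 (act w'' o)].
  move=> [iw [hjo hjv]]; have [i hi] := out w; have hio := iw i hi.
  have ji : j != i by apply: contraTneq hjv => ->; rewrite -leNgt ltW.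
  have [aji|nji] := boolP (j ~~> i); last first.
    exists w, (i :: w), i; split => //.
    - by exists j, i; split => //; exact: ltW.
    - exact: state_step.
    - by apply: hk ji nji _ hjo; exact: psd_act.
  have [iw1 [hio1 hiv1]] := state_step _ _ iw hi.
  have [l hl] := out (i :: w).
  have up : bil o0 (act w o) <= bil o0 (act (i :: w) o) by exact: base_step.
  have il : i != l by apply: contraTneq hl => <-; rewrite -leNgt ltW.
  have jl : j != l.
    apply: contraTneq hl => <- /=.
    by rewrite power_next // -leNgt ltW.
  have ends a : a != l -> ~~ (a ~~> l) -> 0 <= power (C a) (act (i :: w) o) ->
    exists w' w'' i, [/\ crossing o v w', state w'' i,
    bil o0 (act w o) <= bil o0 (act w' o) & (1 + k) * bil o0 (act w o) <= bil o0 (act w'' o)].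
    move=> al nal ha; exists (i :: w), (l :: i :: w), l; split => //.
    - by exists a, l; split => //; exact: ltW.
    - exact: state_step.
    - have hx := psd_act (i :: w) ho.
      have := hk a l _ al nal hx ha; apply: le_trans.
      by rewrite ler_wpM2l // addr_ge0 // ltW.
  have [ail|nil] := boolP (i ~~> l); last exact: ends il nil hio1.
  apply: (ends j jl); first exact: next_trig aji ail.
  by rewrite /= power_next.
have [i hi] := out [::].
have st0 : state [:: i] i by apply: state_step => // j _; exact: co.
have b0 : bil o0 o <= bil o0 (act [:: i] o) by apply: base_step; exact: co.
have seqn n : exists w j, state w j /\ (1 + k) ^+ n * bil o0 o <= bil o0 (act w o).
  elim: n => [|n [w [j [sw hw]]]]; first by exists [:: i], i; rewrite expr0 mul1r.
  have [w' [w'' [l [_ sl _ h]]]] := macro _ _ sw; exists w'', l; split => //.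
  rewrite exprS -mulrA; apply: le_trans h; rewrite ler_wpM2l // addr_ge0 // ltW //.
move=> n; have [w [j [sw hw]]] := seqn n.
have [w' [w'' [l [cw' _ h _]]]] := macro _ _ sw; exists w'; split => //.
exact: le_trans h.
Qed.

Lemma untame_crossing_unbounded o v (M : R) : pd o -> psd v -> chamber o -> ~ tame v ->
  exists w, crossing o v w /\ M <= tr (act w o).
Proof.
move=> ho hv co tv; have [k k0 h] := untame_crossing.
have [c c0 hc] := pd_bil_upper (base_pd C).
have b0 : 0 < bil o0 o.
  have [d d0 hd] := pd_bil_lower (base_pd C).
  by apply: lt_le_trans (hd _ (pd_psd ho)); rewrite mulr_gt0 // pd_tr.
pose n := Num.bound `|c * M / bil o0 o / k|.
have [w [cw hw]] := h o v (pd_psd ho) (pd_neq0 ho) hv co tv n; exists w; split => //.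
rewrite -(ler_pM2l c0); apply: le_trans (hc _ (psd_act w (pd_psd ho))).
apply: le_trans hw; rewrite -ler_pdivrMr //.
have bern m : 1 + k * m%:R <= (1 + k) ^+ m.
  elim: m => [|m IH]; first by rewrite mulr0 addr0 expr0.
  rewrite exprS -natr1; have : 0 <= k * k * m%:R by rewrite !mulr_ge0 // ltW.
  have : 0 < 1 + k by lra.
  by move=> k1; rewrite -(ler_pM2l k1) in IH; lra.
apply: le_trans (bern n).
have h2 : c * M / bil o0 o / k <= n%:R.
  exact/ltW/(le_lt_trans (ler_norm _))/archi_boundP/normr_ge0.
by rewrite ler_pdivrMr // mulrC in h2; lra.
Qed.

Lemma tame_pd v : pd v -> tame v.
Proof.
move=> hv; apply: contrapT => tv; have [k k0 hk] := crossing_bil.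
(* The trace of any translate of [v] is at least half the root of the invariant [bil v v], and the
   right side of [crossing_bil] is the invariant [bil o0 v]. A translate of [o0] whose trace exceeds
   [t] is then impossible. *)
pose t := 2 * bil o0 v / k / Num.sqrt (bil v v).
have d0 : 0 < Num.sqrt (bil v v) by rewrite sqrtr_gt0; case: hv.
have co : chamber o0 by move=> i; exact/ltW/base_out.
have [w [cw hw]] := untame_crossing_unbounded (t + 1) (base_pd C) (pd_psd hv) co tv.
have := hk _ _ _ base_psd (pd_psd hv) cw; rewrite bil_act.
have tv0 : Num.sqrt (bil v v) <= 2 * tr (act w v).
  have hwv := psd_act w (pd_psd hv).
  apply: ler_of_sqr; first by rewrite mulr_ge0 // psd_tr.
  rewrite sqr_sqrtr; last by case: hv => _ _ /ltW.
  rewrite -(bil_act w v) /bil /tr; case: hwv => p r _.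
  have := sqr_ge0 (cs (act w v)); have := sqr_ge0 (ct (act w v)).
  by have := mulr_ge0 p r; have := sqr_ge0 (cp (act w v)); have := sqr_ge0 (cr (act w v)); lra.
apply/negP; rewrite -ltNge.
have t0 : 0 <= t + 1.
  have h := psd_bil base_psd (pd_psd hv).
  rewrite addr_ge0 // /t divr_ge0 ?(ltW d0) // divr_ge0 ?(ltW k0) // mulr_ge0 //.
apply: lt_le_trans (_ : k * ((t + 1) * (Num.sqrt (bil v v) / 2)) <= _); last first.
  apply: ler_wpM2l; first exact: ltW.
  apply: ler_pM => //.
  by rewrite ler_pdivrMr // mulrC.
have -> : k * ((t + 1) * (Num.sqrt (bil v v) / 2)) = bil o0 v + k * Num.sqrt (bil v v) / 2.
  by rewrite /t; field; rewrite !gt_eqF.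
by rewrite ltrDl divr_gt0 // mulr_gt0.
Qed.

End ReflectionGroup.

(** * The surface group inside the reflection group *)

Section ComplexForms.
Variable R : realType.
Local Notation C := R[i].
Local Notation V := 'rV[R]_4.
Local Open Scope sesquilinear_scope.
Local Open Scope complex_scope.

Definition mxconj m n (A : 'M[C]_(m, n)) : 'M[C]_(m, n) := map_mx (@conjc R) A.

Lemma mxconjM m n p (A : 'M[C]_(m, n)) (B : 'M[C]_(n, p)) :
  mxconj (A *m B) = mxconj A *m mxconj B.
Proof. exact: (map_mxM (conjc : {rmorphism C -> C})). Qed.

Lemma mxconjK m n (A : 'M[C]_(m, n)) : mxconj (mxconj A) = A.
Proof. by apply/matrixP => i j; rewrite !mxE conjcK. Qed.

Lemma adjE m n (A : 'M[C]_(m, n)) : A ^t* = (mxconj A)^T.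
Proof. by apply/matrixP => i j; rewrite !mxE. Qed.

Lemma adjM m n p (A : 'M[C]_(m, n)) (B : 'M[C]_(n, p)) :
  (A *m B) ^t* = B ^t* *m A ^t*.
Proof. by rewrite !adjE mxconjM trmx_mul. Qed.

Lemma mxconj_adj m n (A : 'M[C]_(m, n)) : mxconj (A ^t*) = (mxconj A) ^t*.
Proof. by apply/matrixP => i j; rewrite !mxE. Qed.

Lemma ord2P (i : 'I_2) : i = 0 \/ i = 1.
Proof. by case: i => -[|[|//]] h; [left|right]; apply/val_inj. Qed.

Lemma mx2_ext (A B : 'M[C]_2) : A 0 0 = B 0 0 -> A 0 1 = B 0 1 ->
  A 1 0 = B 1 0 -> A 1 1 = B 1 1 -> A = B.
Proof.
by move=> ? ? ? ?; apply/matrixP => i j; case: (ord2P i) (ord2P j) => -> [] ->.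
Qed.

Lemma mul2E (A B : 'M[C]_2) i j : (A *m B) i j = A i 0 * B 0 j + A i 1 * B 1 j.
Proof.
rewrite mxE big_ord_recl big_ord1.
by have -> : lift ord0 ord0 = 1 :> 'I_2 by apply/val_inj.
Qed.

Definition mx2 (a b c d : C) : 'M[C]_2 := \matrix_(i, j)
  if i == 0 then if j == 0 then a else b else if j == 0 then c else d.

Lemma mx2E a b c d : ((mx2 a b c d 0 0 = a) * (mx2 a b c d 0 1 = b) *
  (mx2 a b c d 1 0 = c) * (mx2 a b c d 1 1 = d))%type.
Proof. by rewrite !mxE. Qed.

Lemma mx2M a b c d a' b' c' d' : mx2 a b c d *m mx2 a' b' c' d' =
  mx2 (a * a' + b * c') (a * b' + b * d') (c * a' + d * c') (c * b' + d * d').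
Proof. by apply: mx2_ext; rewrite mul2E !mx2E. Qed.

Lemma mx2_conj a b c d : mxconj (mx2 a b c d) = mx2 (conjc a) (conjc b) (conjc c) (conjc d).
Proof. by apply: mx2_ext; rewrite mxE !mx2E. Qed.

Lemma mx2_adj a b c d : (mx2 a b c d) ^t* = mx2 (conjc a) (conjc c) (conjc b) (conjc d).
Proof. by rewrite adjE mx2_conj; apply: mx2_ext; rewrite mxE !mx2E. Qed.

Lemma mx2N a b c d : - mx2 a b c d = mx2 (- a) (- b) (- c) (- d).
Proof. by apply: mx2_ext; rewrite mxE !mx2E. Qed.

Lemma mx2_1 : 1%:M = mx2 1 0 0 1.
Proof. by apply: mx2_ext; rewrite mxE !mx2E. Qed.

Lemma cplx_ext (z w : C) : complex.Re z = complex.Re w -> complex.Im z = complex.Im w -> z = w.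
Proof. by case: z w => [a b] [c d] /= -> ->. Qed.

Lemma ReD (z w : C) : complex.Re (z + w) = complex.Re z + complex.Re w.
Proof. by case: z w => [a b] [c d]. Qed.
Lemma ImD (z w : C) : complex.Im (z + w) = complex.Im z + complex.Im w.
Proof. by case: z w => [a b] [c d]. Qed.
Lemma ReM (z w : C) : complex.Re (z * w) =
  complex.Re z * complex.Re w - complex.Im z * complex.Im w.
Proof. by case: z w => [a b] [c d]. Qed.
Lemma ImM (z w : C) : complex.Im (z * w) =
  complex.Re z * complex.Im w + complex.Im z * complex.Re w.
Proof. by case: z w => [a b] [c d]. Qed.
Lemma Rec (z : C) : complex.Re (conjc z) = complex.Re z. Proof. by case: z. Qed.
Lemma Imc (z : C) : complex.Im (conjc z) = - complex.Im z. Proof. by case: z. Qed.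
Lemma ReN (z : C) : complex.Re (- z) = - complex.Re z. Proof. by case: z. Qed.
Lemma ImN (z : C) : complex.Im (- z) = - complex.Im z. Proof. by case: z. Qed.
Definition reimE := (ReN, ImN, ReD, ImD, ReM, ImM, Rec, Imc).

Lemma herm_mxE (o : V) : herm_mx o =
  mx2 (cp o)%:C (cs o +i* ct o) (cs o -i* ct o) (cr o)%:C.
Proof. by apply: mx2_ext; rewrite !mxE. Qed.

Lemma herm_coordK (o : V) : herm_coord (herm_mx o) = o.
Proof. by apply: vec_ext; rewrite /cp /cr /cs /ct !mxE. Qed.

Lemma herm_mx_adj (o : V) : (herm_mx o) ^t* = herm_mx o.
Proof.
rewrite adjE herm_mxE; apply: mx2_ext; rewrite !mxE /=; apply: cplx_ext; rewrite /= ?oppr0 ?opprK //.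
Qed.

Lemma herm_coordP (A : 'M[C]_2) : A ^t* = A -> herm_mx (herm_coord A) = A.
Proof.
move=> h; have e i j : conjc (A j i) = A i j by rewrite -[in RHS]h adjE !mxE.
have real i : complex.Im (A i i) = 0.
  by have := congr1 (@complex.Im R) (e i i); rewrite Imc; lra.
rewrite herm_mxE; apply: mx2_ext; rewrite mx2E /cp /cr /cs /ct !mxE /=;
  apply: cplx_ext => //=; rewrite -?(e 1 0) ?real ?Rec ?Imc ?opprK //.
Qed.

Definition mxact (h : 'M[C]_2) (o : V) : V := herm_coord (h *m herm_mx o *m h ^t*).

Lemma herm_mxact h o : herm_mx (mxact h o) = h *m herm_mx o *m h ^t*.
Proof.
apply: herm_coordP; rewrite !adjM mulmxA trmxCK herm_mx_adj //.
Qed.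

Lemma mxactM h k o : mxact (h *m k) o = mxact h (mxact k o).
Proof. by rewrite {1 2}/mxact herm_mxact adjM !mulmxA. Qed.

Lemma det2 (A : 'M[C]_2) : \det A = A 0 0 * A 1 1 - A 0 1 * A 1 0.
Proof.
rewrite (expand_det_row _ 0) big_ord_recl big_ord1 /cofactor.
have -> : lift ord0 ord0 = 1 :> 'I_2 by apply/val_inj.
rewrite !det_mx11 !mxE /= expr0 expr1 mul1r mulN1r mulrN.
have -> : lift 0 0 = 1 :> 'I_2 by apply/val_inj.
by have -> : lift 1 0 = 0 :> 'I_2 by apply/val_inj.
Qed.

Lemma herm_det (o : V) : \det (herm_mx o) = (bil o o / 2)%:C.
Proof.
rewrite det2 herm_mxE !mx2E; apply: cplx_ext; rewrite !reimE /= /bil; last by ring.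
by field.
Qed.

(** For [o = v v^*] this is the value of the form [q] at [v]. The first argument is a point, the
    second a form, and the group acts contragrediently on the two. *)
Definition pair (o q : V) : R := cp o * cp q + cr o * cr q + 2 * cs o * cs q + 2 * ct o * ct q.

Lemma pairE o q : pair o q = complex.Re (\tr (herm_mx o *m herm_mx q)).
Proof.
rewrite /mxtrace big_ord_recl big_ord1.
have -> : lift ord0 ord0 = 1 :> 'I_2 by apply/val_inj.
rewrite !mul2E !herm_mxE !mx2E !reimE /pair /=; ring.
Qed.

Lemma pair_act h o q : \det h = 1 -> pair (mxact h o) (herm_act h q) = pair o q.
Proof.
move=> hd; have hu : h \in unitmx by rewrite unitmxE hd unitr1.
rewrite !pairE herm_mxact herm_coordP; last by rewrite !adjM trmxCK herm_mx_adj mulmxA.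
have e : h ^t* *m (invmx h) ^t* = 1%:M.
  by rewrite -adjM mulVmx // adjE; apply: mx2_ext; rewrite !mxE /=; apply: cplx_ext;
    rewrite /= ?oppr0.
have -> : h *m herm_mx o *m h ^t* *m ((invmx h) ^t* *m herm_mx q *m invmx h) =
   h *m (herm_mx o *m (h ^t* *m (invmx h) ^t*) *m herm_mx q *m invmx h).
  by rewrite !mulmxA.
by rewrite mxtrace_mulC e mulmx1 -!mulmxA mulVmx // mulmx1.
Qed.

Section Bead.
Variables (c : circle R) (c0 : 0 < csq c).

(* The antiholomorphic involution [z |-> M (conj z)] is the inversion in [c]. *)
Definition bead_mx : 'M[C]_2 := let s := (Num.sqrt (csq c))^-1 in
  mx2 ((s * ccx c) +i* (s * ccy c)) (s * (csq c - ccx c ^+ 2 - ccy c ^+ 2))%:C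
    s%:C (- (s * ccx c) +i* (s * ccy c)).

Let rt := Num.sqrt (csq c).
Let rt0 : rt != 0. Proof. by rewrite gt_eqF // sqrtr_gt0. Qed.
Let rt2 : rt * rt = csq c. Proof. by rewrite -expr2 sqr_sqrtr // ltW. Qed.

Lemma bead_mxK : bead_mx *m mxconj bead_mx = 1%:M.
Proof.
rewrite mx2_conj mx2M mx2_1 -/rt.
by congr (mx2 _ _ _ _); apply: cplx_ext; rewrite !reimE /= -?rt2; field.
Qed.

Lemma det_bead_mx : \det bead_mx = -1.
Proof.
by rewrite det2 !mx2E /=; apply: cplx_ext; rewrite !reimE /= -/rt -?rt2; field.
Qed.

Lemma bead_mx_refl o : herm_mx (refl c o) = bead_mx *m mxconj (herm_mx o) *m bead_mx ^t*.
Proof.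
rewrite !herm_mxE /refl powerE !coordE mx2_conj mx2_adj !mx2M -/rt.
by congr (mx2 _ _ _ _); apply: cplx_ext; rewrite !reimE /= -?rt2; field.
Qed.

End Bead.

(** Orthogonal inversions commute, but their lifts of determinant -1 do so only up to a sign. These
    signs must cancel in the relator for the representation to land in SL(2,C) and not just in
    PSL(2,C). *)
Lemma bead_mx_anti (c c' : circle R) : bil (normal c) (normal c') = 0 ->
  bead_mx c *m mxconj (bead_mx c') = - (bead_mx c' *m mxconj (bead_mx c)).
Proof.
rewrite bil_normal => h; rewrite !mx2_conj !mx2M mx2N.
move: (Num.sqrt _)^-1 (Num.sqrt _)^-1 => s s'.
have e : csq c = (ccx c - ccx c') ^+ 2 + (ccy c - ccy c') ^+ 2 - csq c' by lra.
by congr (mx2 _ _ _ _); apply: cplx_ext; rewrite !reimE /= ?e; ring.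
Qed.

End ComplexForms.

(** * The surface group as a subgroup of index 4, by Reidemeister-Schreier rewriting *)

Section Letters.
Variable g : nat.

(* The beads are met in the cyclic order x_0 y_0 x_1 y_1 ... x_g y_g, where
   [(false, i)] stands for x_i and [(true, i)] for y_i. *)
Definition bead_letter : Type := (bool * 'I_g.+1)%type.
HB.instance Definition _ := Finite.on bead_letter.

Definition xy_next (i j : 'I_g.+1) : bool :=
  [|| i == j, i == j.+1 :> nat | (i == 0 :> nat) && (j == g :> nat)].

Definition bead_next : rel bead_letter := fun a b =>
  if a.1 then ~~ b.1 && xy_next b.2 a.2 else b.1 && xy_next a.2 b.2.

(** The action on the four cosets: the parities of the numbers of letters x and y. The surface group
    is the stabilizer of [(false, false)]. *)
Definition step (c : bool * bool) (a : bead_letter) : bool * bool :=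
  if a.1 then (c.1, ~~ c.2) else (~~ c.1, c.2).
Definition stepw c (w : seq bead_letter) := foldl step c w.

Lemma step_next c a b : bead_next a b -> step (step c a) b = step (step c b) a.
Proof. by case: a b => [[] i] [[] j]. Qed.

Lemma stepK c a : step (step c a) a = c.
Proof. by case: c a => c d [[] i]; rewrite /step /= ?negbK. Qed.

Lemma odd_stepw c w : odd (size w) = (stepw c w).1 (+) (stepw c w).2 (+) c.1 (+) c.2.
Proof.
elim: w c => [|a w IH] c /=; first by case: c => [[] []].
by rewrite (IH (step c a)); case: c a => [[] []] [[] i] /=; case: (_.1); case: (_.2).
Qed.

End Letters.

Section Schreier.
Variable g : nat.
Local Notation G := (surface_group g).
Local Notation L := (bead_letter g).
Local Open Scope group_scope.

Definition gen (t : bool) (k : nat) : G :=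
  if insub k : option 'I_g is Some i then class_of [:: (i, t, false)] else 1.

Lemma sgM (v w : seq (letter g)) : class_of v * class_of w = class_of (v ++ w).
Proof. exact: sg_mulE. Qed.
Lemma sgV (w : seq (letter g)) : (class_of w)^-1 = class_of (winv w).
Proof. exact: sg_invE. Qed.
Lemma sg1 : class_of [::] = 1 :> G. Proof. by []. Qed.

Lemma gen_ord t (i : 'I_g) : gen t i = class_of [:: (i, t, false)].
Proof. by rewrite /gen insubT // => h; congr (class_of [:: (_, _, _)]); apply/val_inj. Qed.

(** These elements will act by short reflection words: [BB k] by y_0 y_k, [XX k] by x_k x_0 and
    [PP k] by x_0 y_0 y_k x_0. Below, [YY k] acts by y_k y_g, [YY' k] by x_0 y_k y_g x_0 and [XX' k]
    by y_g x_k y_g x_0. *)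
Fixpoint BB k : G := if k is k'.+1 then gen true k' * BB k' else 1.
Definition XX k : G := if k is k'.+1 then (BB k')^-1 * (gen false k')^-1 * BB k' else 1.
Fixpoint PP k : G := if k is k'.+1 then
  PP k' * ((XX k)^-1 * ((BB k')^-1 * BB k) * XX k) else 1.

(** It makes the product of the first k commutators telescope to [PP k * (BB k)^-1], so that the
    surface relation becomes [PP g = BB g]. *)
Lemma PP_comm k : (PP k.+1 * (BB k.+1)^-1 = PP k * (BB k)^-1 *
  (gen false k * gen true k * (gen false k)^-1 * (gen true k)^-1))%g.
Proof.
rewrite /= !invgM !invgK !mulgA.
by rewrite !(mulgVK, mulgK).
Qed.

Definition comm_word k : seq (letter g) :=
  if insub k : option 'I_g is Some i then [:: (i, false, false); (i, true, false);
     (i, false, true); (i, true, true)] else [::].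

Definition relator_upto n := flatten (map comm_word (iota 0 n)).

Lemma relator_uptoS n : relator_upto n.+1 = relator_upto n ++ comm_word n.
Proof. by rewrite /relator_upto -addn1 iotaD map_cat flatten_cat /= cats0. Qed.

Lemma relatorE : relator g = relator_upto g.
Proof.
rewrite /relator /relator_upto -val_enum_ord -map_comp; congr flatten.
apply: eq_map => i /=; rewrite /comm_word insubT // => h.
by congr [:: (_, _, _); (_, _, _); (_, _, _); (_, _, _)]; apply/val_inj.
Qed.

Lemma relator_prod : class_of (relator g) = PP g * (BB g)^-1.
Proof.
rewrite relatorE; suff h n : (n <= g)%N -> class_of (relator_upto n) = PP n * (BB n)^-1.
  exact: h.
elim: n => [|n IH] ng; first by rewrite /= invg1 mulg1.
rewrite PP_comm relator_uptoS -sgM IH ?(ltnW ng) //; congr (_ * _).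
by rewrite /comm_word insubT /gen insubT !sgV !sgM.
Qed.

Lemma PP_BB : PP g = BB g.
Proof.
apply: (mulIg (BB g)^-1); rewrite mulgV -relator_prod -sg1; apply/class_ofP.
by rewrite -[relator g]cats0; exact: (we_relator [::] [::]).
Qed.

Definition YY j : G := (BB j)^-1 * BB g.
Definition YY' j : G := (PP j)^-1 * PP g.
Definition XX' i : G := (YY i)^-1 * XX i * YY' i.

(** The Schreier generator of the edge labelled [a] that starts at the coset [c]; [psi] multiplies
    these generators along a word. *)
Definition gam (c : bool * bool) (a : L) : G :=
  if a.1 then
    let e := if c.1 then YY' a.2 else YY a.2 in if c.2 then e^-1 else e
  else let e := if c.2 then XX' a.2 else XX a.2 in if c.1 then e^-1 else e.

Fixpoint psi c (w : seq L) : G := if w is a :: w' then gam c a * psi (step c a) w' else 1.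

Lemma psi_cat c v w : psi c (v ++ w) = psi c v * psi (stepw c v) w.
Proof. by elim: v c => [|a v IH] c /=; rewrite ?mul1g // IH mulgA. Qed.

(** The commutation of x_i and y_j, rewritten at the coset [(false, false)]. It is built into [XX']
    for i = j and into [PP] for i = j + 1; the pair x_0, y_g that closes the necklace uses the
    surface relation. *)
Lemma vertex_rel (i j : 'I_g.+1) : xy_next i j -> XX i * YY' j = YY j * XX' i.
Proof.
rewrite /XX' !mulgA; case/or3P => [/eqP ->|/eqP e|/andP [/eqP i0 /eqP jg]].
- by rewrite mulgV mul1g.
- rewrite /YY /YY' e /= !invgM !invgK !mulgA.
  by rewrite !(mulgVK, mulgK).
- by rewrite i0 jg /XX /YY /YY' /= !invg1 PP_BB !mul1g !mulg1 !mulVg mul1g mulVg.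
Qed.

Lemma gamK c a : gam c a * gam (step c a) a = 1.
Proof. by case: c a => [[] []] [[] i]; rewrite /gam /= ?mulgV ?mulVg. Qed.

Lemma gam_next c a b : bead_next a b ->
  gam c a * gam (step c a) b = gam c b * gam (step c b) a.
Proof.
have key (i j : 'I_g.+1) d : xy_next i j ->
   gam d (false, i) * gam (step d (false, i)) (true, j) =
   gam d (true, j) * gam (step d (true, j)) (false, i).
  move=> h; have e := vertex_rel h; case: d => [[] []]; rewrite /gam /=.
  - by rewrite -!invgM e.
  - by apply: (mulgI (XX i)); rewrite mulgA mulgV mul1g mulgA e -mulgA mulgV mulg1.
  - by apply: (mulgI (YY j)); rewrite mulgA -e -mulgA mulgV mulg1 mulgA mulgV mul1g.
  - by [].
case: a b => [[] i] [[] j] //= h; first by rewrite (key _ _ _ h).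
by rewrite key.
Qed.

Lemma psi_weq c v w : weq (@bead_next g) v w -> psi c v = psi c w.
Proof.
move=> h; elim: h c => {v w} [w|v w _ IH|u v w _ IH _ IH'|i v w|i j v w h] c //.
- by rewrite IH IH'.
- by rewrite !psi_cat /= (mulgA (gam _ _)) gamK mul1g stepK.
- by rewrite !psi_cat /= !(mulgA (gam _ _)) gam_next // step_next.
Qed.

Definition xl (i : nat) : L := (false, inord i).
Definition yl (i : nat) : L := (true, inord i).

Definition phi_pos (t : bool) (k : nat) : seq L :=
  if t then [:: yl 0; yl k.+1; yl k; yl 0]
  else [:: yl 0; yl k; xl 0; xl k.+1; yl k; yl 0].
Definition phi (l : letter g) : seq L :=
  let w := phi_pos l.1.2 l.1.1 in if l.2 then rev w else w.
Definition phiw (w : seq (letter g)) : seq L := flatten (map phi w).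

Lemma phiw_cat v w : phiw (v ++ w) = phiw v ++ phiw w.
Proof. by rewrite /phiw map_cat flatten_cat. Qed.

Lemma step_phi c l : stepw c (phi l) = c.
Proof. by case: c l => [[] []] [[i []] []]. Qed.

Lemma stepw_phiw c w : stepw c (phiw w) = c.
Proof.
elim: w c => //= l w IH c; rewrite /phiw /= -/(phiw w) /stepw foldl_cat -!/(stepw _ _).
by rewrite step_phi IH.
Qed.

Lemma even_phiw w : odd (size (phiw w)) = false.
Proof. by rewrite (odd_stepw (false, false)) stepw_phiw. Qed.

Lemma psi_phi l : psi (false, false) (phi l) = class_of [:: l].
Proof.
case: l => [[i t] e]; have ig := ltn_ord i.
have i1 : (inord i : 'I_g.+1) = i :> nat by rewrite inordK // ltnS ltnW.
have i2 : (inord i.+1 : 'I_g.+1) = i.+1 :> nat by rewrite inordK.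
have i0 : (inord 0 : 'I_g.+1) = 0%N :> nat by rewrite inordK.
have y0 k : YY 0 * (YY k)^-1 = BB k.
  by rewrite /YY /= invg1 mul1g invgM invgK mulgA mulgV mul1g.
have y0' k : YY k * (YY 0)^-1 = (BB k)^-1 by have := y0 k; move: (YY 0) (YY k) => u v <-; rewrite invgM invgK.
have pos : psi (false, false) (phi_pos t i) = class_of [:: (i, t, false)].
  rewrite -gen_ord; case: t; rewrite /= /gam /= ?i0 ?i1 ?i2 mulg1.
    by rewrite mulgA y0 y0' /= mulgK.
  by rewrite mulgA y0 y0' /= mul1g !invgM !invgK !mulgA mulgV mul1g mulgK.
case: e => //; rewrite /phi /=.
have inv : psi (false, false) (phi_pos t i ++ rev (phi_pos t i)) = 1.
  suff h w c : psi c (w ++ rev w) = 1 by exact: h.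
  elim: w c => // a w IH c; rewrite rev_cons cat_cons -cats1 catA /=.
  rewrite psi_cat IH mul1g /= mulg1.
  have -> : stepw (step c a) (w ++ rev w) = step c a; last exact: gamK.
  elim: w (step c a) {IH} => // b w IH d; rewrite rev_cons cat_cons -cats1 catA /=.
  by rewrite /stepw foldl_cat -!/(stepw _ _) IH /= stepK.
move: inv; rewrite psi_cat; have := step_phi (false, false) (i, t, false).
rewrite /phi /= => ->; rewrite pos => h.
have -> : [:: (i, t, true)] = winv [:: (i, t, false)] by [].
by rewrite -sgV; apply: (mulgI (class_of [:: (i, t, false)])); rewrite h mulgV.
Qed.

(** The element can be recovered from its reflection word, or from any equivalent one by [psi_weq].
    A short equivalent word therefore bounds the word length, which is the source of the lower
    quasi-isometry bound. *)
Lemma psi_phiw w : psi (false, false) (phiw w) = class_of w.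
Proof.
elim: w => [|l w IH] //=; rewrite /phiw /= -/(phiw w) psi_cat step_phi IH psi_phi.
by rewrite sgM.
Qed.

End Schreier.

(** * The representation into SL(2,C) *)

Section Representation.
Variables (R : realType) (g : nat) (C : necklace R (bead_letter g)).
Hypothesis hC : nextto C =2 @bead_next g.
Local Notation V := 'rV[R]_4.
Local Notation L := (bead_letter g).
Local Notation G := (surface_group g).
Implicit Types (a b : L) (v : 'cV[R[i]]_2) (w : seq L).
Local Open Scope sesquilinear_scope.

Lemma next_xy (i j : nat) : (i <= g)%N -> (j <= g)%N ->
  [|| i == j, i == j.+1 | (i == 0%N) && (j == g)] -> nextto C (xl g i) (yl g j).
Proof. by move=> ig jg h; rewrite hC /bead_next /= /xy_next -val_eqE /= !inordK. Qed.

Lemma next_weq w w' : weq (nextto C) w w' -> weq (@bead_next g) w w'.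
Proof.
elim=> {w w'} [w|w w' _ IH|u w w' _ IH _ IH'|i w w'|i j w w' h].
- exact: weq_refl.
- exact: weq_sym.
- exact: weq_trans IH IH'.
- exact: weq_cancel.
- by apply: weq_swap; rewrite -hC.
Qed.

(** The antilinear lift of the inversion to C^2; acting on vectors keeps track of the signs. *)
Definition op a v := bead_mx (C a) *m mxconj v.
Definition opw w v := foldr op v w.

Lemma opK a v : op a (op a v) = v.
Proof. by rewrite /op mxconjM mxconjK mulmxA bead_mxK ?mul1mx //; exact: csq_gt0. Qed.

Lemma opN a v : op a (- v) = - op a v.
Proof.
rewrite /op -mulmxN; congr (_ *m _); apply/matrixP => i j; rewrite !mxE.
exact: raddfN.
Qed.

Lemma op_anti a b v : nextto C a b -> op a (op b v) = - op b (op a v).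
Proof.
move=> h; rewrite /op !mxconjM !mxconjK !mulmxA bead_mx_anti ?mulNmx //.
exact: next_orth.
Qed.

Lemma opw_cat w w' v : opw (w ++ w') v = opw w (opw w' v).
Proof. exact: foldr_cat. Qed.

Definition Emx w : 'M[R[i]]_2 := foldr (fun a A => bead_mx (C a) *m mxconj A) 1%:M w.

Lemma opwE w v : opw w v = Emx w *m (if odd (size w) then mxconj v else v).
Proof.
elim: w => [|a w IH] /=; first by rewrite mul1mx.
by rewrite IH /op mxconjM mulmxA; case: odd; rewrite ?mxconjK.
Qed.

Lemma Emx_cat w w' : Emx (w ++ w') =
  Emx w *m (if odd (size w) then mxconj (Emx w') else Emx w').
Proof.
elim: w => [|a w IH] /=; first by rewrite mul1mx.
by rewrite IH mxconjM mulmxA; case: odd; rewrite ?mxconjK.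
Qed.

Lemma opw_inj w w' : odd (size w) = false -> odd (size w') = false ->
  opw w =1 opw w' -> Emx w = Emx w'.
Proof.
move=> e e' h; apply/matrixP => i j; have := h (delta_mx j 0).
rewrite !opwE e e' => /matrixP/(_ i 0); rewrite !mxE (bigD1 j) //= big1 ?addr0; last first.
  by move=> k kj; rewrite mxE (negbTE kj) mulr0.
rewrite (bigD1 j) //= big1 ?addr0; last by move=> k kj; rewrite mxE (negbTE kj) mulr0.
by rewrite !mxE eqxx !mulr1.
Qed.

Lemma det_Emx w : \det (Emx w) = (-1) ^+ size w.
Proof.
elim: w => [|a w IH] /=; first by rewrite det1.
rewrite det_mulmx det_bead_mx ?csq_gt0 // exprS; congr (_ * _).
rewrite /mxconj (det_map_mx (conjc : {rmorphism R[i] -> R[i]})) IH.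
by rewrite rmorphXn rmorphN1.
Qed.

Lemma opw_phiV (l : letter g) v : opw (phi l) (opw (phi (linv l)) v) = v.
Proof.
have rK w u : opw (rev w) (opw w u) = u.
  elim: w u => //= a w IH u; rewrite rev_cons -cats1 opw_cat /= opK; exact: IH.
case: l => [[i t] []]; rewrite /phi /=; first exact: rK.
by rewrite -{1}(revK (phi_pos _ _ _)) rK.
Qed.

Lemma phiw_comm n (ng : (n < g)%N) : phiw (comm_word g n) =
  [:: yl g 0; yl g n; xl g 0; xl g n.+1; yl g n; yl g 0;
      yl g 0; yl g n.+1; yl g n; yl g 0;
      yl g 0; yl g n; xl g n.+1; xl g 0; yl g n; yl g 0;
      yl g 0; yl g n; yl g n.+1; yl g 0].
Proof. by rewrite /comm_word insubT. Qed.

(** The induction step of [opw_relator]: multiplying by one more commutator replaces [yn] by [y'].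
    The letter [x'] moves across [yn] and across [y'], and the two signs cancel. *)
Lemma comm_telescope (T : zmodType) (x x' y yn y' : T -> T) (v : T) :
  involutive x -> involutive x' -> involutive y -> involutive yn -> involutive y' ->
  (forall u, x (- u) = - x u) -> (forall u, y (- u) = - y u) ->
  (forall u, yn (- u) = - yn u) -> (forall u, y' (- u) = - y' u) ->
  (forall u, x' (yn u) = - yn (x' u)) -> (forall u, x' (y' u) = - y' (x' u)) ->
  x (y (yn (x (yn (y (y (yn (x (x' (yn (y (y (y' (yn (y (y (yn (x' (x (yn (y (y
    (yn (y' (y v))))))))))))))))))))))))) = x (y (y' (x (y' (y v))))).
Proof.
move=> xK x'K yK ynK y'K xN yN ynN y'N a a'.
by rewrite !(yK, ynK, xK) a !(xN, yN, ynN, ynK, xK) a' !(y'N, x'K, xN, yN) opprK.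
Qed.

(** A partial product of commutators acts as x_0 y_0 y_n x_0 y_n y_0. For n = g this is the
    identity: x_0 anticommutes with both y_0 and y_g, which gives two signs. *)
Lemma opw_relator v : opw (phiw (relator g)) v = v.
Proof.
rewrite relatorE.
have x0y0 : nextto C (xl g 0) (yl g 0) by apply: next_xy.
have x0yg : nextto C (xl g 0) (yl g g) by apply: next_xy => //; rewrite !eqxx !orbT.
have h n : (n <= g)%N -> opw (phiw (relator_upto g n)) v =
   opw [:: xl g 0; yl g 0; yl g n; xl g 0; yl g n; yl g 0] v.
  elim: n v => [|n IH] u ng; first by rewrite /opw /= !opK.
  rewrite relator_uptoS phiw_cat (phiw_comm ng) [LHS]opw_cat (IH _ (ltnW ng)).
  have xy : nextto C (xl g n.+1) (yl g n) by apply: next_xy; rewrite ?eqxx ?orbT // ltnW.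
  have xy' : nextto C (xl g n.+1) (yl g n.+1) by apply: next_xy; rewrite ?eqxx ?orbT.
  apply: (@comm_telescope _ (op (xl g 0)) (op (xl g n.+1)) (op (yl g 0))
    (op (yl g n)) (op (yl g n.+1)));
    [exact: opK|exact: opK|exact: opK|exact: opK|exact: opK|exact: opN|exact: opN|exact: opN|exact: opN| |] => w; exact: op_anti.
have fin (T : zmodType) (x y yn : T -> T) (u : T) : involutive x -> involutive y -> involutive yn ->
   (forall u, x (- u) = - x u) -> (forall u, y (- u) = - y u) ->
   (forall u, yn (- u) = - yn u) -> (forall u, x (yn u) = - yn (x u)) -> (forall u, x (y u) = - y (x u)) ->
   x (y (yn (x (yn (y u))))) = u.
  by move=> xK yK ynK xN yN ynN a a'; rewrite a ynN ynK yN xN a' opprK xK yK.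
rewrite (h _ (leqnn g)); apply: (@fin _ (op (xl g 0)) (op (yl g 0)) (op (yl g g)));
  [exact: opK|exact: opK|exact: opK|exact: opN|exact: opN|exact: opN| |] => w; exact: op_anti.
Qed.

Lemma Emx_equiv (u u' : seq (letter g)) : word_equiv u u' -> Emx (phiw u) = Emx (phiw u').
Proof.
move=> h; apply: opw_inj; rewrite ?even_phiw // => v.
elim: h v => {u u'} [u|u u' _ IH|u1 u2 u3 _ IH _ IH'|l u u'|u u'] v //.
- by rewrite IH IH'.
- have e : phiw (l :: linv l :: u') = phi l ++ phi (linv l) ++ phiw u' by [].
  by rewrite (phiw_cat u) e (phiw_cat u) !opw_cat opw_phiV.
- by rewrite !phiw_cat !opw_cat opw_relator.
Qed.

Definition rho_mx (x : G) := Emx (phiw (repr x)).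

Lemma rho_class u : rho_mx (class_of u) = Emx (phiw u).
Proof. exact/Emx_equiv/repr_class_of. Qed.

Lemma rho_det x : \det (rho_mx x) = 1.
Proof. by rewrite det_Emx -signr_odd even_phiw expr0. Qed.

Lemma rho_mul x y : rho_mx (x * y)%g = rho_mx x *m rho_mx y.
Proof.
rewrite -{1}(class_of_repr x) -{1}(class_of_repr y) sgM rho_class phiw_cat Emx_cat.
by rewrite even_phiw.
Qed.

Definition bead_rep := SL2Representation rho_det rho_mul.

Lemma herm_act_word w (o : V) : herm_mx (act C w o) =
  Emx w *m (if odd (size w) then mxconj (herm_mx o) else herm_mx o) *m (Emx w) ^t*.
Proof.
elim: w => [|a w IH] /=.
  have -> : (1%:M : 'M[R[i]]_2) ^t* = 1%:M.
    by rewrite mx2_1 mx2_adj; congr mx2; apply: cplx_ext; rewrite /= ?oppr0.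
  by rewrite mul1mx mulmx1.
rewrite bead_mx_refl ?csq_gt0 // IH !mxconjM mxconj_adj adjM !mulmxA.
by case: odd; rewrite ?mxconjK.
Qed.

Lemma mxact_word w o : odd (size w) = false -> mxact (Emx w) o = act C w o.
Proof. by move=> e; rewrite -[RHS]herm_coordK herm_act_word e. Qed.

Definition gact (x : G) (o : V) := mxact (rho_mx x) o.

Lemma gact_word x o : gact x o = act C (phiw (repr x)) o.
Proof. by rewrite /gact mxact_word // even_phiw. Qed.

Lemma gact_class u o : gact (class_of u) o = act C (phiw u) o.
Proof. by rewrite /gact rho_class mxact_word // even_phiw. Qed.

Lemma gactM x y o : gact (x * y)%g o = gact x (gact y o).
Proof. by rewrite /gact rho_mul mxactM. Qed.

Lemma gact1 o : gact 1%g o = o.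
Proof. by rewrite -sg1 gact_class. Qed.

Lemma gactK x o : gact x^-1%g (gact x o) = o.
Proof. by rewrite -gactM mulVg gact1. Qed.

Lemma gactVK x o : gact x (gact x^-1%g o) = o.
Proof. by rewrite -gactM mulgV gact1. Qed.

Let is_word x w := forall o, gact x o = act C w o.

Let is_wordM x y w w' : is_word x w -> is_word y w' -> is_word (x * y)%g (w ++ w').
Proof. by move=> h h' o; rewrite gactM act_cat h h'. Qed.

Let is_wordV x w : is_word x w -> is_word x^-1%g (rev w).
Proof. by move=> h o; rewrite -{1}(act_Krev C w o) -h gactK. Qed.

Let is_word1 : is_word 1%g [::]. Proof. by move=> o; rewrite gact1. Qed.

Let is_word_eq x w w' : is_word x w -> (forall o, act C w o = act C w' o) -> is_word x w'.
Proof. by move=> h e o; rewrite h e. Qed.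

Let rK a : involutive (refl (C a)). Proof. exact/reflK/csq_gt0. Qed.

Let rC a b o : nextto C a b -> refl (C a) (refl (C b) o) = refl (C b) (refl (C a) o).
Proof. by move=> h; rewrite refl_comm // next_orth. Qed.

Lemma BB_word k : (k <= g)%N -> is_word (BB g k) [:: yl g 0; yl g k].
Proof.
elim: k => [_|k IH kg] /=; first by apply: is_word_eq is_word1 _ => o /=; rewrite rK.
have h : is_word (gen g true k) (phi_pos g true k).
  by move=> o; rewrite (gen_ord true (Ordinal kg)) gact_class.
by apply: is_word_eq (is_wordM h (IH (ltnW kg))) _ => o /=; rewrite !rK.
Qed.

Lemma XX_word k : (k <= g)%N -> is_word (XX g k) [:: xl g k; xl g 0].
Proof.
case: k => [_|k kg] /=; first by apply: is_word_eq is_word1 _ => o /=; rewrite rK.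
have h : is_word (gen g false k) (phi_pos g false k).
  by move=> o; rewrite (gen_ord false (Ordinal kg)) gact_class.
have hB := BB_word (ltnW kg).
apply: is_word_eq (is_wordM (is_wordM (is_wordV hB) (is_wordV h)) hB) _ => o /=.
by rewrite !rK.
Qed.

Lemma PP_word k : (k <= g)%N -> is_word (PP g k) [:: xl g 0; yl g 0; yl g k; xl g 0].
Proof.
elim: k => [_|k IH kg]; first by apply: is_word_eq is_word1 _ => o /=; rewrite !rK.
have hB := BB_word (ltnW kg); have hB' := BB_word kg; have hX := XX_word kg.
have hd := is_wordM (is_wordM (is_wordV hX) (is_wordM (is_wordV hB) hB')) hX.
apply: is_word_eq (is_wordM (IH (ltnW kg)) hd) _ => o /=; rewrite !rK.
have xy : nextto C (xl g k.+1) (yl g k) by apply: next_xy; rewrite ?eqxx ?orbT // ltnW.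
have xy' : nextto C (xl g k.+1) (yl g k.+1) by apply: next_xy; rewrite ?eqxx ?orbT.
by rewrite (rC _ xy) (rC _ xy') !rK.
Qed.

Lemma YY_word k : (k <= g)%N -> is_word (YY g k) [:: yl g k; yl g g].
Proof.
move=> kg; apply: is_word_eq (is_wordM (is_wordV (BB_word kg)) (BB_word (leqnn g))) _ => o /=.
by rewrite rK.
Qed.

Lemma YY'_word k : (k <= g)%N -> is_word (YY' g k) [:: xl g 0; yl g k; yl g g; xl g 0].
Proof.
move=> kg; apply: is_word_eq (is_wordM (is_wordV (PP_word kg)) (PP_word (leqnn g))) _ => o /=.
by rewrite !rK.
Qed.

Lemma XX'_word k : (k <= g)%N -> is_word (XX' g k) [:: yl g g; xl g k; yl g g; xl g 0].
Proof.
move=> kg; apply: is_word_eq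
  (is_wordM (is_wordM (is_wordV (YY_word kg)) (XX_word kg)) (YY'_word kg)) _ => o /=.
have xy : nextto C (xl g k) (yl g k) by apply: next_xy; rewrite ?eqxx.
by rewrite !rK (rC _ xy) !rK.
Qed.

(* The spanning tree of the four chambers modulo the surface group. *)
Definition tree (c : bool * bool) : seq L :=
  (if c.1 then [:: xl g 0] else [::]) ++ (if c.2 then [:: yl g g] else [::]).

Lemma gam_word c a : is_word (gam c a) (tree c ++ a :: rev (tree (step c a))).
Proof.
case: c a => c d [t i]; have ig : (i <= g)%N by rewrite -ltnS.
have ei : inord i = i by apply/val_inj; rewrite /= inordK.
have X := XX_word ig; have X' := XX'_word ig; have Y := YY_word ig; have Y' := YY'_word ig.
rewrite /xl /yl ei in X X' Y Y'.
case: t c d => [] [] [] /=; rewrite /gam /tree /step /xl /yl /rev /=.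
all: first [exact: X|exact: X'|exact: Y|exact: Y'|exact: (is_wordV X)|exact: (is_wordV X')
  |exact: (is_wordV Y)|exact: (is_wordV Y')].
Qed.

(** Up to the spanning tree, every reflection word is the action of a surface group element. Through
    this, statements on the reflection group such as [untame_crossing] apply to the deck action. *)
Lemma psi_word c w : is_word (psi c w) (tree c ++ w ++ rev (tree (stepw c w))).
Proof.
elim: w c => [|a w IH] c.
  by move=> o; rewrite [RHS]act_cat act_Krev gact1.
move=> o; rewrite (is_wordM (gam_word c a) (IH (step c a))).
rewrite -/(stepw _ _) act_cat [in LHS]act_cat [in LHS](act_cat _ (tree (step c a))).
by rewrite [RHS]act_cat /= act_revK.
Qed.

End Representation.

(** * The orbit maps are quasi-isometric embeddings *)

Section QuasiFuchsian.
Variables (R : realType) (g : nat) (C : necklace R (bead_letter g)).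
Hypothesis hC : nextto C =2 @bead_next g.
Local Notation V := 'rV[R]_4.
Local Notation L := (bead_letter g).
Local Notation G := (surface_group g).
Local Open Scope sesquilinear_scope.

Lemma word_length_le (w : seq (letter g)) : (word_length (class_of w) <= size w)%N.
Proof.
rewrite /word_length; case: ex_minnP => m _; apply.
by apply/asboolP; exists w.
Qed.

Lemma word_lengthP (x : G) : exists2 w, size w = word_length x & class_of w = x.
Proof. by rewrite /word_length; case: ex_minnP => m /asboolP [w sw e] _; exists w. Qed.

Lemma word_lengthM (x y : G) : (word_length (x * y)%g <= word_length x + word_length y)%N.
Proof.
have [w <- ex] := word_lengthP x; have [w' <- ey] := word_lengthP y.
by rewrite -ex -ey sgM -size_cat; exact: word_length_le.
Qed.

Lemma word_length_psi : exists M : nat, forall c (w : seq L),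
  (word_length (psi c w) <= M * size w)%N.
Proof.
exists (\max_(ca : (bool * bool) * L) word_length (gam ca.1 ca.2)) => c w.
elim: w c => [|a w IH] c; first by rewrite muln0 /= -(sg1 g) word_length_le.
apply: leq_trans (word_lengthM _ _) _; rewrite /= mulnS leq_add //.
exact: (leq_bigmax (c, a)).
Qed.

Lemma invmx_herm (o : V) : bil o o = 2 ->
  invmx (herm_mx o) = mx2 (cr o)%:C%C (- (cs o +i* ct o)%C) (- (cs o -i* ct o)%C) (cp o)%:C%C.
Proof.
move=> h; have hd : \det (herm_mx o) = 1.
  by rewrite herm_det h divff ?pnatr_eq0.
have hu : herm_mx o \in unitmx by rewrite unitmxE hd unitr1.
apply: (can_inj (mulKmx hu)); rewrite mulmxV // herm_mxE mx2M mx2_1.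
by congr mx2; apply: cplx_ext; rewrite !reimE /=; move: h; rewrite /bil; lra.
Qed.

Lemma hyp3_pd M : hyp3 M -> exists o : V, [/\ pd o, bil o o = 2 & M = herm_mx o].
Proof.
case=> hM pos dM; exists (herm_coord M); have e := herm_coordP hM.
set o := herm_coord M in e *.
have b2 : bil o o = 2.
  have := congr1 (@complex.Re R) dM; rewrite -e herm_det /= => h.
  by rewrite -(divfK (_ : 2 != 0) (bil o o)) ?h ?mul1r // pnatr_eq0.
split=> //; split; last by rewrite b2.
- have z0 : (delta_mx 0 0 : 'cV[R[i]]_2) != 0.
    by apply/eqP => /matrixP/(_ 0 0)/eqP; rewrite !mxE eqxx oner_eq0.
  have := pos _ z0; rewrite -e herm_mxE adjE.
  rewrite !mxE big_ord_recl big_ord1 !mxE !big_ord_recl !big_ord0 !mxE /=.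
  rewrite ltcE => /andP [_] /=; rewrite ?reimE /=; lra.
- have z0 : (delta_mx 1 0 : 'cV[R[i]]_2) != 0.
    by apply/eqP => /matrixP/(_ 1 0)/eqP; rewrite !mxE eqxx oner_eq0.
  have := pos _ z0; rewrite -e herm_mxE adjE.
  rewrite !mxE big_ord_recl big_ord1 !mxE !big_ord_recl !big_ord0 !mxE /=.
  rewrite ltcE => /andP [_] /=; rewrite ?reimE /=; lra.
Qed.

Lemma hyp3_dist_bil (a b : V) : bil a a = 2 -> hyp3_dist (herm_mx a) (herm_mx b) = arcosh (bil a b / 2).
Proof.
move=> h; rewrite /hyp3_dist invmx_herm // herm_mxE mx2M; congr (arcosh (_ / _)).
rewrite /mxtrace big_ord_recl big_ord1.
have -> : lift ord0 ord0 = 1 :> 'I_2 by apply/val_inj.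
rewrite !mx2E !reimE /= /bil; ring.
Qed.

Lemma hyp3_act_coord h (o : V) : hyp3_act h (herm_mx o) = herm_mx (mxact h o).
Proof. by rewrite herm_mxact. Qed.

Lemma pd_compare (a b : V) : pd a -> pd b -> exists2 c, 0 < c & psd (a - c *: b).
Proof.
move=> ha hb; have [c c0 h] := pd_lower ha.
have hcb : pd (idv R - (2 * tr b)^-1 *: b).
  have tb := pd_tr hb; set t := (2 * tr b)^-1.
  have t0 : 0 < t by rewrite invr_gt0 mulr_gt0.
  have tt : t * tr b = 2^-1 by rewrite /t; field; rewrite gt_eqF.
  have [h1 h2 h3 h4] := psd_coord (pd_psd hb).
  have q1 : t * cp b <= 2^-1 by rewrite -tt ler_wpM2l // ltW.
  have q2 : t * cr b <= 2^-1 by rewrite -tt ler_wpM2l // ltW.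
  split; rewrite ?cpD ?crD ?cpN ?crN ?cpZ ?crZ ?vecE; [lra|lra|].
  rewrite bilDl !bilDr !bilNl !bilNr !bilZl !bilZr (bilC (idv R) b) !bil_idv tt.
  have -> : tr (idv R) = 2 by rewrite /tr /idv !vecE.
  have : 0 < t * (t * bil b b) by rewrite !mulr_gt0 //; case: hb.
  lra.
exists (c * (2 * tr b)^-1); first by rewrite mulr_gt0 // invr_gt0 mulr_gt0 // pd_tr.
have -> : a - (c * (2 * tr b)^-1) *: b = (a - c *: idv R) + c *: (idv R - (2 * tr b)^-1 *: b).
  by apply: vec_ext; rewrite !coordE; ring.
by apply: psdD => //; apply: psdZ; [exact: ltW|exact: pd_psd].
Qed.

Lemma act_upper : exists2 A : R, 1 <= A & forall w o, psd o -> tr (act C w o) <= A ^+ size w * tr o.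
Proof.
have [i|i x y|A A0 hA] := @fin_pos_min R L (fun i k => forall o, psd o -> k * tr (refl (C i) o) <= tr o).
- have [c c0 hc] := pd_bil_upper (pd_refl (csq_gt0 C i) (pd_idv R)).
  exists c^-1; first by rewrite invr_gt0.
  move=> o ho; rewrite mulrC ler_pdivrMr // mulrC -bil_idv bilC.
  by rewrite -(reflK (csq_gt0 C i) (idv R)) bil_refl ?csq_gt0 // hc.
- move=> y0 yx h o ho; apply: le_trans (h o ho); rewrite ler_wpM2r //.
  by apply: psd_tr; apply: psd_refl => //; exact: csq_gt0.
exists (1 + A^-1); first by rewrite lerDl invr_ge0 ltW.
elim=> [|a w IH] o ho /=; first by rewrite expr0 mul1r.
have h := hA a _ (psd_act C w ho).
have t0 : 0 <= tr (refl (C a) (act C w o)).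
  by apply: psd_tr; apply: psd_refl; [exact: csq_gt0|exact: psd_act].
have h' : tr (refl (C a) (act C w o)) <= A^-1 * tr (act C w o).
  by rewrite mulrC ler_pdivlMr // mulrC.
apply: (le_trans h'); rewrite exprS -mulrA.
apply: ler_pM; [by rewrite invr_ge0 ltW|exact/psd_tr/psd_act|by rewrite lerDr|exact: IH].
Qed.

Lemma bil_gact (x : G) a b : bil (gact C x a) (gact C x b) = bil a b.
Proof. by rewrite !gact_word bil_act. Qed.

Lemma lnMX (x y : R) m : 0 < x -> 0 < y -> ln (x * y ^+ m) = ln x + ln y * m%:R.
Proof. by move=> x0 y0; rewrite lnM ?posrE ?exprn_gt0 // lnXn // mulr_natr. Qed.

Lemma arcosh_ge (y : R) : 0 < y -> ln y <= arcosh y.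
Proof.
move=> y0; rewrite /arcosh ler_ln ?posrE //; first by rewrite lerDl sqrtr_ge0.
by rewrite ltr_wpDr // sqrtr_ge0.
Qed.

Lemma arcosh_le (y : R) : 0 < y -> arcosh y <= ln (2 * y).
Proof.
move=> y0; rewrite /arcosh ler_ln ?posrE ?mulr_gt0 //; last by rewrite ltr_wpDr // sqrtr_ge0.
suff : Num.sqrt (y ^+ 2 - 1) <= y by lra.
rewrite -[leRHS](gtr0_norm y0) -sqrtr_sqr ler_wsqrtr //.
by lra.
Qed.

Lemma bead_rep_quasi_fuchsian : quasi_fuchsian (bead_rep hC).
Proof.
move=> _ /hyp3_pd [ o [ho b2 ->]].
have [k k0 hk] := good_growth C.
have [A A1 hA] := act_upper.
have [M hM] := word_length_psi.
have [c1 c10 hc1] := pd_compare ho (base_pd C).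
have [c2 c20 hc2] := pd_bil_upper ho.
have o0 := psd_bil (pd_psd ho) (pd_psd ho).
pose f (x : G) := bil o (gact C x o).
have dist x y : hyp3_dist (hyp3_act (bead_rep hC x) (herm_mx o))
    (hyp3_act (bead_rep hC y) (herm_mx o)) = arcosh (f (x^-1 * y)%g / 2).
  rewrite !hyp3_act_coord hyp3_dist_bil; last by rewrite (bil_gact x).
  have e : bil (gact C x o) (gact C y o) = f (x^-1 * y)%g.
    by rewrite /f (gactM hC) -[RHS](bil_gact x) (gactVK hC).
  by rewrite -e.
have bb : 0 < bil (base C) (base C) by case: (base_pd C).
(* A good word for [x] serves twice: rewritten by [psi], its size bounds the word length, and by
   [good_growth] it bounds the pairing from below. *)
have lower x : exists2 n : nat, (word_length x <= M * n)%N &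
    c1 * c1 * bil (base C) (base C) * (1 + k) ^+ (n.-1)./2 <= f x.
  have [w [e gw _]] := good_word C (phiw (repr x)).
  exists (size w).
    by rewrite -{1}(class_of_repr x) -psi_phiw (psi_weq _ (next_weq hC e)).
  rewrite /f gact_word (weq_act _ e).
  have h1 := hk _ gw.
  have h2 : c1 * bil (base C) (act C w (base C)) <= bil o (act C w (base C)).
    have := psd_bil hc1 (psd_act C w (pd_psd (base_pd C))).
    by rewrite bilDl bilNl bilZl; lra.
  have h3 : c1 * bil o (act C w (base C)) <= bil o (act C w o).
    have := psd_bil (pd_psd ho) (psd_act C w hc1).
    rewrite actD -scaleN1r !actZ bilDr !bilZr; lra.
  apply: le_trans h3; rewrite -!mulrA ler_wpM2l ?(ltW c10) //.
  apply: le_trans h2; rewrite ler_wpM2l ?(ltW c10) // mulrC //.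
have fpos x : 0 < f x.
  have [n _] := lower x; apply: lt_le_trans.
  by rewrite !mulr_gt0 // exprn_gt0 // ltr_wpDr // ltW.
(* A letter of the surface group becomes at most 6 reflections, whence the power of [A]. *)
have upper x : f x <= c2 * tr o * (A ^+ 6) ^+ word_length x.
  have [w sw ex] := word_lengthP x; rewrite -sw -ex /f gact_class //.
  apply: le_trans (hc2 _ (psd_act C _ (pd_psd ho))) _.
  rewrite -mulrA ler_wpM2l ?(ltW c20) // mulrC; apply: le_trans (hA _ _ (pd_psd ho)) _.
  rewrite ler_wpM2r ?(ltW (pd_tr ho)) // -exprM ler_weXn2l //.
  elim: w {sw ex} => [|l w IH] //; rewrite /phiw /= -/(phiw w) size_cat mulnS leq_add //.
  by case: l => [[i []] []].
pose B := c1 * c1 * bil (base C) (base C) / 2.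
have B0 : 0 < B by rewrite !mulr_gt0.
have lk0 : 0 < ln (1 + k) by rewrite ln_gt0 // ltrDl.
pose D := c2 * tr o.
have D0 : 0 < D by rewrite mulr_gt0 // pd_tr.
have lA0 : 0 <= ln (A ^+ 6) by rewrite ln_ge0 // exprn_ege1.
(* The second term comes from the lower bound: the distance is about n / 2 * ln (1 + k) or more, for
   a word length of at most M n. The third term is the growth rate in the upper bound. *)
pose K := 1 + 2 * M%:R / ln (1 + k) + ln (A ^+ 6).
pose c := `|ln B| + 2 * ln (1 + k) + `|ln D|.
have q0 : 0 <= 2 * M%:R / ln (1 + k) by rewrite divr_ge0 ?mulr_ge0 // ltW.
exists K, c; split; [by rewrite /K; lra| |].
  by rewrite /c !addr_ge0 ?normr_ge0 // mulr_ge0 // ltW.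
move=> x y; rewrite dist /word_dist; set z := (x^-1 * y)%g.
have fz : 0 < f z / 2 by rewrite divr_gt0.
split.
  apply: le_trans (arcosh_ge fz).
  have [n ln_ hn] := lower z.
  have e1 : ln (B * (1 + k) ^+ (n.-1)./2) <= ln (f z / 2).
    rewrite ler_ln ?posrE // ?mulr_gt0 ?exprn_gt0 //; try lra.
    by rewrite /B mulrAC ler_pM2r ?invr_gt0.
  have k1 : 0 < 1 + k by lra.
  rewrite (lnMX _ B0 k1) in e1.
  apply: le_trans e1.
  have n2 : (n%:R : R) <= 2 * ((n.-1)./2)%:R + 2.
    have : (n <= 2 * (n.-1)./2 + 2)%N.
      case: n {ln_ hn} => // n /=; rewrite -{1}(odd_double_half n) -mul2n -addSn addnC leq_add2l.
      by case: odd.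
    by rewrite -(ler_nat R) natrD natrM.
  have wl : (word_length z)%:R <= M%:R * n%:R :> R by rewrite -natrM ler_nat.
  have K0 : 0 < K by rewrite /K; lra.
  have lB : - `|ln B| <= ln B by rewrite lerNl (le_trans (ler_norm _)) // normrN.
  have w1 : (word_length z)%:R / K <= ln (1 + k) * n%:R / 2.
    rewrite ler_pdivrMr //; apply: (le_trans wl).
    apply: le_trans (_ : ln (1 + k) * n%:R / 2 * (2 * M%:R / ln (1 + k)) <= _).
      by rewrite le_eqVlt; apply/orP; left; apply/eqP; field; rewrite gt_eqF.
    rewrite ler_wpM2l // /K; last lra.
    by rewrite !mulr_ge0 // ltW.
  have : ln (1 + k) * n%:R <= ln (1 + k) * (2 * ((n.-1)./2)%:R + 2) by rewrite ler_wpM2l // ltW.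
  by have := normr_ge0 (ln D); rewrite /c; lra.
apply: (le_trans (arcosh_le fz)); rewrite mulrC divfK ?pnatr_eq0 //.
apply: le_trans (_ : ln (D * (A ^+ 6) ^+ word_length z) <= _).
  rewrite ler_ln ?posrE ?upper // mulr_gt0 // exprn_gt0 // exprn_gt0 //; lra.
have A60 : 0 < A ^+ 6 by rewrite exprn_gt0 //; lra.
rewrite (lnMX _ D0 A60).
have lD : ln D <= `|ln D| by exact: ler_norm.
have : ln (A ^+ 6) * (word_length z)%:R <= K * (word_length z)%:R.
  by rewrite ler_wpM2r // /K; lra.
by have := normr_ge0 (ln B); rewrite /c; lra.
Qed.

End QuasiFuchsian.

(** * Local analysis of fitting immersions *)

Section PairCalculus.
Variable R : realType.
Local Notation V := 'rV[R]_4.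
Local Notation P2 := 'rV[R]_2.
Implicit Types (o q : V) (y w : P2).

Lemma norm_coord n (x : 'rV[R]_n) i : `|x 0 i| <= `|x|.
Proof.
rewrite [leRHS]/Num.Def.normr /= mx_normrE; apply: le_trans; last exact: (le_bigmax _ _ (0, i)).
by [].
Qed.

Lemma norm_le n (x : 'rV[R]_n) M : 0 <= M -> (forall i, `|x 0 i| <= M) -> `|x| <= M.
Proof.
move=> M0 h; rewrite [leLHS]/Num.Def.normr /= mx_normrE bigmax_le // => -[i j] _ /=.
by rewrite ord1.
Qed.

Lemma pairDl a b q : pair (a + b) q = pair a q + pair b q.
Proof. rewrite /pair !coordE; ring. Qed.
Lemma pairDr a b o : pair o (a + b) = pair o a + pair o b.
Proof. rewrite /pair !coordE; ring. Qed.
Lemma pairZl k a q : pair (k *: a) q = k * pair a q.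
Proof. rewrite /pair !coordE; ring. Qed.
Lemma pairZr k o q : pair o (k *: q) = k * pair o q.
Proof. rewrite /pair !coordE; ring. Qed.
Lemma pairNl a q : pair (- a) q = - pair a q.
Proof. rewrite /pair !coordE; ring. Qed.
Lemma pairNr a q : pair a (- q) = - pair a q.
Proof. rewrite /pair !coordE; ring. Qed.

Lemma pair_norm o q : `|pair o q| <= 6 * `|o| * `|q|.
Proof.
have h i : `|o 0 i * q 0 i| <= `|o| * `|q| by rewrite normrM ler_pM ?norm_coord.
have := h 0; have := h 1; have := h 2%:R; have := h 3%:R.
rewrite !ler_norml /pair -!/(cp _) -!/(cr _) -!/(cs _) -!/(ct _).
move=> /andP[? ?] /andP[? ?] /andP[? ?] /andP[? ?]; apply/andP; split; lra.
Qed.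

Lemma psd_norm o : psd o -> `|o| <= tr o.
Proof.
move=> h; have [h1 h2 h3 h4] := psd_coord h; have [p r _] := h.
apply: norm_le; first exact: psd_tr.
by move=> i; case: (ord4P i) => -> //; rewrite ger0_norm.
Qed.

Section Derivatives.
Variable W : normedModType R.

Lemma is_derive_lin4 (a b c d : R) (f0 f1 f2 f3 : W -> R) (x w : W) (d0 d1 d2 d3 : R) :
  is_derive x w f0 d0 -> is_derive x w f1 d1 -> is_derive x w f2 d2 -> is_derive x w f3 d3 ->
  is_derive x w (fun z => a * f0 z + b * f1 z + c * f2 z + d * f3 z)
    (a * d0 + b * d1 + c * d2 + d * d3).
Proof.
move=> h0 h1 h2 h3.
exact: (is_deriveD (is_deriveD (is_deriveD (is_deriveZ a h0) (is_deriveZ b h1))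
  (is_deriveZ c h2)) (is_deriveZ d h3)).
Qed.

Lemma is_derive_pair o (f : W -> V) (x w : W) : derivable f x w ->
  is_derive x w (fun z => pair o (f z)) (pair o ('D_w f x)).
Proof.
move=> df; have /derivable_mxP dm := df.
have dfi i : is_derive x w (fun z => f z 0 i) ('D_w f x 0 i).
  by rewrite derive_mx // mxE; exact: derivableP (dm 0 i).
have := dfi 0; have := dfi 1; have := dfi 2%:R; have := dfi 3%:R.
move=> d3 d2 d1 d0.
exact: (is_derive_lin4 (cp o) (cr o) (2 * cs o) (2 * ct o) d0 d1 d2 d3).
Qed.

Lemma is_derive_line (f : W -> V) (y w : W) (t : R) : derivable f (y + t *: w) w ->
  is_derive t 1 (fun s : R => f (y + s *: w)) ('D_w f (y + t *: w)).
Proof.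
move=> df; have e : (fun h : R => h^-1 *: (f (y + (h *: (1 : R) + t) *: w) - f (y + t *: w)))
   = (fun h : R => h^-1 *: (f (h *: w + (y + t *: w)) - f (y + t *: w))).
  apply/funext => h; congr (_ *: (f _ - _)).
  by rewrite scalerDl addrCA /GRing.scale /= mulr1.
by split; rewrite /derivable /derive /= ?e.
Qed.

End Derivatives.

Lemma derivable_pair_line (W : normedModType R) o (f : W -> V) (y w : W) (t : R) :
  derivable f (y + t *: w) w ->
  is_derive t 1 (fun s : R => pair o (f (y + s *: w))) (pair o ('D_w f (y + t *: w))).
Proof.
move=> df; have [d e] := is_derive_line df; rewrite -e.
exact: (@is_derive_pair R^o o (fun s : R => f (y + s *: w)) t 1 d).
Qed.

Definition e0 : P2 := delta_mx 0 0.
Definition e1 : P2 := delta_mx 0 1.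

Lemma rV2E w : w = w 0 0 *: e0 + w 0 1 *: e1.
Proof.
apply/rowP => i; rewrite !mxE /=; case: (ord2P i) => -> /=; ring.
Qed.

Lemma derive_basis (f : P2 -> V) y w : differentiable f y ->
  'D_w f y = w 0 0 *: 'D_e0 f y + w 0 1 *: 'D_e1 f y.
Proof. by move=> df; rewrite !deriveE // {1}(rV2E w) linearD !linearZ. Qed.

Lemma ball_line y0 r y w (t : R) : ball y0 r y -> ball y0 r (y + w) -> 0 <= t <= 1 ->
  ball y0 r (y + t *: w).
Proof.
rewrite -!ball_normE /ball_ /= => h h' /andP[t0 t1].
have -> : y0 - (y + t *: w) = (1 - t) *: (y0 - y) + t *: (y0 - (y + w)).
  by apply/rowP => i; rewrite !mxE; ring.
apply: le_lt_trans (ler_normD _ _) _; rewrite !normrZ (ger0_norm t0) ger0_norm ?subr_ge0 //.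
case: (ltP 0 t) => [tp|tn].
  have := ltr_pM2l tp `|y0 - (y + w)| r; rewrite h' => H.
  have : (1 - t) * `|y0 - y| <= (1 - t) * r by rewrite ler_wpM2l ?subr_ge0 // ltW.
  lra.
have -> : t = 0 by apply/eqP; rewrite eq_le tn.
by rewrite subr0 mul1r mul0r addr0.
Qed.

Lemma pair_mvt o (f : P2 -> V) y0 r y y' :
  (forall z, ball y0 r z -> differentiable f z) -> ball y0 r y -> ball y0 r y' ->
  exists2 z, ball y0 r z & pair o (f y) - pair o (f y') = pair o ('D_(y - y') f z).
Proof.
move=> df hy hy'; set w := y - y'.
have hb (t : R) : 0 <= t <= 1 -> ball y0 r (y' + t *: w).
  by move=> ht; apply: ball_line => //; rewrite /w addrC subrK.
have der (t : R) : 0 <= t <= 1 -> is_derive t 1 (fun s : R => pair o (f (y' + s *: w)))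
     (pair o ('D_w f (y' + t *: w))).
  by move=> ht; apply: derivable_pair_line; apply/diff_derivable/df/hb.
have [|t||c hc] := @MVT R (fun s : R => pair o (f (y' + s *: w)))
   (fun s => pair o ('D_w f (y' + s *: w))) 0 1.
- exact: ltr01.
- by rewrite in_itv /= => /andP[/ltW t0 /ltW t1]; apply: der; rewrite t0.
- apply: derivable_within_continuous => t; rewrite in_itv /= => ht.
  by have [] := der t ht.
have yw : y' + w = y by rewrite /w addrC subrK.
rewrite scale1r scale0r addr0 subr0 mulr1 yw => ->.
  exists (y' + c *: w) => //; apply: hb.
  by move: hc; rewrite in_itv /= => /andP[/ltW -> /ltW ->].
Qed.

End PairCalculus.

(** * Positive forms and mixed planes *)

Section PositiveForms.
Variable R : realType.
Local Notation V := 'rV[R]_4.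
Local Notation C := R[i].
Local Open Scope sesquilinear_scope.
Local Open Scope complex_scope.
Implicit Types (o q : V).

Lemma herm_formE q (z : 'cV[C]_2) : (z ^t* *m herm_mx q *m z) 0 0 =
  conjc (z 0 0) * (cp q)%:C * z 0 0 + conjc (z 1 0) * (cs q -i* ct q) * z 0 0 +
  conjc (z 0 0) * (cs q +i* ct q) * z 1 0 + conjc (z 1 0) * (cr q)%:C * z 1 0.
Proof.
have s2 (F : 'I_2 -> C) : \sum_i F i = F 0 + F 1.
  by rewrite big_ord_recl big_ord1; congr (_ + F _); apply/val_inj.
rewrite mxE s2 !mxE !s2 herm_mxE adjE !mx2E !mxE; ring.
Qed.

Lemma posdef_pd q : posdef (herm_mx q) -> pd q.
Proof.
move=> h.
have pos (a b : C) : (a != 0) || (b != 0) -> 0 < complex.Re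
   (conjc a * (cp q)%:C * a + conjc b * (cs q -i* ct q) * a +
  conjc a * (cs q +i* ct q) * b + conjc b * (cr q)%:C * b).
  move=> ab; pose z : 'cV[C]_2 := \col_i (if i == 0 then a else b).
  have z0 : z != 0.
    apply: contraTneq ab => zz; have := congr1 (fun m : 'cV[C]_2 => m 0 0) zz.
    have := congr1 (fun m : 'cV[C]_2 => m 1 0) zz; rewrite !mxE /= => -> ->.
    by rewrite eqxx.
  have := h z z0; rewrite herm_formE !mxE /= ltcE => /andP[_].
  by rewrite !reimE.
have p0 : 0 < cp q.
  have : ((1 : C) != 0) || ((0 : C) != 0) by rewrite oner_eq0.
  by move=> /pos; rewrite !reimE /=; lra.
split => //.
- have : ((0 : C) != 0) || ((1 : C) != 0) by rewrite oner_eq0 orbT.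
  by move=> /pos; rewrite !reimE /=; lra.
- have := pos (- (cs q +i* ct q)) (cp q)%:C.
  have -> : ((cp q)%:C != 0) = true by rewrite eq_complex /= gt_eqF.
  rewrite orbT => /(_ isT); rewrite !reimE /= => hh.
  rewrite -(pmulr_rgt0 _ p0) /bil; nra.
Qed.

Lemma psd_possemidef q : psd q -> possemidef (herm_mx q).
Proof.
move=> [p0 r0 d0] z; rewrite herm_formE; case: (z 0 0) (z 1 0) => [a b] [c d].
rewrite lecE !reimE /=; apply/andP; split; first by apply/eqP; ring.
set u := (X in _ <= X).
pose s := cs q; pose t := ct q; pose p := cp q; pose r := cr q.
have -> : u = p * (a ^+ 2 + b ^+ 2) + r * (c ^+ 2 + d ^+ 2) +
   2 * (s * (a * c + b * d) + t * (b * c - a * d)).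
  by rewrite /u /p /r /s /t; ring.
have h1 : (s * (a * c + b * d) + t * (b * c - a * d)) ^+ 2 <=
    (s ^+ 2 + t ^+ 2) * ((a ^+ 2 + b ^+ 2) * (c ^+ 2 + d ^+ 2)).
  rewrite -subr_ge0 (_ : _ - _ = (s * (b * c - a * d) - t * (a * c + b * d)) ^+ 2) ?sqr_ge0 //.
  ring.
have h2 : s ^+ 2 + t ^+ 2 <= p * r by move: d0; rewrite /bil /p /r /s /t; lra.
have A0 : 0 <= a ^+ 2 + b ^+ 2 by rewrite addr_ge0 ?sqr_ge0.
have C0 : 0 <= c ^+ 2 + d ^+ 2 by rewrite addr_ge0 ?sqr_ge0.
set A := a ^+ 2 + b ^+ 2 in h1 A0 *; set D := c ^+ 2 + d ^+ 2 in h1 C0 *.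
set X := s * _ + _ in h1 *.
have h3 : X ^+ 2 <= (p * A) * (r * D).
  apply: le_trans h1 _; rewrite (_ : p * A * (r * D) = p * r * (A * D)); last by ring.
  by rewrite ler_wpM2r // mulr_ge0.
suff : - (2 * X) <= p * A + r * D by lra.
apply: ler_of_sqr; first by rewrite addr_ge0 // mulr_ge0.
have : 0 <= (p * A - r * D) ^+ 2 by exact: sqr_ge0.
rewrite (_ : (- (2 * X)) ^+ 2 = 4 * X ^+ 2); last by ring.
rewrite (_ : (p * A + r * D) ^+ 2 = (p * A - r * D) ^+ 2 + 4 * (p * A * (r * D))); last by ring.
lra.
Qed.

(** A form of nonnegative determinant is semidefinite up to sign, and a plane contains the opposites
    of its forms. *)
Lemma mixed_neg (P : {vspace V}) q : mixed P -> q \in P -> q != 0 -> bil q q < 0.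
Proof.
case=> _ h hq q0; rewrite ltNge; apply/negP => d.
have nq := h q hq q0; have nq' : ~ possemidef (herm_mx (- q)).
  by apply: h; rewrite ?memvN ?oppr_eq0.
have hpr : 0 <= cp q * cr q.
  by move: d; rewrite /bil; have := sqr_ge0 (cs q); have := sqr_ge0 (ct q); lra.
have [p0|p0] := ltP 0 (cp q).
  by apply/nq/psd_possemidef; split => //; [exact: ltW|rewrite -(pmulr_rge0 _ p0)].
have [r0|r0] := ltP 0 (cr q).
  by apply/nq/psd_possemidef; split => //; [rewrite -(pmulr_lge0 _ r0)|exact: ltW].
by apply/nq'/psd_possemidef; split; rewrite ?cpN ?crN ?oppr_ge0 // bilNl bilNr opprK.
Qed.

(** The adjugate matrix. It identifies forms with points, so that orthogonality to a plane of forms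
    becomes Lorentz orthogonality. *)
Definition dual q : V := vec (cr q) (cp q) (- cs q) (- ct q).

Lemma pair_dual o q : pair o q = bil o (dual q).
Proof. rewrite /pair /bil /dual !vecE; ring. Qed.

Lemma bil_dual a b : bil (dual a) (dual b) = bil a b.
Proof. rewrite /bil /dual !vecE; ring. Qed.

Lemma pd_dual q : pd q -> pd (dual q).
Proof. by case=> p r d; split; rewrite ?bil_dual // /dual !vecE. Qed.

Lemma pair_posdef o q : psd o -> o != 0 -> posdef (herm_mx q) -> 0 < pair o q.
Proof.
move=> ho o0 /posdef_pd/pd_dual/pd_bil_lower [c c0 h].
rewrite pair_dual bilC; apply: lt_le_trans (h _ ho).
by rewrite mulr_gt0 // psd_tr_gt0.
Qed.

End PositiveForms.

(** * The two local equations defined by a fitting immersion *)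

Section LocalFrame.
Variable R : realType.
Local Notation V := 'rV[R]_4.
Local Notation P2 := 'rV[R]_2.
Implicit Types (o : V) (y w : P2).

Definition dl (q0 q1 : V) o w : R := w 0 0 * pair o q0 + w 0 1 * pair o q1.

(** What the solution of the equations uses of a smooth frame vector [q] with partial derivatives
    [q0] and [q1]: the mean value theorem, derivatives along lines, and continuity. *)
Record C1_ball (y0 : P2) (r : R) (q q0 q1 : P2 -> V) : Prop := C1Ball {
  c1_mvt : forall o y y', ball y0 r y -> ball y0 r y' ->
    exists2 z, ball y0 r z & pair o (q y) - pair o (q y') = dl (q0 z) (q1 z) o (y - y');
  c1_line : forall o y w (t : R), ball y0 r (y + t *: w) ->
    is_derive t 1 (fun s : R => pair o (q (y + s *: w)))
      (dl (q0 (y + t *: w)) (q1 (y + t *: w)) o w);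
  c1_cont : forall y, ball y0 r y -> {for y, continuous q};
  c1_cont0 : {for y0, continuous q0};
  c1_cont1 : {for y0, continuous q1}
}.

Lemma lin_pair o (a b : V) w : pair o (w 0 0 *: a + w 0 1 *: b) = dl a b o w.
Proof. by rewrite pairDr !pairZr. Qed.

Lemma pair_derive (q : P2 -> V) o y w : differentiable q y ->
  pair o ('D_w q y) = dl ('D_(@e0 R) q y) ('D_(@e1 R) q y) o w.
Proof.
move=> dq; have H := @lin_pair o ('D_(@e0 R) q y) ('D_(@e1 R) q y) w.
by rewrite (derive_basis w dq); exact H.
Qed.

Lemma smooth_C1 (N : set P2) (q : P2 -> V) y0 (r : R) : N y0 -> smooth_on N q ->
  ball y0 r `<=` N -> C1_ball y0 r q (fun y => 'D_(@e0 R) q y) (fun y => 'D_(@e1 R) q y).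
Proof.
move=> Ny0 sq rN; have [dq dDq] := sq 2%N.
split.
- move=> o y y' hy hy'.
  have [z hz e] := @pair_mvt R o q y0 r y y' (fun z hz => dq z (rN z hz)) hy hy'.
  by exists z => //; rewrite e (pair_derive _ _ (dq z (rN z hz))).
- move=> o y w t h; have d := dq _ (rN _ h).
  by rewrite -(pair_derive o w d); exact: derivable_pair_line (diff_derivable d).
- by move=> y hy; exact: differentiable_continuous (dq y (rN y hy)).
- by have [d _] := dDq (@e0 R); exact: differentiable_continuous (d y0 Ny0).
- by have [d _] := dDq (@e1 R); exact: differentiable_continuous (d y0 Ny0).
Qed.

(** Differentiate the identity at 0: all terms vanish except [a' * d 0]. It is applied to an
    identity obtained by Cramer's rule. *)
Lemma deriv_rank (a E F d d1 d2 : R -> R) (a' d' d1' d2' : R) :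
  is_derive (0 : R) 1 a a' -> is_derive (0 : R) 1 E 0 -> is_derive (0 : R) 1 F 0 ->
  is_derive (0 : R) 1 d d' -> is_derive (0 : R) 1 d1 d1' -> is_derive (0 : R) 1 d2 d2' ->
  a 0 = 0 -> E 0 = 0 -> F 0 = 0 -> d 0 != 0 ->
  (\forall t \near (0 : R), a t * d t = E t * d1 t + F t * d2 t) -> a' = 0.
Proof.
move=> ha hE hF hd hd1 hd2 a0 E0 F0 d0 e.
have h1 := is_deriveM ha hd.
have h2 := is_deriveD (is_deriveM hE hd1) (is_deriveM hF hd2).
have h3 : is_derive (0 : R) 1 (a * d) (E 0 *: d1' + d1 0 *: (0 : R) + (F 0 *: d2' + d2 0 *: (0 : R))).
  by apply: near_eq_is_derive h2; apply: filterS e => t et; exact: esym et.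
have := @derive_val _ _ _ _ _ _ _ h1; rewrite (@derive_val _ _ _ _ _ _ _ h3).
rewrite a0 E0 F0 !scale0r !scaler0 !add0r => /esym/eqP.
by rewrite scaler_eq0 (negbTE d0) /= => /eqP.
Qed.

Lemma pair_gram (a b : V) : a != 0 -> (forall k, b != k *: a) ->
  pair a a * pair b b - pair a b * pair b a != 0.
Proof.
have pos (x : V) : pair x x = 0 -> x = 0.
  rewrite /pair => h; have h1 := sqr_ge0 (cp x); have h2 := sqr_ge0 (cr x).
  have h3 := sqr_ge0 (cs x); have h4 := sqr_ge0 (ct x).
  by apply: vec_ext; rewrite !coordE; apply/eqP; rewrite -sqrf_eq0; apply/eqP; lra.
move=> a0 h; apply/eqP => e.
have aa : pair a a != 0 by apply: contraNneq a0 => /pos ->.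
have : pair a a *: b - pair a b *: a = 0.
  apply: pos; rewrite !(pairDl, pairDr, pairNl, pairNr, pairZl, pairZr).
  rewrite (_ : _ + _ = pair a a * (pair a a * pair b b - pair a b * pair b a)) ?e ?mulr0 //.
  ring.
move/eqP; rewrite subr_eq0 => /eqP eb; apply/negP: (h (pair a b / pair a a)).
by rewrite negbK mulrC -scalerA -eb scalerA mulVf // scale1r.
Qed.

Lemma span2_indep (a b : V) : \dim (<[a]> + <[b]>)%VS = 2 -> a != 0 /\ forall k, b != k *: a.
Proof.
move=> h; split.
  apply: contra_eq_neq h => ->; rewrite -/(0%VS); apply/eqP => h.
  have : (\dim (<[0 : V]> + <[b]>) <= 1)%N.
    by rewrite -/(0%VS) add0v dim_vline leq_b1.
  by rewrite h.
move=> k; apply: contra_eq_neq h => ->; apply/eqP => h.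
have : (\dim (<[a]> + <[k *: a]>) <= 1)%N.
  have -> : (<[a]> + <[k *: a]> = <[a]>)%VS.
    by apply/addv_idPl; rewrite -memvE memvZ // memv_line.
  by rewrite dim_vline leq_b1.
by rewrite h.
Qed.

Definition orthv o (P : {vspace V}) := forall q, q \in P -> pair o q = 0.

Lemma orthv_span o a b (P : {vspace V}) : P = (<[a]> + <[b]>)%VS ->
  orthv o P <-> pair o a = 0 /\ pair o b = 0.
Proof.
move=> ->; split=> [h|[ha hb] q].
  by split; apply: h; [apply: (subvP (addvSl _ _))|apply: (subvP (addvSr _ _))]; exact: memv_line.
move=> /memv_addP [u /vlineP [k ->] [v /vlineP [l ->] ->]].
by rewrite pairDr !pairZr ha hb !mulr0 addr0.
Qed.

Section Fit.
Variables (O : set P2) (U : P2 -> {vspace V}) (y0 : P2).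
Hypotheses (hfit : fitting_immersion_on O U) (oO : open O) (Oy0 : O y0).

(* A positive definite representative of a tangent direction pairs positively with [o],
   so the two equations [pair o e = pair o f = 0] have injective derivative at [y0]. *)
Lemma fit_frame : exists (N : set P2) (e f : P2 -> V), [/\ open N, N y0, N `<=` O &
  [/\ smooth_on N e, smooth_on N f,
    (forall y, N y -> \dim (U y) = 2 /\ U y = (<[e y]> + <[f y]>)%VS) &
    forall o w, psd o -> o != 0 -> w != 0 -> orthv o (U y0) ->
      ~ (pair o ('D_w e y0) = 0 /\ pair o ('D_w f y0) = 0)]].
Proof.
case: hfit => sm _ fit; have [N [e [f [oN Ny0 se sf hU]]]] := sm _ Oy0.
have sub g : smooth_on N g -> smooth_on (N `&` O) (g : P2 -> V).
  move=> sg k; have := sg k; elim: k g {sg} => [|k IH] g /=.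
    by move=> h y [Ny _]; exact: h.
  by move=> [h1 h2]; split=> [y [Ny _]|v]; [exact: h1|exact/IH/h2].
exists (N `&` O), e, f; split; [exact: openI|by split|by move=> y []|]; split.
- exact: sub.
- exact: sub.
- by move=> y [Ny _]; exact: hU.
move=> o w ho o0 w0 oU [he hf].
have [v [q [hq [N' [e' [[oN' Ny'] se' hU' e'v De']]]]]] := fit _ _ Oy0 w0.
have hoq := pair_posdef ho o0 hq.
(* The derivative of [e'] is [q] modulo the plane, to which [o] is orthogonal; so its pairing with
   [o] is that of [q], which is positive. *)
have : pair o ('D_w e' y0) = 0; last first.
  move=> h; have := oU _ De'; rewrite pairDr pairNr h add0r => /eqP.
  by rewrite oppr_eq0 gt_eqF.
have [_ eU0] := hU _ Ny0.
have [oe of_] := (orthv_span o eU0).1 oU.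
have line g M : open M -> M y0 -> smooth_on M g -> forall x, is_derive (0 : R) 1
    (fun s : R => pair x (g (y0 + s *: w))) (pair x ('D_w g y0)).
  move=> oM My0 sg x; have [dg _] := sg 1%N.
  have := @derivable_pair_line R P2 x g y0 w 0; rewrite scale0r addr0; apply.
  exact/diff_derivable/dg.
have Le := line _ _ oN Ny0 se; have Lf := line _ _ oN Ny0 sf; have Le' := line _ _ oN' Ny' se'.
pose g1 := e y0; pose g2 := f y0.
(* Minors against the fixed vectors [g1] and [g2]. Near 0 the section [e'] is a combination of [e]
   and [f], and Cramer's rule reads e' D(e, f) = e D(e', f) + f D(e, e'), without assuming that the
   coefficients of the combination are differentiable. *)
pose D (a b : P2 -> V) := fun s : R => pair g1 (a (y0 + s *: w)) * pair g2 (b (y0 + s *: w))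
   - pair g1 (b (y0 + s *: w)) * pair g2 (a (y0 + s *: w)).
have LD a b : (forall x, is_derive (0 : R) 1 (fun s : R => pair x (a (y0 + s *: w))) (pair x ('D_w a y0))) ->
  (forall x, is_derive (0 : R) 1 (fun s : R => pair x (b (y0 + s *: w))) (pair x ('D_w b y0))) ->
  exists d, is_derive (0 : R) 1 (D a b) d.
  move=> La Lb; eexists; exact: is_deriveB (is_deriveM (La g1) (Lb g2)) (is_deriveM (Lb g1) (La g2)).
have [d hd] := LD _ _ Le Lf; have [d1 hd1] := LD _ _ Le' Lf; have [d2 hd2] := LD _ _ Le Le'.
have Ef := Le o; have Ff := Lf o; rewrite he in Ef; rewrite hf in Ff.
apply: (deriv_rank (Le' o) Ef Ff hd hd1 hd2); rewrite ?scale0r ?addr0 //.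
- by rewrite e'v; apply: oU; rewrite -e'v; exact: hU'.
- rewrite /D scale0r addr0; have [dm eU] := hU _ Ny0; rewrite eU in dm.
  have [a0 ind] := span2_indep dm; have := pair_gram a0 ind.
  by rewrite (_ : pair (e y0) (f y0) * _ = pair g1 (f y0) * pair g2 (e y0)).
have cl : (fun s : R => y0 + s *: w) @ (0 : R) --> y0 + (0 : R) *: w.
  by apply: cvgD; [exact: cvg_cst|apply: cvgZr_tmp; exact: cvg_id].
rewrite scale0r addr0 in cl.
have nN : \forall s \near (0 : R), (N `&` N') (y0 + s *: w).
  by apply: cl; apply: open_nbhs_nbhs; split; [exact: openI|].
near=> s; have [Ns N's] : (N `&` N') (y0 + s *: w) by near: s.
rewrite /D; have := hU' _ N's; have [_ ->] := hU _ Ns.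
move=> /memv_addP [u /vlineP [k ->] [u' /vlineP [l ->] ->]].
by rewrite !pairDr !pairZr; ring.
Unshelve. all: by end_near. Qed.

End Fit.
End LocalFrame.

Section Topo.
Variable R : realType.
Local Notation V := 'rV[R]_4.
Local Notation P2 := 'rV[R]_2.

Lemma lip_continuous (W : normedModType R) (f : W -> R) (K : R) :
  (forall x y, `|f x - f y| <= K * `|x - y|) -> continuous f.
Proof.
move=> h x; apply/cvgrPdist_le => /= e e0.
have K1 : 0 < `|K| + 1 by rewrite ltr_wpDl.
near=> y; apply: le_trans (h _ _) _.
have : `|x - y| <= e / (`|K| + 1).
  by near: y; apply: (@cvgr_dist_le _ _ _ _ (nbhs_filter x) id x cvg_id); rewrite divr_gt0.
rewrite ler_pdivlMr // => h'; apply: le_trans h'; rewrite mulrC ler_wpM2l //.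
by rewrite (le_trans (ler_norm _)) // lerDl.
Unshelve. all: by end_near. Qed.

Lemma coord_cont n (i : 'I_n) : continuous (fun w : 'rV[R]_n => w 0 i).
Proof.
apply: (@lip_continuous _ _ 1) => x y; rewrite mul1r.
by apply: le_trans (norm_coord (x - y) i); rewrite !mxE.
Qed.

Lemma cp_cont : continuous (@cp R). Proof. exact: coord_cont. Qed.
Lemma cr_cont : continuous (@cr R). Proof. exact: coord_cont. Qed.
Lemma cs_cont : continuous (@cs R). Proof. exact: coord_cont. Qed.
Lemma ct_cont : continuous (@ct R). Proof. exact: coord_cont. Qed.

Lemma pair_cont q : continuous (fun o : V => pair o q).
Proof.
apply: (@lip_continuous _ _ (6 * `|q|)) => x y; rewrite -pairNl -pairDl.
by apply: le_trans (pair_norm _ _) _; rewrite mulrAC.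
Qed.

Section Filters.
Context (T : Type) (F : set_system T) {FF : Filter F}.

Lemma cvg_pairing (f g : T -> V) a b : f @ F --> a -> g @ F --> b ->
  (fun x => pair (f x) (g x)) @ F --> pair a b.
Proof.
move=> fa gb.
have c i : ((fun x => f x 0 i * g x 0 i) @ F --> a 0 i * b 0 i).
  apply: cvgM; [exact: (cvg_comp _ _ fa (@coord_cont _ i a))|].
  exact: (cvg_comp _ _ gb (@coord_cont _ i b)).
have c2 i : ((fun x => 2 * f x 0 i * g x 0 i) @ F --> 2 * a 0 i * b 0 i).
  apply: cvgM; last exact: (cvg_comp _ _ gb (@coord_cont _ i b)).
  by apply: cvgM; [exact: cvg_cst|exact: (cvg_comp _ _ fa (@coord_cont _ i a))].
rewrite /pair; apply: cvgD; first apply: cvgD; first apply: cvgD.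
- exact: c.
- exact: c.
- exact: (c2 2%:R).
- exact: (c2 3%:R).
Qed.

Lemma cvg_bil (f g : T -> V) a b : f @ F --> a -> g @ F --> b ->
  (fun x => bil (f x) (g x)) @ F --> bil a b.
Proof.
move=> fa gb.
have c i j : ((fun x => f x 0 i * g x 0 j) @ F --> a 0 i * b 0 j).
  apply: cvgM; [exact: (cvg_comp _ _ fa (@coord_cont _ i a))|].
  exact: (cvg_comp _ _ gb (@coord_cont _ j b)).
have c2 i : ((fun x => 2 * f x 0 i * g x 0 i) @ F --> 2 * a 0 i * b 0 i).
  apply: cvgM; last exact: (cvg_comp _ _ gb (@coord_cont _ i b)).
  by apply: cvgM; [exact: cvg_cst|exact: (cvg_comp _ _ fa (@coord_cont _ i a))].
rewrite /bil; apply: cvgB; first apply: cvgB; first apply: cvgD.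
- exact: c.
- exact: c.
- exact: (c2 2%:R).
- exact: (c2 3%:R).
Qed.

End Filters.

Lemma tr_cont : continuous (@tr R).
Proof. by move=> o; exact: (cvgD (@cp_cont o) (@cr_cont o)). Qed.

Lemma bil_cont : continuous (fun o : V => bil o o).
Proof. move=> o; exact: (@cvg_bil V (nbhs o) _ id id o o (@cvg_id _ _) (@cvg_id _ _)). Qed.

Lemma closed_ge_fun (W : topologicalType) (f : W -> R) k : continuous f -> closed [set x | k <= f x].
Proof. by move=> cf; apply: (closed_comp _ (@closed_ge _ k)) => x _; exact: cf. Qed.

Lemma closed_eqr (W : topologicalType) (f : W -> R) k : continuous f -> closed [set x | f x = k].
Proof. by move=> cf; apply: (closed_comp _ (@closed_eq _ k)) => x _; exact: cf. Qed.

Lemma open_gt_fun (W : topologicalType) (f : W -> R) k : continuous f -> open [set x | k < f x].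
Proof. by move=> cf; apply: (open_comp _ (@open_gt _ k)) => x _; exact: cf. Qed.

Lemma psd_closed : closed [set o : V | psd o].
Proof.
have -> : [set o : V | psd o] = [set o | 0 <= cp o] `&` ([set o | 0 <= cr o] `&` [set o | 0 <= bil o o]).
  by apply/seteqP; split=> o; [case|case=> ? []].
apply: closedI; first exact: closed_ge_fun cp_cont.
by apply: closedI; [exact: closed_ge_fun cr_cont|exact: closed_ge_fun bil_cont].
Qed.

Lemma pd_open : open [set o : V | pd o].
Proof.
have -> : [set o : V | pd o] = [set o | 0 < cp o] `&` ([set o | 0 < cr o] `&` [set o | 0 < bil o o]).
  by apply/seteqP; split=> o; [case|case=> ? []].
apply: openI; first exact: open_gt_fun cp_cont.
by apply: openI; [exact: open_gt_fun cr_cont|exact: open_gt_fun bil_cont].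
Qed.

Lemma rV_compact_sub n (A : set 'rV[R]_n) (M : R) : closed A -> (forall x, A x -> `|x| <= M) ->
  compact A.
Proof.
move=> cA hM; apply: bounded_closed_compact => //.
exists M; split; first exact: num_real.
by move=> z /ltW Mz x Ax; exact: le_trans (hM x Ax) Mz.
Qed.

Definition ballC : set V := [set o | psd o /\ tr o = 1].

Lemma ballC_compact : compact ballC.
Proof.
apply: (@rV_compact_sub _ _ 1).
  by apply: closedI; [exact: psd_closed|exact: closed_eqr tr_cont].
by move=> o [ho <-]; exact: psd_norm.
Qed.

End Topo.

(** * A quantitative implicit function theorem, uniform in the form *)

Section Newton.
Variable R : realType.
Local Notation V := 'rV[R]_4.
Local Notation P2 := 'rV[R]_2.
Implicit Types (o : V) (y w : P2).

Lemma dl_norm (a b : V) o w : `|dl a b o w| <= 6 * `|o| * (`|a| + `|b|) * `|w|.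
Proof.
rewrite /dl; apply: le_trans (ler_normD _ _) _; rewrite !normrM.
have := ler_pM (normr_ge0 _) (normr_ge0 _) (norm_coord w 0) (pair_norm o a).
have := ler_pM (normr_ge0 _) (normr_ge0 _) (norm_coord w 1) (pair_norm o b).
lra.
Qed.

Lemma dlBo (a b : V) o o' w : dl a b o w - dl a b o' w = dl a b (o - o') w.
Proof. rewrite /dl !pairDl !pairNl; ring. Qed.

Lemma dlBa (a b a' b' : V) o w : dl a b o w - dl a' b' o w = dl (a - a') (b - b') o w.
Proof. rewrite /dl !pairDr !pairNr; ring. Qed.

Variables (y0 : P2) (r1 : R) (e A0 A1 f B0 B1 : P2 -> V).
Hypotheses (r10 : 0 < r1)
  (Ce : forall r, r <= r1 -> C1_ball y0 r e A0 A1)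
  (Cf : forall r, r <= r1 -> C1_ball y0 r f B0 B1)
  (key : forall o w, ballC o -> w != 0 -> pair o (e y0) = 0 -> pair o (f y0) = 0 ->
    ~ (dl (A0 y0) (A1 y0) o w = 0 /\ dl (B0 y0) (B1 y0) o w = 0)).

(** The sum of the four terms is continuous and vanishes nowhere on the compact set of trace-one
    forms and unit directions. Including the two equations themselves makes the bound hold off their
    zero set too. *)
Lemma newton_lower0 : exists2 k, 0 < k & forall o w, ballC o -> `|w| = 1 ->
  k <= `|pair o (e y0)| + `|pair o (f y0)| + `|dl (A0 y0) (A1 y0) o w|
    + `|dl (B0 y0) (B1 y0) o w|.
Proof.
pose G (p : V * P2) := `|pair p.1 (e y0)| + `|pair p.1 (f y0)| + `|dl (A0 y0) (A1 y0) p.1 p.2|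
    + `|dl (B0 y0) (B1 y0) p.1 p.2|.
have cl q : continuous (fun p : V * P2 => pair p.1 q).
  move=> p; apply: (@cvg_comp _ _ _ fst (fun o => pair o q) _ (nbhs p.1)); last exact: pair_cont.
  exact: cvg_fst.
have cw i : continuous (fun p : V * P2 => p.2 0 i).
  move=> p; apply: (@cvg_comp _ _ _ snd (fun w : P2 => w 0 i) _ (nbhs p.2)); last exact: coord_cont.
  exact: cvg_snd.
have cdl a b : continuous (fun p : V * P2 => dl a b p.1 p.2).
  move=> p; exact: (cvgD (cvgM (cw 0 p) (cl a p)) (cvgM (cw 1 p) (cl b p))).
have cG : continuous G.
  move=> p; exact: (cvgD (cvgD (cvgD (cvg_norm (cl _ p)) (cvg_norm (cl _ p)))
     (cvg_norm (cdl _ _ p))) (cvg_norm (cdl _ _ p))).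
pose S1 := [set w : P2 | `|w| = 1].
have cS1 : compact S1.
  apply: (@rV_compact_sub _ _ _ 1); last by move=> x ->.
  by apply: closed_eqr; exact: norm_continuous.
have cK : compact (@ballC R `*` S1) by apply: compact_setX => //; exact: ballC_compact.
have K0 : (@ballC R `*` S1) !=set0.
  exists ((2^-1 : R) *: idv R, e0 R); split => /=.
    split; first by apply: psdZ; [rewrite invr_ge0|exact/pd_psd/pd_idv].
    by rewrite trZ /tr /idv !vecE; lra.
  rewrite /S1 /=; apply/eqP; rewrite eq_le; apply/andP; split.
    by apply: norm_le => // i; rewrite mxE /=; case: (_ == _); rewrite ?normr1 ?normr0.
  by apply: le_trans (norm_coord _ 0); rewrite mxE /= normr1.
have [[oo ww]] := compact_EVT_min K0 cK (continuous_subspaceT cG).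
rewrite inE => -[/= ho hw] hmin; exists (G (oo, ww)).
  have G0 : 0 <= G (oo, ww) by rewrite /G !addr_ge0.
  rewrite lt_neqAle G0 andbT eq_sym; apply/eqP; rewrite /G /= => Ge.
  have n1 := normr_ge0 (pair oo (e y0)); have n2 := normr_ge0 (pair oo (f y0)).
  have n3 := normr_ge0 (dl (A0 y0) (A1 y0) oo ww); have n4 := normr_ge0 (dl (B0 y0) (B1 y0) oo ww).
  have z (x : R) : `|x| = 0 -> x = 0 by move/eqP; rewrite normr_eq0 => /eqP.
  have w0 : ww != 0 by apply: contra_eq_neq hw => ->; rewrite normr0 eq_sym oner_eq0.
  by case: (key ho w0); [| |split]; apply: z; lra.
by move=> o w bo w1; apply: (hmin (o, w)); rewrite inE.
Qed.

(* The constants are uniform in [o] since [ballC] is compact. *)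
Lemma newton_lower : exists k r, [/\ 0 < k, 0 < r, r <= r1,
  forall y w o, ball y0 r y -> ballC o -> pair o (e y) = 0 -> pair o (f y) = 0 ->
    k * `|w| <= `|dl (A0 y) (A1 y) o w| + `|dl (B0 y) (B1 y) o w| &
  forall y y' w o, ball y0 r y -> ball y0 r y' ->
    `|dl (A0 y) (A1 y) o w - dl (A0 y') (A1 y') o w| <= k / 16 * `|o| * `|w| /\
    `|dl (B0 y) (B1 y) o w - dl (B0 y') (B1 y') o w| <= k / 16 * `|o| * `|w|].
Proof.
have [k k0 hk] := newton_lower0.
have C := Ce (lexx r1); have C' := Cf (lexx r1).
(* The errors add up to 36 eta in the lower bound, to be kept below k / 2, and to 24 eta in the
   variation, to be kept below k / 32. *)
pose eta := k / 48 / 32.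
have eta0 : 0 < eta by rewrite /eta !divr_gt0 // ltr0n.
have by0 : ball y0 r1 y0 by exact: ballxx.
have near_le (q : P2 -> V) : {for y0, continuous q} -> \forall y \near y0, `|q y0 - q y| <= eta.
  by move=> cq; exact: (@cvgr_dist_le _ _ _ _ _ q (q y0) cq).
have hn : nbhs y0 [set y | ((`|e y0 - e y| <= eta /\ `|f y0 - f y| <= eta) /\
    (`|A0 y0 - A0 y| <= eta /\ `|A1 y0 - A1 y| <= eta)) /\
    (`|B0 y0 - B0 y| <= eta /\ `|B1 y0 - B1 y| <= eta)].
  have q1 := near_le _ (c1_cont C by0); have q2 := near_le _ (c1_cont C' by0).
  have q3 := near_le _ (c1_cont0 C); have q4 := near_le _ (c1_cont1 C).
  have q5 := near_le _ (c1_cont0 C'); have q6 := near_le _ (c1_cont1 C').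
  near=> y; split; [split; split|split]; near: y; assumption.
have [r2 /= r20 hr] := (@nbhs_ballP R P2 y0 _).1 hn.
exists (k / 2), (Num.min r1 r2); split.
- by rewrite divr_gt0.
- by rewrite lt_min r10.
- by rewrite ge_min lexx.
- move=> y w o hy bo he hf.
  have /hr [[[h1 h2] [h3 h4]] [h5 h6]] : ball y0 r2 y.
    by apply: le_ball hy; rewrite ge_min lexx orbT.
  have on : `|o| <= 1 by case: bo => ho <-; exact: psd_norm.
  have [->|w0] := eqVneq w 0; first by rewrite normr0 mulr0 addr_ge0.
  have wn : 0 < `|w| by rewrite normr_gt0.
  pose v := `|w|^-1 *: w.
  have v1 : `|v| = 1 by rewrite /v normrZ normfV normr_id mulVf // gt_eqF.
  have := hk o v bo v1.
  have e1 : `|pair o (e y0)| <= 6 * eta.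
    rewrite -[pair o (e y0)]subr0 -he -pairNr -pairDr; apply: le_trans (pair_norm _ _) _.
    by apply: ler_pM; rewrite ?mulr_ge0 //; lra.
  have e2 : `|pair o (f y0)| <= 6 * eta.
    rewrite -[pair o (f y0)]subr0 -hf -pairNr -pairDr; apply: le_trans (pair_norm _ _) _.
    by apply: ler_pM; rewrite ?mulr_ge0 //; lra.
  have dd (a b a' b' : V) : `|a - a'| <= eta -> `|b - b'| <= eta ->
      `|dl a b o v| <= `|dl a' b' o v| + 12 * eta.
    move=> ha hb; have := ler_normB (dl a b o v - dl a' b' o v) (- dl a' b' o v).
    rewrite opprK subrK normrN dlBa => h; have := dl_norm (a - a') (b - b') o v.
    rewrite v1 mulr1 => h'.
    have : 6 * `|o| * (`|a - a'| + `|b - b'|) <= 6 * (eta + eta).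
      by apply: ler_pM; rewrite ?mulr_ge0 ?addr_ge0 ?lerD //; lra.
    lra.
  have d1 := dd _ _ _ _ h3 h4; have d2 := dd _ _ _ _ h5 h6.
  have sc a b : `|dl a b o w| = `|dl a b o v| * `|w|.
    rewrite -[in RHS](ger0_norm (ltW wn)) -normrM /dl /v !mxE; congr `| _ |.
    by field; rewrite gt_eqF.
  rewrite !sc -mulrDl => hh; rewrite ler_wpM2r //.
  by move: e1 e2 d1 d2 hh; rewrite /eta; lra.
- move=> y y' w o hy hy'.
  have /hr [[_ [h3 h4]] [h5 h6]] : ball y0 r2 y.
    by apply: le_ball hy; rewrite ge_min lexx orbT.
  have /hr [[_ [g3 g4]] [g5 g6]] : ball y0 r2 y'.
    by apply: le_ball hy'; rewrite ge_min lexx orbT.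
  have tri (q : P2 -> V) : `|q y0 - q y| <= eta -> `|q y0 - q y'| <= eta -> `|q y - q y'| <= 2 * eta.
    move=> p1 p2; have -> : q y - q y' = (q y0 - q y') - (q y0 - q y).
      by rewrite opprB [RHS]addrC addrA subrK.
    by apply: le_trans (ler_normB _ _) _; lra.
  have fin (a b a' b' : V) : `|a - a'| <= 2 * eta -> `|b - b'| <= 2 * eta ->
     `|dl a b o w - dl a' b' o w| <= k / 2 / 16 * `|o| * `|w|.
    move=> p1 p2; rewrite dlBa; apply: le_trans (dl_norm _ _ _ _) _; rewrite ler_wpM2r //.
    move: (`|a - a'|) (`|b - b'|) p1 p2 => u v p1 p2.
    have -> : 6 * `|o| * (u + v) = `|o| * (6 * (u + v)) by ring.
    have -> : k / 2 / 16 * `|o| = `|o| * (k / 2 / 16) by ring.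
    by rewrite ler_wpM2l //; move: p1 p2; rewrite /eta; lra.
  by split; apply: fin; apply: tri.
Unshelve. all: by end_near. Qed.

End Newton.

Section Solve.
Variable R : realType.
Local Notation V := 'rV[R]_4.
Local Notation P2 := 'rV[R]_2.
Implicit Types (o : V) (y w : P2).

Variables (y0 : P2) (r k M : R) (e A0 A1 f B0 B1 : P2 -> V).
Hypotheses (k0 : 0 < k) (r0 : 0 < r) (M0 : 0 < M)
  (Ce : C1_ball y0 r e A0 A1) (Cf : C1_ball y0 r f B0 B1)
  (hk : forall y w o, ball y0 r y -> ballC o -> pair o (e y) = 0 -> pair o (f y) = 0 ->
    k * `|w| <= `|dl (A0 y) (A1 y) o w| + `|dl (B0 y) (B1 y) o w|)
  (hv : forall y y' w o, ball y0 r y -> ball y0 r y' ->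
    `|dl (A0 y) (A1 y) o w - dl (A0 y') (A1 y') o w| <= k / 16 * `|o| * `|w| /\
    `|dl (B0 y) (B1 y) o w - dl (B0 y') (B1 y') o w| <= k / 16 * `|o| * `|w|)
  (hM : forall y, ball y0 r y -> [/\ `|e y| <= M, `|f y| <= M, `|A0 y| <= M & `|A1 y| <= M] /\
    (`|B0 y| <= M /\ `|B1 y| <= M)).

(** As [o] has norm at most 2, moving the base point costs k / 8; moving the form costs 6 (k / 192 /
    M) 2M = k / 16. *)
Lemma dl_stable y1 z o1 o w : ball y0 r y1 -> ballC o1 -> ball y0 r z ->
  `|o - o1| <= k / 192 / M -> `|o - o1| <= 1 ->
  `|dl (A0 z) (A1 z) o w - dl (A0 y1) (A1 y1) o1 w| <= 3 * k / 16 * `|w| /\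
  `|dl (B0 z) (B1 z) o w - dl (B0 y1) (B1 y1) o1 w| <= 3 * k / 16 * `|w|.
Proof.
move=> hy1 bo1 hz od od1.
have o2 : `|o| <= 2.
  have -> : o = (o - o1) + o1 by rewrite subrK.
  apply: le_trans (ler_normD _ _) _; have : `|o1| <= 1 by case: bo1 => ho <-; exact: psd_norm.
  lra.
have [[_ _ a0 a1] [b0 b1]] := hM hy1; have [v1 v2] := hv w o hz hy1.
have kw : 0 <= k * `|w| by rewrite mulr_ge0 // ltW.
have fin (a b a' b' : V) : `|a'| <= M -> `|b'| <= M ->
   `|dl a b o w - dl a' b' o w| <= k / 16 * `|o| * `|w| ->
   `|dl a b o w - dl a' b' o1 w| <= 3 * k / 16 * `|w|.
  move=> h1 h2 h3.
  have -> : dl a b o w - dl a' b' o1 w = (dl a b o w - dl a' b' o w) + dl a' b' (o - o1) w.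
    by rewrite -dlBo addrA subrK.
  apply: le_trans (ler_normD _ _) _.
  have h4 : k / 16 * `|o| * `|w| <= k / 8 * `|w|.
    have : 0 <= k * `|w| * (2 - `|o|) by rewrite mulr_ge0 // subr_ge0.
    lra.
  have h5 := dl_norm a' b' (o - o1) w.
  have h6 : 6 * `|o - o1| * (`|a'| + `|b'|) <= 6 * (k / 192 / M) * (2 * M).
    apply: ler_pM; [by rewrite mulr_ge0|by rewrite addr_ge0| |lra].
    by rewrite ler_wpM2l.
  have h7 : 6 * (k / 192 / M) * (2 * M) = k / 16 by field; rewrite gt_eqF.
  rewrite h7 in h6.
  have h8 : 6 * `|o - o1| * (`|a'| + `|b'|) * `|w| <= k / 16 * `|w| by rewrite ler_wpM2r.
  lra.
by split; apply: fin.
Qed.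

(** The two derivatives are taken at unrelated points because the mean value theorem yields one
    point per equation. What is left of the constant is k - 2 (3k / 16), more than k / 2. *)
Lemma dl_invert y1 z o1 o w : ball y0 r y1 -> ballC o1 -> ball y0 r z ->
  pair o1 (e y1) = 0 -> pair o1 (f y1) = 0 ->
  `|o - o1| <= k / 192 / M -> `|o - o1| <= 1 -> forall z',  ball y0 r z' ->
  k / 2 * `|w| <= `|dl (A0 z) (A1 z) o w| + `|dl (B0 z') (B1 z') o w|.
Proof.
move=> hy1 bo1 hz he hf od od1 z' hz'.
have [s1 _] := dl_stable w hy1 bo1 hz od od1; have [_ s2] := dl_stable w hy1 bo1 hz' od od1.
have h := hk w hy1 bo1 he hf.
have tri (x x' : R) : `|x'| <= `|x| + `|x - x'|.
  by rewrite -{1}(subrK x x') addrC distrC; exact: ler_normD.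
have t1 := tri (dl (A0 z) (A1 z) o w) (dl (A0 y1) (A1 y1) o1 w).
have t2 := tri (dl (B0 z') (B1 z') o w) (dl (B0 y1) (B1 y1) o1 w).
have kw : 0 <= k * `|w| by rewrite mulr_ge0 // ltW.
lra.
Qed.

Lemma newton_inj y1 o1 o y y' : ball y0 r y1 -> ballC o1 ->
  pair o1 (e y1) = 0 -> pair o1 (f y1) = 0 ->
  `|o - o1| <= k / 192 / M -> `|o - o1| <= 1 -> ball y0 r y -> ball y0 r y' ->
  k / 2 * `|y - y'| <= `|pair o (e y) - pair o (e y')| + `|pair o (f y) - pair o (f y')|.
Proof.
move=> hy1 bo1 he hf od od1 hy hy'.
have [z hz ->] := c1_mvt Ce o hy hy'; have [z' hz' ->] := c1_mvt Cf o hy hy'.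
exact: (dl_invert _ hy1 bo1 hz he hf od od1 hz').
Qed.

(** At a critical point of half the sum of squares, the transpose of the derivative kills the vector
    of values (x, t); an injective 2 by 2 derivative forces x = t = 0. *)
Lemma crit_zero (a b c d x t : R) :
  (forall w : P2, w != 0 -> (w 0 0 * a + w 0 1 * b != 0) || (w 0 0 * c + w 0 1 * d != 0)) ->
  (forall w : P2, x * (w 0 0 * a + w 0 1 * b) + t * (w 0 0 * c + w 0 1 * d) = 0) ->
  x = 0 /\ t = 0.
Proof.
move=> inj crit.
pose mk (u v : R) : P2 := \row_i (if i == 0 then u else v).
have m0 u v : mk u v 0 0 = u by rewrite mxE. have m1 u v : mk u v 0 1 = v by rewrite mxE.
have mk0 u v : (u != 0) || (v != 0) -> mk u v != 0.
  move=> uv; apply: contraTneq uv => h; have p := m0 u v; have q := m1 u v.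
  by rewrite h !mxE in p q; rewrite -p -q eqxx.
have det0 : a * d - b * c != 0.
  apply/eqP => D.
  have [/andP[/eqP d0 /eqP c0]|] := boolP ((d == 0) && (c == 0)).
    have [/andP[/eqP a0 /eqP b0]|] := boolP ((a == 0) && (b == 0)).
      have := inj (mk 1 0) (mk0 _ _ _); rewrite m0 m1 a0 b0 c0 d0 oner_eq0 => /(_ isT).
      by rewrite !mulr0 addr0 eqxx.
    rewrite negb_and orbC => h.
    have nz : mk b (- a) != 0 by apply: mk0; rewrite oppr_eq0.
    have := inj _ nz; rewrite m0 m1 c0 d0.
    have -> : (b * a + - a * b) = 0 by ring.
    by rewrite !mulr0 addr0 eqxx.
  rewrite negb_and => h; have nz : mk d (- c) != 0 by apply: mk0; rewrite oppr_eq0.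
  have := inj _ nz; rewrite m0 m1.
  have -> : d * a + - c * b = 0 by rewrite -D; ring.
  have -> : d * c + - c * d = 0 by ring.
  by rewrite eqxx.
(* The adjugate of the derivative applied to (x, t), which turns the equation into det (x^2 + t^2) =
   0. *)
have := crit (mk (d * x - b * t) (a * t - c * x)); rewrite m0 m1.
have -> : x * ((d * x - b * t) * a + (a * t - c * x) * b) + t * ((d * x - b * t) * c + (a * t - c * x) * d) =
   (a * d - b * c) * (x ^+ 2 + t ^+ 2) by ring.
move/eqP; rewrite mulf_eq0 (negbTE det0) /= paddr_eq0 ?sqr_ge0 // !sqrf_eq0.
by move=> /andP[/eqP -> /eqP ->].
Qed.

(* The zero is found by minimizing the sum of squares of the two equations. *)
Lemma newton_solve : exists d L, [/\ 0 < d, 0 < L & forall y1 o1 o, ball y0 (r / 2) y1 ->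
  ballC o1 -> pair o1 (e y1) = 0 -> pair o1 (f y1) = 0 -> `|o - o1| <= d ->
  exists y, [/\ ball y0 r y, pair o (e y) = 0, pair o (f y) = 0 & `|y - y1| <= L * `|o - o1|]].
Proof.
pose K := 12 * M; have K0 : 0 < K by rewrite mulr_gt0 // ltr0n.
pose L := 6 * K / k; have L0 : 0 < L by rewrite divr_gt0 // mulr_gt0 // ltr0n.
have q0 : 0 < k / 192 / M by rewrite divr_gt0 // divr_gt0 // ltr0n.
(* The last bound keeps the minimizer within r / 8 of [y1], hence in the interior of the ball of
   radius r / 4 over which one minimizes. *)
pose d := Num.min (Num.min (k / 192 / M) 1) (r / 8 / L).
have d0 : 0 < d by rewrite !lt_min q0 ltr01 divr_gt0 // divr_gt0 // ltr0n.
exists d, L; split => // y1 o1 o hy1' bo1 he hf od.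
have hy1 : ball y0 r y1 by apply: le_ball hy1'; rewrite ler_pdivrMr //; move: r0; lra.
have [od1 od2 od3] : [/\ `|o - o1| <= k / 192 / M, `|o - o1| <= 1 & `|o - o1| <= r / 8 / L].
  by split; apply: le_trans od _; rewrite /d !ge_min lexx ?orbT.
pose s := r / 4.
pose Bs : set P2 := [set y | `|y - y1| <= s].
have Bsr y : Bs y -> ball y0 r y.
  move: hy1'; rewrite -!ball_normE /ball_ /Bs /= => h1 h2.
  have -> : y0 - y = (y0 - y1) - (y - y1) by rewrite opprB addrA subrK.
  by apply: le_lt_trans (ler_normB _ _) _; move: h2 r0; rewrite /s; lra.
pose h (y : P2) := (pair o (e y)) ^+ 2 + (pair o (f y)) ^+ 2.
have cpq (q : P2 -> V) y : {for y, continuous q} -> {for y, continuous (fun y => pair o (q y))}.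
  move=> cq.
  have H := @cvg_pairing R P2 (nbhs y) (nbhs_filter y) (fun=> o) q o (q y) (cvg_cst o) cq.
  exact: H.
have ch : {within Bs, continuous h}.
  apply: continuous_in_subspaceT => y; rewrite inE => /Bsr hy.
  have c1 := cpq _ _ (c1_cont Ce hy); have c2 := cpq _ _ (c1_cont Cf hy).
  exact: (cvgD (cvgM c1 c1) (cvgM c2 c2)).
have cB : compact Bs.
  apply: (@rV_compact_sub _ _ _ (`|y1| + s)).
    have -> : Bs = closed_ball y1 s.
      rewrite closed_ballE /closed_ball_ ?divr_gt0 ?ltr0n //.
      by apply/seteqP; split=> y; rewrite /Bs /= distrC.
    exact: closed_ball_closed.
  move=> y hy; rewrite -(subrK y1 y); apply: le_trans (ler_normD _ _) _.
  by rewrite addrC lerD2l.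
have Bs1 : Bs y1 by rewrite /Bs /= subrr normr0 divr_ge0 // ltW.
have [ys] := EVT_min_rV (ex_intro _ y1 Bs1) cB ch; rewrite inE => hys hmin.
have [[Me Mf _ _] _] := hM hy1.
have small (q : V) : `|q| <= M -> pair o1 q = 0 -> `|pair o q| <= 6 * M * `|o - o1|.
  move=> hq hq0; rewrite -[pair o q]subr0 -hq0 -pairNl -pairDl.
  by apply: le_trans (pair_norm _ _) _; rewrite mulrAC ler_wpM2r // ler_wpM2l.
have se := small _ Me he; have sf := small _ Mf hf.
have hmin1 : h ys <= h y1 by apply: hmin; rewrite inE.
have dist0 : `|ys - y1| <= L * `|o - o1|.
  have I := newton_inj hy1 bo1 he hf od1 od2 (Bsr _ hys) hy1.
  set u := pair o (e ys) in I hmin1 *; set v := pair o (f ys) in I hmin1 *.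
  set u1 := pair o (e y1) in I se *; set v1 := pair o (f y1) in I sf *.
  have uv : `|u| + `|v| <= 2 * (`|u1| + `|v1|).
    apply: ler_of_sqr; first by rewrite mulr_ge0 // addr_ge0.
    have : u ^+ 2 + v ^+ 2 <= u1 ^+ 2 + v1 ^+ 2 := hmin1.
    rewrite -(real_normK (num_real u)) -(real_normK (num_real v)).
    rewrite -(real_normK (num_real u1)) -(real_normK (num_real v1)).
    have := normr_ge0 u1; have := normr_ge0 v1.
    move: `|u| `|v| `|u1| `|v1| => a b a1 b1 b10 a10 hh.
    have := sqr_ge0 (a - b); have := mulr_ge0 a10 b10; nra.
  have tu := ler_normB u u1; have tv := ler_normB v v1.
  have kk : k / 2 * `|ys - y1| <= 3 * K * `|o - o1| by rewrite /K; lra.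
  rewrite /L -mulrAC ler_pdivlMr //; lra.
have Ld : L * `|o - o1| <= r / 8.
  by move: od3; rewrite ler_pdivlMr // mulrC.
have inside : `|ys - y1| < s by apply: le_lt_trans dist0 _; move: Ld r0; rewrite /s; lra.
exists ys; have bys := Bsr _ hys.
suff [E F] : pair o (e ys) = 0 /\ pair o (f ys) = 0 by split.
apply: (@crit_zero (pair o (A0 ys)) (pair o (A1 ys)) (pair o (B0 ys)) (pair o (B1 ys))).
  move=> w w0; have := dl_invert w hy1 bo1 bys he hf od1 od2 bys.
  rewrite /dl => hh; rewrite -negb_and; apply/negP => /andP[/eqP E /eqP F].
  move: hh; rewrite E F normr0 addr0; apply/negP; rewrite -ltNge mulr_gt0 ?divr_gt0 ?normr_gt0 //.
move=> w.
pose tau := (s - `|ys - y1|) / (`|w| + 1).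
have w1 : 0 < `|w| + 1 by rewrite ltr_wpDl.
have tau0 : 0 < tau by rewrite divr_gt0 // subr_gt0.
have inB (t : R) : t \in `](- tau), tau[ -> Bs (ys + t *: w).
  rewrite in_itv /= -ltr_norml => ht; rewrite /Bs /= addrAC.
  apply: le_trans (ler_normD _ _) _; rewrite normrZ.
  have : `|t| * `|w| <= tau * (`|w| + 1) by apply: ler_pM; rewrite ?(ltW ht) ?lerDl.
  by rewrite /tau divfK ?gt_eqF //; lra.
have der (t : R) : t \in `](- tau), tau[ -> is_derive t 1 (fun s : R => h (ys + s *: w))
   (2 * pair o (e (ys + t *: w)) * dl (A0 (ys + t *: w)) (A1 (ys + t *: w)) o w +
    2 * pair o (f (ys + t *: w)) * dl (B0 (ys + t *: w)) (B1 (ys + t *: w)) o w).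
  move=> /inB/Bsr ht.
  have de := c1_line Ce o ht; have df := c1_line Cf o ht.
  have D := is_deriveD (is_deriveM de de) (is_deriveM df df).
  have E : (fun s : R => h (ys + s *: w)) = (fun s : R => pair o (e (ys + s *: w))) * (fun s : R => pair o (e (ys + s *: w)))
      + (fun s : R => pair o (f (ys + s *: w))) * (fun s : R => pair o (f (ys + s *: w))).
    by apply/funext => s'; rewrite /h !expr2.
  rewrite E; apply: (is_derive_eq D); rewrite /GRing.scale /=; ring.
have t0 : (0 : R) \in `](- tau), tau[ by rewrite in_itv /= oppr_lt0 tau0.
have dmin : is_derive (0 : R) 1 (fun s : R => h (ys + s *: w)) 0.
  apply: (@derive1_at_min R _ (- tau) tau) => //; first by rewrite (le_trans _ (ltW tau0)) // oppr_le0 ltW.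
    by move=> t ht; have [] := der t ht.
  by move=> t ht; rewrite scale0r addr0; apply: hmin; rewrite inE; exact: inB.
have := @derive_val _ _ _ _ _ _ _ dmin; rewrite (@derive_val _ _ _ _ _ _ _ (der 0 t0)).
rewrite scale0r addr0 /dl; lra.
Qed.

End Solve.

(** * Local sections of the incidence relation *)

Section LocalSection.
Variable R : realType.
Local Notation V := 'rV[R]_4.
Local Notation P2 := 'rV[R]_2.
Implicit Types (o : V) (y w : P2).

Definition zeros (e f : P2 -> V) o y := pair o (e y) = 0 /\ pair o (f y) = 0.

Lemma newton_section (y0 : P2) (r k M : R) (e A0 A1 f B0 B1 : P2 -> V) :
  0 < k -> 0 < r -> 0 < M -> C1_ball y0 r e A0 A1 -> C1_ball y0 r f B0 B1 ->
  (forall y w o, ball y0 r y -> ballC o -> pair o (e y) = 0 -> pair o (f y) = 0 ->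
    k * `|w| <= `|dl (A0 y) (A1 y) o w| + `|dl (B0 y) (B1 y) o w|) ->
  (forall y y' w o, ball y0 r y -> ball y0 r y' ->
    `|dl (A0 y) (A1 y) o w - dl (A0 y') (A1 y') o w| <= k / 16 * `|o| * `|w| /\
    `|dl (B0 y) (B1 y) o w - dl (B0 y') (B1 y') o w| <= k / 16 * `|o| * `|w|) ->
  (forall y, ball y0 r y -> [/\ `|e y| <= M, `|f y| <= M, `|A0 y| <= M & `|A1 y| <= M] /\
    (`|B0 y| <= M /\ `|B1 y| <= M)) ->
  exists d L, [/\ 0 < d, 0 < L & forall y1 o1, ball y0 (r / 2) y1 -> ballC o1 ->
    zeros e f o1 y1 -> exists l : V -> P2, [/\ l o1 = y1,
      (forall o, `|o - o1| <= d -> ball y0 r (l o) /\ zeros e f o (l o)) &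
      (forall o o', `|o - o1| <= d -> `|o' - o1| <= d -> `|l o - l o'| <= L * `|o - o'|)]].
Proof.
move=> k0 r0 M0 Ce Cf hk hv hM.
have [d1 [L1 [d10 L10 sol]]] := newton_solve k0 r0 M0 Ce Cf hk hv hM.
have q0 : 0 < k / 192 / M by apply: divr_gt0 => //; exact: divr_gt0.
pose d := Num.min (Num.min (k / 192 / M) 1) d1.
have d0 : 0 < d by rewrite !lt_min q0 ltr01.
pose L := 24 * M / k.
have L0 : 0 < L by rewrite divr_gt0 // mulr_gt0.
exists d, L; split => // y1 o1 hy1 bo1 [he hf].
have hy1' : ball y0 r y1 by apply: le_ball hy1; rewrite ler_pdivrMr //; move: r0; lra.
have dd o : `|o - o1| <= d -> [/\ `|o - o1| <= k / 192 / M, `|o - o1| <= 1 & `|o - o1| <= d1].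
  by move=> od; split; apply: le_trans od _; rewrite /d !ge_min lexx ?orbT.
have ex o : exists y, `|o - o1| <= d -> ball y0 r y /\ zeros e f o y.
  have [od|//] := boolP (`|o - o1| <= d); last by exists y1.
  have [_ _ od1] := dd _ od.
  by have [y [h1 h2 h3 _]] := sol _ _ _ hy1 bo1 he hf od1; exists y.
have [l hl] := choice ex.
have o11 : `|o1 - o1| <= d by rewrite subrr normr0 ltW.
exists l; split => //.
- have [b1 [z1 z2]] := hl o1 o11; have [h1 h2 _] := dd _ o11.
  have := newton_inj k0 M0 Ce Cf hk hv hM hy1' bo1 he hf h1 h2 b1 hy1'.
  rewrite z1 z2 he hf subrr normr0 addr0 => h.
  apply/eqP; rewrite -subr_eq0 -normr_le0; rewrite -(pmulr_rle0 _ (_ : 0 < k / 2)) //.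
  by rewrite divr_gt0.
- move=> o o' od od'; have [h1 h2 _] := dd _ od.
  have [b1 [z1 z2]] := hl o od; have [b2 [z3 z4]] := hl o' od'.
  have := newton_inj k0 M0 Ce Cf hk hv hM hy1' bo1 he hf h1 h2 b1 b2.
  rewrite z1 z2 !sub0r !normrN => h.
  have [[Me Mf _ _] _] := hM _ b2.
  have small (q : V) : `|q| <= M -> pair o' q = 0 -> `|pair o q| <= 6 * M * `|o - o'|.
    move=> hq hq0; rewrite -[pair o q]subr0 -hq0 -pairNl -pairDl.
    by apply: le_trans (pair_norm _ _) _; rewrite mulrAC ler_wpM2r // ler_wpM2l.
  have s1 := small _ Me z3; have s2 := small _ Mf z4.
  rewrite /L -mulrAC ler_pdivlMr //; lra.
Qed.

Lemma zeros_inj (y0 : P2) (r k M : R) (e A0 A1 f B0 B1 : P2 -> V) :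
  0 < k -> 0 < r -> 0 < M -> C1_ball y0 r e A0 A1 -> C1_ball y0 r f B0 B1 ->
  (forall y w o, ball y0 r y -> ballC o -> pair o (e y) = 0 -> pair o (f y) = 0 ->
    k * `|w| <= `|dl (A0 y) (A1 y) o w| + `|dl (B0 y) (B1 y) o w|) ->
  (forall y y' w o, ball y0 r y -> ball y0 r y' ->
    `|dl (A0 y) (A1 y) o w - dl (A0 y') (A1 y') o w| <= k / 16 * `|o| * `|w| /\
    `|dl (B0 y) (B1 y) o w - dl (B0 y') (B1 y') o w| <= k / 16 * `|o| * `|w|) ->
  (forall y, ball y0 r y -> [/\ `|e y| <= M, `|f y| <= M, `|A0 y| <= M & `|A1 y| <= M] /\
    (`|B0 y| <= M /\ `|B1 y| <= M)) ->
  forall o y y', ballC o -> ball y0 r y -> ball y0 r y' ->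
    zeros e f o y -> zeros e f o y' -> y = y'.
Proof.
move=> k0 r0 M0 Ce Cf hk hv hM o y y' bo hy hy' [h1 h2] [h3 h4].
have h5 : `|o - o| <= k / 192 / M by rewrite subrr normr0 !divr_ge0 // ltW.
have h6 : `|o - o| <= 1 by rewrite subrr normr0.
have := newton_inj k0 M0 Ce Cf hk hv hM hy bo h1 h2 h5 h6 hy hy'.
rewrite h1 h2 h3 h4 subrr normr0 addr0 => h.
apply/eqP; rewrite -subr_eq0 -normr_le0; rewrite -(pmulr_rle0 _ (_ : 0 < k / 2)) //.
by rewrite divr_gt0.
Qed.

Lemma zeros_scale (e f : P2 -> V) (c : R) o y : c != 0 -> zeros e f (c *: o) y <-> zeros e f o y.
Proof.
move=> c0; rewrite /zeros !pairZl; split=> [[]|[-> ->]]; last by rewrite !mulr0.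
by move=> /eqP + /eqP; rewrite !mulf_eq0 (negbTE c0) /= => /eqP -> /eqP ->.
Qed.

Lemma ballC_scale o : psd o -> o != 0 -> ballC ((tr o)^-1 *: o).
Proof.
move=> ho o0; have t0 := psd_tr_gt0 ho o0.
by split; [apply: psdZ; rewrite // invr_ge0 ltW|rewrite trZ mulVf // gt_eqF].
Qed.

Lemma pairC o q : pair o q = pair q o.
Proof. rewrite /pair; ring. Qed.

Section Frame.
Variables (y0 : P2) (e f : P2 -> V).
Hypotheses (ce : {for y0, continuous e}) (cf : {for y0, continuous f}).

Lemma zeros_closed v : ~ zeros e f v y0 -> \forall p \near (v, y0), ~ zeros e f p.1 p.2.
Proof.
move=> nz.
have c (q : P2 -> V) : {for y0, continuous q} ->
    (fun p : V * P2 => pair p.1 (q p.2)) @ nbhs (v, y0) --> pair v (q y0).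
  move=> cq; apply: (@cvg_pairing R _ _ (nbhs_filter (v, y0)) fst (q \o snd)).
    exact: (@cvg_fst V P2 (nbhs v) (nbhs y0)).
  exact: (cvg_comp _ _ (@cvg_snd V P2 (nbhs v) (nbhs y0) _) cq).
have [/eqP h|/eqP h] : pair v (e y0) <> 0 \/ pair v (f y0) <> 0 by apply/not_andP.
- have E := cvgr_neq0 _ (c _ ce) h; near=> p; case=> /eqP + _; apply/negP; near: p; exact: E.
- have E := cvgr_neq0 _ (c _ cf) h; near=> p; case=> _ /eqP; apply/negP; near: p; exact: E.
Unshelve. all: by end_near. Qed.

(* Project [o1] orthogonally to the moving plane. *)
Lemma zeros_lsc o1 (G : set V) : \dim (<[e y0]> + <[f y0]>)%VS = 2 -> zeros e f o1 y0 ->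
  nbhs o1 G -> \forall y \near y0, exists2 o, G o & zeros e f o y.
Proof.
move=> dm [z1 z2] nG; have [a0 ind] := span2_indep dm; have g0 := pair_gram a0 ind.
pose g y := pair (e y) (e y) * pair (f y) (f y) - pair (e y) (f y) * pair (f y) (e y).
pose a y := pair o1 (e y) * pair (f y) (f y) - pair o1 (f y) * pair (f y) (e y).
pose b y := pair o1 (f y) * pair (e y) (e y) - pair o1 (e y) * pair (e y) (f y).
pose F y := o1 - (a y / g y) *: e y - (b y / g y) *: f y.
have cp1 (p q : P2 -> V) : {for y0, continuous p} -> {for y0, continuous q} ->
   (fun y => pair (p y) (q y)) @ nbhs y0 --> pair (p y0) (q y0).
  by move=> c1 c2; exact: cvg_pairing.
have co : (fun=> o1) @ nbhs y0 --> o1 by exact: cvg_cst.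
have cg : g @ nbhs y0 --> g y0.
  exact: (cvgB (cvgM (cp1 _ _ ce ce) (cp1 _ _ cf cf)) (cvgM (cp1 _ _ ce cf) (cp1 _ _ cf ce))).
have ca : a @ nbhs y0 --> a y0.
  by apply: cvgB; (apply: cvgM; [exact: cvg_pairing|exact: cvg_pairing]).
have cb : b @ nbhs y0 --> b y0.
  by apply: cvgB; (apply: cvgM; [exact: cvg_pairing|exact: cvg_pairing]).
have cF : F @ nbhs y0 --> F y0.
  by apply: cvgB; [apply: cvgB; [exact: cvg_cst|]|];
    (apply: cvgZ; [apply: cvgM => //; exact: cvgV|]).
have F0 : F y0 = o1 by rewrite /F /a /b z1 z2 !mul0r subrr !mul0r !scale0r !subr0.
rewrite F0 in cF; have gn := cvgr_neq0 _ cg g0.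
near=> y; exists (F y); first by near: y; exact: cF.
have gy : g y != 0 by near: y; exact: gn.
rewrite /zeros /F !(pairDl, pairNl, pairZl).
move: gy; rewrite /a /b /g; set oe := pair o1 (e y); set of_ := pair o1 (f y).
rewrite (pairC (f y) (e y)).
by move: (pair (e y) (e y)) (pair (f y) (f y)) (pair (e y) (f y)) => A B C gy; split; field.
Unshelve. all: by end_near. Qed.

End Frame.

Lemma frame_local (O N : set P2) (U : P2 -> {vspace V}) (y0 : P2) (r1 : R) (e A0 A1 f B0 B1 : P2 -> V) :
  0 < r1 -> ball y0 r1 `<=` N -> N `<=` O ->
  (forall y, N y -> \dim (U y) = 2 /\ U y = (<[e y]> + <[f y]>)%VS) ->
  (forall r, r <= r1 -> C1_ball y0 r e A0 A1) ->
  (forall r, r <= r1 -> C1_ball y0 r f B0 B1) ->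
  (forall o w, ballC o -> w != 0 -> pair o (e y0) = 0 -> pair o (f y0) = 0 ->
    ~ (dl (A0 y0) (A1 y0) o w = 0 /\ dl (B0 y0) (B1 y0) o w = 0)) ->
  exists r d L : R, [/\ 0 < r, 0 < d, ball y0 r `<=` O &
  [/\ forall o y y', psd o -> o != 0 -> ball y0 r y -> ball y0 r y' ->
        orthv o (U y) -> orthv o (U y') -> y = y',
    forall y1 o1, ball y0 (r / 2) y1 -> ballC o1 -> orthv o1 (U y1) ->
      exists l : V -> P2, [/\ l o1 = y1,
      (forall o, `|o - o1| <= d -> ball y0 r (l o) /\ orthv o (U (l o))) &
      (forall o o', `|o - o1| <= d -> `|o' - o1| <= d -> `|l o - l o'| <= L * `|o - o'|)],
    forall o1 (G : set V), orthv o1 (U y0) -> nbhs o1 G ->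
      \forall y \near y0, exists2 o, G o & orthv o (U y) &
    forall v, ~ orthv v (U y0) -> \forall p \near (v, y0), ~ orthv p.1 (U p.2)]].
Proof.
move=> r10 hr1 NO hU Ce Cf key.
have by0 : ball y0 r1 y0 by exact: ballxx.
have Ny0 := hr1 _ by0.
have iff y o : N y -> orthv o (U y) <-> zeros e f o y.
  by move=> /hU [_ h]; exact: orthv_span.
have nN : nbhs y0 N by apply/nbhs_ballP; exists r1.
have ce := c1_cont (Ce _ (lexx r1)) by0; have cf := c1_cont (Cf _ (lexx r1)) by0.
have [k [r2 [k0 r20 r21 hk hv]]] := newton_lower r10 Ce Cf key.
pose M := `|e y0| + `|f y0| + `|A0 y0| + `|A1 y0| + `|B0 y0| + `|B1 y0| + 1.
have M0 : 0 < M by rewrite ltr_wpDl // !addr_ge0.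
have near_le (q : P2 -> V) : `|q y0| + 1 <= M -> {for y0, continuous q} ->
    \forall y \near y0, `|q y| <= M.
  move=> qM cq; near=> y; apply: le_trans qM.
  have : `|q y0 - q y| <= 1 by near: y; exact: (@cvgr_dist_le _ _ _ _ _ q (q y0) cq).
  by rewrite distrC => h; rewrite -{1}(subrK (q y0) (q y)) (le_trans (ler_normD _ _)) // addrC lerD2l.
have hn : nbhs y0 [set y | [/\ `|e y| <= M, `|f y| <= M, `|A0 y| <= M & `|A1 y| <= M] /\
    (`|B0 y| <= M /\ `|B1 y| <= M)].
  have bnd : [/\ `|e y0| + 1 <= M, `|f y0| + 1 <= M & [/\ `|A0 y0| + 1 <= M, `|A1 y0| + 1 <= M,
     `|B0 y0| + 1 <= M & `|B1 y0| + 1 <= M]].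
    rewrite /M; have := normr_ge0 (e y0); have := normr_ge0 (f y0); have := normr_ge0 (A0 y0).
    have := normr_ge0 (A1 y0); have := normr_ge0 (B0 y0); have := normr_ge0 (B1 y0).
    by move=> *; split; [lra|lra|split; lra].
  have [b1 b2 [b3 b4 b5 b6]] := bnd.
  have q1 := near_le _ b1 ce; have q2 := near_le _ b2 cf.
  have q3 := near_le _ b3 (c1_cont0 (Ce _ (lexx r1))); have q4 := near_le _ b4 (c1_cont1 (Ce _ (lexx r1))).
  have q5 := near_le _ b5 (c1_cont0 (Cf _ (lexx r1))); have q6 := near_le _ b6 (c1_cont1 (Cf _ (lexx r1))).
  by near=> y; split; split; near: y; assumption.
have [r3 /= r30 hr3] := (@nbhs_ballP R P2 y0 _).1 hn.
pose r := Num.min r2 r3.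
have r0 : 0 < r by rewrite lt_min r20.
have rr2 : r <= r2 by rewrite ge_min lexx.
have rr1 : r <= r1 := le_trans rr2 r21.
have rN : ball y0 r `<=` N by move=> y hy; apply: hr1; exact: le_ball hy.
have hM y : ball y0 r y -> [/\ `|e y| <= M, `|f y| <= M, `|A0 y| <= M & `|A1 y| <= M] /\
    (`|B0 y| <= M /\ `|B1 y| <= M).
  by move=> hy; apply: hr3; apply: le_ball hy; rewrite ge_min lexx orbT.
have hk' y w o : ball y0 r y -> ballC o -> pair o (e y) = 0 -> pair o (f y) = 0 ->
    k * `|w| <= `|dl (A0 y) (A1 y) o w| + `|dl (B0 y) (B1 y) o w|.
  by move=> hy; apply: hk; exact: le_ball hy.
have hv' y y' w o : ball y0 r y -> ball y0 r y' ->
    `|dl (A0 y) (A1 y) o w - dl (A0 y') (A1 y') o w| <= k / 16 * `|o| * `|w| /\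
    `|dl (B0 y) (B1 y) o w - dl (B0 y') (B1 y') o w| <= k / 16 * `|o| * `|w|.
  by move=> hy hy'; apply: hv; [exact: le_ball hy|exact: le_ball hy'].
have [d [L [d0 L0 sec]]] := newton_section k0 r0 M0 (Ce _ rr1) (Cf _ rr1) hk' hv' hM.
exists r, d, L; split => //; first by move=> y /rN /NO.
split.
- move=> o y y' ho o0 hy hy' /(iff _ _ (rN _ hy)) z1 /(iff _ _ (rN _ hy')) z2.
  have t0 : (tr o)^-1 != 0 by rewrite invr_eq0 gt_eqF // psd_tr_gt0.
  apply: (@zeros_inj _ _ _ _ _ _ _ _ _ _ k0 r0 M0 (Ce _ rr1) (Cf _ rr1) hk' hv' hM _ _ _
     (ballC_scale ho o0) hy hy'); exact/zeros_scale.
- move=> y1 o1 hy1 bo1 z1.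
  have hy1' : ball y0 r y1 by apply: le_ball hy1; rewrite ler_pdivrMr //; move: r0; lra.
  have [l [l1 l2 l3]] := sec y1 o1 hy1 bo1 ((iff _ _ (rN _ hy1')).1 z1).
  exists l; split => // o /l2 [b z]; split => //.
  exact: (iff _ _ (rN _ b)).2 z.
- move=> o1 G /(iff _ _ Ny0) z nG.
  have [dm eU] := hU _ Ny0; rewrite eU in dm.
  have Z := zeros_lsc ce cf dm z nG.
  near=> y.
  have [ o Go zo] : exists2 o, G o & zeros e f o y by near: y; exact: Z.
  by exists o => //; apply/iff => //; near: y; exact: nN.
- move=> v nz; have Z := zeros_closed ce cf (fun h => nz ((iff _ _ Ny0).2 h)).
  have nN' : \forall p \near (v, y0), N p.2.
    exact: (@cvg_snd V P2 (nbhs v) (nbhs y0) _ _ nN).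
  near=> p => /iff h.
  have : ~ zeros e f p.1 p.2 by near: p; exact: Z.
  by apply; apply: h; near: p; exact: nN'.
Unshelve. all: by end_near. Qed.

(** Each clause has a global use: the first two make incident pairs a covering of the cone, the
    third makes the image of a section open and closed in the surface, and the fourth, where [v]
    need not be positive definite, controls the endpoints. *)
Lemma fit_local (O : set P2) (U : P2 -> {vspace V}) (y0 : P2) :
  fitting_immersion_on O U -> open O -> O y0 ->
  exists r d L : R, [/\ 0 < r, 0 < d, ball y0 r `<=` O &
  [/\ forall o y y', psd o -> o != 0 -> ball y0 r y -> ball y0 r y' ->
        orthv o (U y) -> orthv o (U y') -> y = y',
    forall y1 o1, ball y0 (r / 2) y1 -> ballC o1 -> orthv o1 (U y1) ->
      exists l : V -> P2, [/\ l o1 = y1,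
      (forall o, `|o - o1| <= d -> ball y0 r (l o) /\ orthv o (U (l o))) &
      (forall o o', `|o - o1| <= d -> `|o' - o1| <= d -> `|l o - l o'| <= L * `|o - o'|)],
    forall o1 (G : set V), orthv o1 (U y0) -> nbhs o1 G ->
      \forall y \near y0, exists2 o, G o & orthv o (U y) &
    forall v, ~ orthv v (U y0) -> \forall p \near (v, y0), ~ orthv p.1 (U p.2)]].
Proof.
move=> hfit oO Oy0.
have [N [e [f [oN Ny0 NO [se sf hU key]]]]] := fit_frame hfit oO Oy0.
have [r1 /= r10 hr1] := (@nbhs_ballP R P2 y0 N).1 (open_nbhs_nbhs (conj oN Ny0)).
have Ce r : r <= r1 -> C1_ball y0 r e (fun y => 'D_(@e0 R) e y) (fun y => 'D_(@e1 R) e y).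
  move=> rr; have sub : ball y0 r `<=` N by move=> y hy; apply: hr1; exact: le_ball hy.
  have H := @smooth_C1 R N e y0 r Ny0 se sub; exact H.
have Cf r : r <= r1 -> C1_ball y0 r f (fun y => 'D_(@e0 R) f y) (fun y => 'D_(@e1 R) f y).
  move=> rr; have sub : ball y0 r `<=` N by move=> y hy; apply: hr1; exact: le_ball hy.
  have H := @smooth_C1 R N f y0 r Ny0 sf sub; exact H.
have [de _] := se 1%N; have [df _] := sf 1%N.
have [_ eU] := hU _ Ny0.
have H := @frame_local O N U y0 r1 e _ _ f _ _ r10 hr1 NO hU Ce Cf.
apply: H => o w [ho ht] w0 ze zf [D1 D2].
have o0 : o != 0.
  apply/eqP => o0; move: ht; rewrite o0 /tr /cp /cr !mxE addr0 => /eqP.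
  by rewrite eq_sym oner_eq0.
have Pe := @pair_derive R e o y0 w (de _ Ny0); have Pf := @pair_derive R f o y0 w (df _ Ny0).
apply: (key o w ho o0 w0); first by apply/(orthv_span o eU).
by rewrite Pe Pf.
Qed.

End LocalSection.

(** * The global section *)

Section Interval.
Variable R : realType.

Lemma loc_const_01 (Q : R -> Prop) :
  (forall t : R, 0 <= t <= 1 -> \forall s \near t, 0 <= s <= 1 -> (Q s <-> Q t)) -> Q 0 -> Q 1.
Proof.
move=> h Q0; pose A : set R := [set t | 0 <= t <= 1].
have cA : connected A.
  have -> : A = `[0, 1]%classic by apply/seteqP; split => t; rewrite /A /= in_itv.
  exact: segment_connected.
have A0 : A 0 by rewrite /A /= lexx ler01.
have A1 : A 1 by rewrite /A /= lexx ler01.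
suff E : A `&` Q = A.
  have : (A `&` Q) 1 by rewrite E.
  by case.
pose I (S : set R) : set R := [set t : R | \forall s \near t, A s -> S s].
have oI (S : set R) : open (I S).
  rewrite openE => t; rewrite /I /interior /= => /nbhs_interior; apply: filterS => s.
  by rewrite /interior.
apply: cA; first by exists 0.
  exists (I Q) => //; apply/seteqP; split => t [At Qt]; split => //.
    by near=> s => As; apply/(near (h t At) s) => //; near: s; exact: h.
  exact: (nbhs_singleton Qt).
exists (~` I (~` Q)); first exact: open_closedC.
apply/seteqP; split => t [At Qt]; split => //.
  by move=> /nbhs_singleton /(_ At).
apply: contrapT => nQ; apply: Qt.
near=> s => As Qs; apply: nQ; have : A s -> (Q s <-> Q t) by near: s; exact: h.
by move=> /(_ As) [/(_ Qs)].
Unshelve. all: by end_near. Qed.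

End Interval.

(** * Segments and order intervals in the cone *)

Section Cone.
Variable R : realType.
Local Notation V := 'rV[R]_4.
Implicit Types (o : V).

Definition seg (a b : V) (t : R) : V := (1 - t) *: a + t *: b.

Lemma seg0 a b : seg a b 0 = a. Proof. by rewrite /seg subr0 scale1r scale0r addr0. Qed.
Lemma seg1 a b : seg a b 1 = b. Proof. by rewrite /seg subrr scale1r scale0r add0r. Qed.

Lemma seg_pd a b t : pd a -> pd b -> 0 <= t <= 1 -> pd (seg a b t).
Proof.
move=> ha hb /andP[t0 t1].
have [->|tn] := eqVneq t 0; first by rewrite seg0.
by apply: pdDr; [apply: psdZ; [rewrite subr_ge0|exact: pd_psd]|apply: pdZ => //; rewrite lt_def tn].
Qed.

Lemma seg_contt a b : continuous (seg a b).
Proof.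
move=> t; apply: cvgD; (apply: cvgZr_tmp); last exact: cvg_id.
by apply: cvgB; [exact: cvg_cst|exact: cvg_id].
Qed.

Lemma seg_contr a t : continuous (fun b => seg a b t).
Proof.
move=> b.
have H : (fun x => t *: x) @ nbhs b --> t *: b by apply: cvgZ; [exact: cvg_cst|exact: cvg_id].
have H0 : (fun x : V => (1 - t) *: a) @ nbhs b --> (1 - t) *: a by exact: cvg_cst.
exact: (cvgD H0 H).
Qed.

Lemma subr_cont (a : V) : continuous (fun o => o - a).
Proof.
move=> o; have H0 : (fun x : V => a) @ nbhs o --> a by exact: cvg_cst.
have H1 : (fun x : V => x) @ nbhs o --> o by exact: cvg_id.
exact: (cvgB H1 H0).
Qed.

Lemma subl_cont (a : V) : continuous (fun o => a - o).
Proof.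
move=> o; have H0 : (fun x : V => a) @ nbhs o --> a by exact: cvg_cst.
have H1 : (fun x : V => x) @ nbhs o --> o by exact: cvg_id.
exact: (cvgB H0 H1).
Qed.

(* An order interval around [o1]: unlike a ball, it is carried to an order interval by
   every linear automorphism of the cone. *)
Definition box (e : R) (o1 : V) : set V :=
  [set o | pd (o - (1 - e) *: o1) /\ pd ((1 + e) *: o1 - o)].

Lemma box_self e o : 0 < e -> pd o -> box e o o.
Proof.
move=> e0 ho; split.
  have -> : o - (1 - e) *: o = e *: o by apply: vec_ext; rewrite !coordE; ring.
  exact: pdZ.
have -> : (1 + e) *: o - o = e *: o by apply: vec_ext; rewrite !coordE; ring.
exact: pdZ.
Qed.

Lemma box_open e o1 : open (box e o1).
Proof.
apply: openI.
  apply: (@open_comp _ _ (fun o => o - (1 - e) *: o1) (@pd R)); last exact: pd_open.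
  by move=> o _; exact: subr_cont.
apply: (@open_comp _ _ (fun o => (1 + e) *: o1 - o) (@pd R)); last exact: pd_open.
by move=> o _; exact: subl_cont.
Qed.

Lemma seg_box e o1 a b t : box e o1 a -> box e o1 b -> 0 <= t <= 1 -> box e o1 (seg a b t).
Proof.
move=> [a1 a2] [b1 b2] h; split.
  have -> : seg a b t - (1 - e) *: o1 = seg (a - (1 - e) *: o1) (b - (1 - e) *: o1) t.
    by apply: vec_ext; rewrite /seg !coordE; ring.
  exact: seg_pd.
have -> : (1 + e) *: o1 - seg a b t = seg ((1 + e) *: o1 - a) ((1 + e) *: o1 - b) t.
  by apply: vec_ext; rewrite /seg !coordE; ring.
exact: seg_pd.
Qed.

Lemma box_pd e o1 o : e <= 1 -> pd o1 -> box e o1 o -> pd o.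
Proof.
move=> e1 h [h1 _]; have -> : o = (o - (1 - e) *: o1) + (1 - e) *: o1 by rewrite subrK.
by apply: pdDl => //; apply: psdZ; [lra|exact: pd_psd].
Qed.

(** Convex order intervals that exhaust the cone as [M] grows. *)
Definition cone_box (M : R) (o0 : V) : set V :=
  [set o | pd (o - M^-1 *: o0) /\ pd (M *: o0 - o)].

Lemma cone_box_open M o0 : open (cone_box M o0).
Proof.
apply: openI.
  apply: (@open_comp _ _ (fun o => o - M^-1 *: o0) (@pd R)); last exact: pd_open.
  by move=> o _; exact: subr_cont.
apply: (@open_comp _ _ (fun o => M *: o0 - o) (@pd R)); last exact: pd_open.
by move=> o _; exact: subl_cont.
Qed.

Lemma cone_box_pd M o0 o : 0 < M -> pd o0 -> cone_box M o0 o -> pd o.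
Proof.
move=> M0 h [h1 _]; have -> : o = (o - M^-1 *: o0) + M^-1 *: o0 by rewrite subrK.
by apply: pdDl => //; apply: psdZ; [rewrite invr_ge0 ltW|exact: pd_psd].
Qed.

Lemma cone_box_self M o0 : 1 < M -> pd o0 -> cone_box M o0 o0.
Proof.
move=> M1 h; have M0 : 0 < M by lra.
split.
  have -> : o0 - M^-1 *: o0 = (1 - M^-1) *: o0 by apply: vec_ext; rewrite !coordE; ring.
  by apply: pdZ => //; rewrite subr_gt0 invf_lt1.
have -> : M *: o0 - o0 = (M - 1) *: o0 by apply: vec_ext; rewrite !coordE; ring.
by apply: pdZ => //; rewrite subr_gt0.
Qed.

Lemma seg_cone_box M o0 a b t : cone_box M o0 a -> cone_box M o0 b -> 0 <= t <= 1 ->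
  cone_box M o0 (seg a b t).
Proof.
move=> [a1 a2] [b1 b2] h; split.
  have -> : seg a b t - M^-1 *: o0 = seg (a - M^-1 *: o0) (b - M^-1 *: o0) t.
    by apply: vec_ext; rewrite /seg !coordE; ring.
  exact: seg_pd.
have -> : M *: o0 - seg a b t = seg (M *: o0 - a) (M *: o0 - b) t.
  by apply: vec_ext; rewrite /seg !coordE; ring.
exact: seg_pd.
Qed.

Lemma psd_le_tr a : psd a -> psd (tr a *: idv R - a).
Proof.
case=> p r d; split; rewrite ?cpD ?crD ?cpN ?crN ?cpZ ?crZ /idv ?vecE /tr; [lra|lra|].
move: d; rewrite /bil !(cpD, crD, csD, ctD, cpN, crN, csN, ctN, cpZ, crZ, csZ, ctZ) !vecE; lra.
Qed.

Lemma cone_box_cover o0 o : pd o0 -> pd o -> exists2 M, 1 < M & cone_box M o0 o.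
Proof.
have dom (a b : V) : pd a -> pd b -> exists2 M : R, 0 < M & forall M' : R, M <= M' -> pd (M' *: b - a).
  move=> ha hb; have [c c0 h] := pd_lower_pd hb.
  exists (tr a / c); first by rewrite divr_gt0 ?pd_tr.
  move=> M' hM'; have M0 : 0 < M' by apply: lt_le_trans hM'; rewrite divr_gt0 ?pd_tr.
  have -> : M' *: b - a = M' *: (b - c *: idv R) + ((M' * c - tr a) *: (idv R : V) + (tr a *: idv R - a)).
    by apply: vec_ext; rewrite !coordE; ring.
  apply: pdDl; first exact: pdZ.
  apply: psdD; last exact/psd_le_tr/pd_psd.
  by apply: psdZ; [rewrite subr_ge0 -ler_pdivrMr|exact/pd_psd/pd_idv].
move=> h0 h; have [M1 M10 h1] := dom _ _ h h0; have [M2 M20 h2] := dom _ _ h0 h.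
pose M := M1 + M2 + 2; exists M; first by rewrite /M; lra.
have M0 : 0 < M by rewrite /M; lra.
split; last by apply: h1; rewrite /M; lra.
have -> : o - M^-1 *: o0 = M^-1 *: (M *: o - o0) by rewrite scalerBr scalerA mulVf ?scale1r // gt_eqF.
by apply: pdZ; [rewrite invr_gt0|apply: h2; rewrite /M; lra].
Qed.

(** On the order interval the segment stays above o0 / M, and both ends stay below M o0; so a change
    of parameter by n moves the form by at most the fraction n M^2 of itself. *)
Lemma cone_step M e t t' o0 o : 1 < M -> 0 < e -> pd o0 -> cone_box M o0 o ->
  0 <= t -> t <= t' -> t' <= 1 -> t' - t <= e / M ^+ 2 -> box e (seg o0 o t) (seg o0 o t').
Proof.
move=> M1 e0 h0 ho t0 tt' t1 hs; have M0 : 0 < M by lra.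
have po := cone_box_pd M0 h0 ho; case: ho => h1 h2.
have Mi : 0 < M^-1 by rewrite invr_gt0.
have Mi1 : M^-1 < 1 by rewrite invf_lt1.
set n := t' - t in hs; have n0 : 0 <= n by rewrite /n; lra.
have nM : n * M <= e * M^-1.
  by move: hs; rewrite expr2 invfM mulrA -ler_pdivlMr // invrK -mulrA [_^-1 * M]mulrC mulrA.
have nM' : n <= e * M^-1 by apply: le_trans nM; rewrite -{1}(mulr1 n) ler_wpM2l // ltW.
have -> : t' = t + n by rewrite /n; ring.
have pc c x : 0 <= c -> pd x -> psd (c *: x) by move=> c0 hx; apply: psdZ => //; exact: pd_psd.
have e1 : 0 <= e * (1 - t) by apply: mulr_ge0; lra.
have core : pd ((e * (1 - t) * (1 - M^-1)) *: o0 + (e * t) *: (o - M^-1 *: o0)).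
  have [t00|tn] := eqVneq t 0.
    apply: pdDl; last by apply: pc => //; rewrite mulr_ge0 // ltW.
    by apply: pdZ => //; rewrite t00 subr0 mulr1 mulr_gt0 // subr_gt0.
  apply: pdDr; first by apply: pc => //; rewrite mulr_ge0 // subr_ge0 ltW.
  by apply: pdZ => //; rewrite mulr_gt0 // lt_def tn.
split.
  have -> : seg o0 o (t + n) - (1 - e) *: seg o0 o t =
     ((e * (1 - t) * (1 - M^-1)) *: o0 + (e * t) *: (o - M^-1 *: o0)) + (n *: o + (e * M^-1 - n) *: o0).
    by apply: vec_ext; rewrite /seg !coordE; ring.
  by apply: pdDl => //; apply: psdD; apply: pc => //; rewrite subr_ge0.
have -> : (1 + e) *: seg o0 o t - seg o0 o (t + n) =
   ((e * (1 - t) * (1 - M^-1)) *: o0 + (e * t) *: (o - M^-1 *: o0)) +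
   (n *: (M *: o0 - o) + (e * M^-1 - n * M + n) *: o0).
  by apply: vec_ext; rewrite /seg !coordE; ring.
by apply: pdDl => //; apply: psdD; apply: pc => //; lra.
Qed.

End Cone.

Lemma hausdorff_sep (T : topologicalType) (x y : T) : hausdorff_space T -> x <> y ->
  exists A B, [/\ nbhs x A, nbhs y B & forall z, A z -> B z -> False].
Proof.
rewrite open_hausdorff => h /eqP xy.
have [[A B] /= [+ +] [oA oB /eqP AB]] := h _ _ xy; rewrite !inE => xA yB.
exists A, B; split; [exact: open_nbhs_nbhs|exact: open_nbhs_nbhs|].
by move=> z Az Bz; have : (A `&` B) z by []; rewrite AB.
Qed.

(** * Continuation of local sections over the cone *)

Section GlobalSection.
Variable R : realType.
Local Notation V := 'rV[R]_4.
Variables (X : topologicalType) (orth : V -> X -> Prop) (e : R).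
Implicit Types (o : V) (x : X).
Hypotheses (e0 : 0 < e) (e1 : e <= 1) (hX : hausdorff_space X).
Hypothesis lift : forall o1 x1, pd o1 -> orth o1 x1 -> exists l : V -> X,
  l o1 = x1 /\ forall o, box e o1 o -> orth o (l o) /\ {for o, continuous l}.
Hypothesis loc_inj : forall x, exists2 W, nbhs x W & forall o x' x'', pd o ->
  W x' -> W x'' -> orth o x' -> orth o x'' -> x' = x''.

(** Uniqueness of lifts: the set of times of agreement is open by local injectivity and closed
    because [X] is Hausdorff. *)
Lemma path_unique (c : R -> V) (F G : R -> X) :
  (forall t, 0 <= t <= 1 -> [/\ pd (c t), orth (c t) (F t) & orth (c t) (G t)]) ->
  (forall t, 0 <= t <= 1 -> {for t, continuous F} /\ {for t, continuous G}) ->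
  F 0 = G 0 -> F 1 = G 1.
Proof.
move=> h hc; apply: (@loc_const_01 R (fun t => F t = G t)) => t ht.
have [cF cG] := hc t ht.
have [E|N] := pselect (F t = G t).
  have [W nW inj] := loc_inj (F t).
  have nF : \forall s \near t, W (F s) by apply: cF.
  have nG : \forall s \near t, W (G s) by apply: cG; rewrite -E.
  near=> s => hs; split=> // _; have [p1 p2 p3] := h s hs.
  by apply: (inj (c s)) => //; near: s.
have [A [B [nA nB AB]]] := hausdorff_sep hX N.
have nF : \forall s \near t, A (F s) by apply: cF.
have nG : \forall s \near t, B (G s) by apply: cG.
near=> s => hs; split=> // E; exfalso.
have Fs : A (F s) by near: s.
have Gs : B (G s) by near: s.
by apply: (AB (F s)) => //; rewrite E.
Unshelve. all: by end_near. Qed.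

Variables (o0 : V) (x0 : X).
Hypotheses (po0 : pd o0) (z0 : orth o0 x0).

Definition section_at M (t : R) (G : V -> X) := G o0 = x0 /\
  forall o, cone_box M o0 o -> orth (seg o0 o t) (G o) /\ {for o, continuous G}.

(* Radial continuation from [o0]: [G] is a section over the shrunken copy
   [seg o0 o t] of the box. *)
Lemma section_step M t t' G : 1 < M -> 0 <= t -> t <= t' -> t' <= 1 -> t' - t <= e / M ^+ 2 ->
  section_at M t G -> exists G', section_at M t' G'.
Proof.
move=> M1 t0 tt' t1 hs [G0 hG].
have M0 : 0 < M by lra.
have ht : 0 <= t <= 1 by rewrite t0 (le_trans tt').
have ht' : 0 <= t' <= 1 by rewrite t1 (le_trans t0).
have ex (p : V * X) : exists l : V -> X, pd p.1 -> orth p.1 p.2 ->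
    l p.1 = p.2 /\ forall o, box e p.1 o -> orth o (l o) /\ {for o, continuous l}.
  have [[p1 p2]|n] := pselect (pd p.1 /\ orth p.1 p.2).
    by have [l hl] := lift p1 p2; exists l.
  by exists (fun=> p.2) => p1 p2; case: n.
have [l hl] := choice ex.
pose G' o := l (seg o0 o t, G o) (seg o0 o t').
have L o : cone_box M o0 o -> [/\ pd (seg o0 o t), l (seg o0 o t, G o) (seg o0 o t) = G o,
   box e (seg o0 o t) (seg o0 o t') & forall o', box e (seg o0 o t) o' ->
   orth o' (l (seg o0 o t, G o) o') /\ {for o', continuous (l (seg o0 o t, G o))}].
  move=> ho; have po := cone_box_pd M0 po0 ho; have ps := seg_pd po0 po ht.
  have [h1 h2] := hl (seg o0 o t, G o) ps (hG o ho).1.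
  by split => //; exact: cone_step ho t0 tt' t1 hs.
have sself s : seg o0 o0 s = o0 by apply: vec_ext; rewrite /seg !coordE; ring.
exists G'; split.
  have [_ h _ _] := L _ (cone_box_self M1 po0).
  by rewrite /G' -[RHS]G0 -[RHS]h !sself.
move=> o ho; have [ps lE bx lo] := L o ho; split; first by have [] := lo _ bx.
set l1 := l (seg o0 o t, G o) in lE lo.
have [W nW inj] := loc_inj (G o).
have cl1 : (fun o' => l1 (seg o0 o' t')) @ nbhs o --> l1 (seg o0 o t').
  exact: (cvg_comp _ _ (@seg_contr R o0 t' o) (lo _ bx).2).
have cl0 : (fun o' => l1 (seg o0 o' t)) @ nbhs o --> G o.
  rewrite -lE; exact: (cvg_comp _ _ (@seg_contr R o0 t o) (lo _ (box_self e0 ps)).2).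
have n1 : \forall o' \near o, cone_box M o0 o'.
  by apply: open_nbhs_nbhs; split => //; exact: cone_box_open.
have nb s : box e (seg o0 o t) (seg o0 o s) -> \forall o' \near o, box e (seg o0 o t) (seg o0 o' s).
  move=> h; apply: (@seg_contr R o0 s o); apply: open_nbhs_nbhs.
  by split => //; exact: box_open.
have n2 := nb _ (box_self e0 ps); have n3 := nb _ bx.
have n4 : \forall o' \near o, W (G o') by exact: (hG o ho).2.
have n5 : \forall o' \near o, W (l1 (seg o0 o' t)) by exact: cl0.
(* The values of [G'] near [o] come from other local sections than [l1]. They agree with it at time
   [t], and the segment from time [t] to time [t'] stays in both boxes, so they agree at time
   [t']. *)
have E : \forall o' \near o, l1 (seg o0 o' t') = G' o'.
  near=> o'.
  have ho' : cone_box M o0 o' by near: o'.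
  have b2 : box e (seg o0 o t) (seg o0 o' t) by near: o'; exact: n2.
  have b3 : box e (seg o0 o t) (seg o0 o' t') by near: o'; exact: n3.
  have [ps' lE' bx' lo'] := L o' ho'.
  pose c := seg (seg o0 o' t) (seg o0 o' t').
  have cb s : 0 <= s <= 1 -> box e (seg o0 o t) (c s) by move=> hs'; exact: seg_box.
  have cb' s : 0 <= s <= 1 -> box e (seg o0 o' t) (c s).
    by move=> hs'; apply: seg_box => //; exact: box_self.
  have := @path_unique c (fun s => l1 (c s)) (fun s => l (seg o0 o' t, G o') (c s)).
  rewrite /c seg0 seg1; apply.
  - move=> s hs'; split; [exact: (box_pd e1 ps' (cb' s hs'))|exact: (lo _ (cb s hs')).1|].
    exact: (lo' _ (cb' s hs')).1.
  - move=> s hs'; split.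
      exact: (cvg_comp _ _ (@seg_contt R _ _ s) (lo _ (cb s hs')).2).
    exact: (cvg_comp _ _ (@seg_contt R _ _ s) (lo' _ (cb' s hs')).2).
  - rewrite lE'; apply: (inj (seg o0 o' t)) => //; first by near: o'; exact: n5.
    + by near: o'; exact: n4.
    + exact: (lo _ b2).1.
    + exact: (hG o' ho').1.
have G'o : G' o = l1 (seg o0 o t') by [].
have H : G' @ nbhs o --> G' o.
  rewrite G'o; apply: cvg_trans cl1; apply: near_eq_cvg; exact: E.
exact: H.
Unshelve. all: by end_near. Qed.

Lemma section_box M : 1 < M -> exists G, section_at M 1 G.
Proof.
move=> M1; have M0 : 0 < M by lra.
pose h := e / M ^+ 2; have h0 : 0 < h by rewrite divr_gt0 // exprn_gt0.
pose n := (Num.truncn h^-1).+1.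
have n0 : 0 < n%:R :> R by rewrite ltr0n.
have nh : n%:R^-1 <= h.
  rewrite -[h]invrK lef_pV2 ?posrE ?invr_gt0 //; exact/ltW/truncnS_gt.
have S k : (k <= n)%N -> exists G, section_at M (k%:R / n%:R) G.
  elim: k => [|k IH] kn.
    exists (fun=> x0); split => // o ho; rewrite mul0r seg0; split => //.
    by have H : (fun=> x0) @ nbhs o --> x0 by exact: cvg_cst.
  have [G hG] := IH (ltnW kn).
  have kn' : k.+1%:R / n%:R - k%:R / n%:R = n%:R^-1 :> R.
    by rewrite -mulrBl -natr1 [_ + 1]addrC addrK mul1r.
  apply: (section_step M1 _ _ _ _ hG).
  - by rewrite divr_ge0.
  - by rewrite -subr_ge0 kn' invr_ge0 ltW.
  - by rewrite ler_pdivrMr // mul1r ler_nat.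
  - by rewrite kn'.
by have := S n (leqnn n); rewrite mulfV ?gt_eqF.
Qed.

Lemma global_section : exists L : V -> X,
  forall o, pd o -> orth o (L o) /\ {for o, continuous L}.
Proof.
pose P o x := exists M G, [/\ 1 < M, section_at M 1 G, cone_box M o0 o & G o = x].
(* Sections over two order intervals are compared along the segment from [o0], which both
   contain. *)
have Puniq o x x' : P o x -> P o x' -> x = x'.
  move=> [M [G [M1 [G0 hG] ho <-]]] [M' [G' [M1' [G0' hG'] ho' <-]]].
  have b t : 0 <= t <= 1 -> cone_box M o0 (seg o0 o t) /\ cone_box M' o0 (seg o0 o t).
    by move=> ht; split; apply: seg_cone_box => //; exact: cone_box_self.
  have := @path_unique (seg o0 o) (fun t => G (seg o0 o t)) (fun t => G' (seg o0 o t)).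
  rewrite seg0 seg1 G0 G0'; apply => // t ht; have [b1 b2] := b t ht.
    have [h1 _] := hG _ b1; have [h2 _] := hG' _ b2; rewrite !seg1 in h1 h2.
    by split => //; apply: cone_box_pd b1 => //; lra.
  split.
    exact: (cvg_comp _ _ (@seg_contt R _ _ t) (hG _ b1).2).
  exact: (cvg_comp _ _ (@seg_contt R _ _ t) (hG' _ b2).2).
have Pex o : exists x, pd o -> P o x.
  have [po|n] := pselect (pd o); last by exists x0.
  have [M M1 ho] := cone_box_cover po0 po; have [G hG] := section_box M1.
  by exists (G o) => _; exists M, G.
have [L hL] := choice Pex.
exists L => o po; have [M [G [M1 hG ho E]]] := hL o po.
have [hG0 hG1] := hG; have [g1 g2] := hG1 o ho; rewrite seg1 E in g1; split => //.
have n1 : \forall o' \near o, cone_box M o0 o'.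
  by apply: open_nbhs_nbhs; split => //; exact: cone_box_open.
have H : L @ nbhs o --> L o.
  rewrite -E; have cG : G @ nbhs o --> G o by exact: g2.
  apply: cvg_trans cG; apply: near_eq_cvg; near=> o'.
  have ho' : cone_box M o0 o' by near: o'.
  apply: (Puniq o'); first by exists M, G.
  by apply: hL; apply: cone_box_pd ho' => //; lra.
exact: H.
Unshelve. all: by end_near. Qed.

Hypothesis cX : connected [set: X].
Hypothesis orth_ex : forall x, exists2 o, pd o & orth o x.
Hypothesis orth_seg : forall x a b t, orth a x -> orth b x -> orth (seg a b t) x.
Hypothesis orth_lsc : forall x o1 (G : set V), orth o1 x -> nbhs o1 G ->
  \forall x' \near x, exists2 o, G o & orth o x'.

(** The forms incident to a given [x] are convex, so [x] is the value of [L] at all of them or at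
    none. The points of the first kind are open and closed by lower semicontinuity, and [X] is
    connected. *)
Lemma global_section_unique : exists L : V -> X, forall o, pd o ->
  {for o, continuous L} /\ forall x, orth o x <-> x = L o.
Proof.
have [L hL] := global_section; exists L => o po; split; first by have [] := hL o po.
have fib x a b : pd a -> pd b -> orth a x -> orth b x -> x = L a -> x = L b.
  move=> pa pb xa xb E; have := @path_unique (seg a b) (fun=> x) (fun t => L (seg a b t)).
  rewrite seg0 seg1; apply => // t ht; have ps := seg_pd pa pb ht; have [h1 h2] := hL _ ps.
    by split => //; exact: orth_seg.
  split; first by have H : (fun=> x) @ nbhs t --> x by exact: cvg_cst.
  exact: (cvg_comp _ _ (@seg_contt R _ _ t) h2).
pose A : set X := [set x | exists o, [/\ pd o, orth o x & x = L o]].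
suff E : A = [set: X].
  move=> x; split=> [xo|->]; last by have [] := hL o po.
  have : A x by rewrite E.
  by move=> [a [pa xa xE]]; exact: (fib _ a).
have pdn (a : V) : pd a -> \forall b \near a, pd b.
  by move=> pa; apply: open_nbhs_nbhs; split => //; exact: pd_open.
apply: cX; first by exists (L o0), o0; split => //; exact: (hL o0 po0).1.
  exists A; last by rewrite setTI.
  rewrite openE => x [a [pa xa xE]]; have [W nW inj] := loc_inj x.
  have [_ ca] := hL a pa.
  have nG : \forall b \near a, pd b /\ W (L b).
    by near=> b; split; near: b; [exact: pdn|apply: ca; rewrite -xE].
  have ls := orth_lsc xa nG; rewrite /interior; near=> x'.
  have [b [pb Wb] bx'] : exists2 b, pd b /\ W (L b) & orth b x' by near: x'; exact: ls.
  exists b; split => //; apply: (inj b) => //; first by near: x'.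
  by have [] := hL b pb.
exists A; last by rewrite setTI.
rewrite -[A]setCK; apply: open_closedC; rewrite openE => x nA.
have [a pa xa] := orth_ex x; have [_ ca] := hL a pa.
have N : x <> L a by move=> E; apply: nA; exists a.
have [B [B' [nB nB' BB']]] := hausdorff_sep hX N.
have nG : \forall b \near a, pd b /\ B' (L b).
  by near=> b; split; near: b; [exact: pdn|exact: ca].
have ls := orth_lsc xa nG.
rewrite /interior; near=> x'.
have [b [pb Wb] bx'] : exists2 b, pd b /\ B' (L b) & orth b x' by near: x'; exact: ls.
have Bx' : B x' by near: x'; exact: nB.
move=> [d [pd' dx' dE]]; have E := fib _ _ _ pd' pb dx' bx' dE.
by apply: (BB' x') => //; rewrite E.
Unshelve. all: by end_near. Qed.

End GlobalSection.

(** * Covering maps and lifted charts *)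

Section CoveringSpace.
Variables (R : realType) (S X : topologicalType) (p : X -> S).
Hypotheses (pcov : covering_map p).

(** The last clause provides disjoint neighbourhoods for two points of one fibre. *)
Lemma cover_sheet x : exists (V : set S) (W : set X), [/\ open V, V (p x), W x, open W & [/\ W `<=` p @^-1` V,
  {in W &, injective p}, (forall O, open O -> O `<=` W -> open (p @` O)) &
  (forall x', V (p x') -> W x' \/ exists2 W' : set X, open W' & W' x' /\ (forall z, W z -> W' z -> False))]].
Proof.
have [cp _ ev] := pcov; have [V [oV Vx [F [FV tF hF]]]] := ev (p x).
have : (p @^-1` V) x by []; rewrite -FV => -[W FW Wx].
have [oW inj im op] := hF W FW.
exists V, W; split => //; split => //; first by rewrite -FV => z Wz; exists W.
move=> x' Vx'; have : (p @^-1` V) x' by []; rewrite -FV => -[W' FW' Wx'].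
have [oW' _ _ _] := hF W' FW'.
have [E|N] := pselect (W = W'); first by left; rewrite E.
right; exists W' => //; split => // z Wz W'z; apply: N.
by apply: (tF _ _ FW FW'); exists z.
Qed.

Lemma cover_open (O : set X) : open O -> open (p @` O).
Proof.
move=> oO; rewrite openE => s [x Ox <-].
have [V [W [oV Vx Wx oW [_ _ op _]]]] := cover_sheet x.
rewrite /interior; have o1 : open (p @` (O `&` W)).
  by apply: op; [exact: openI|move=> z []].
apply: filterS (open_nbhs_nbhs (conj o1 _)); first by move=> _ [z [Oz _] <-]; exists z.
by exists x.
Qed.

Lemma cover_hausdorff : hausdorff_space S -> hausdorff_space X.
Proof.
have [cp _ ev] := pcov.
move=> hS; rewrite open_hausdorff => x x' /eqP xx'.
have [E|N] := pselect (p x = p x').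
  have [V [W [oV Vx Wx oW [_ inj _ dj]]]] := cover_sheet x.
  have [|Wx'|[W' oW' [Wx' dW]]] := dj x'; first by rewrite -E.
    by case: xx'; apply: inj => //; rewrite inE.
  exists (W, W') => /=; first by rewrite !inE.
  split => //.
  apply/eqP; rewrite -subset0 => z [Wz W'z]; exact: (dW z Wz W'z).
have [A [B [nA nB AB]]] := hausdorff_sep hS N.
move: nA nB; rewrite !nbhsE => -[A' [oA' A'x] sA] [B' [oB' B'x] sB].
exists (p @^-1` A', p @^-1` B') => /=; first by rewrite !inE.
split.
- exact: (open_comp (fun x _ => cp x) oA').
- exact: (open_comp (fun x _ => cp x) oB').
- by apply/eqP; rewrite -subset0 => z [/sA Az /sB Bz]; exact: (AB (p z)).
Qed.

End CoveringSpace.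

Lemma path_connected_connected (R : realType) (X : topologicalType) :
  simply_connected R X -> connected [set: X].
Proof.
move=> [_ hp _] B [b Bb] [ O oO BO] [D cD BD]; rewrite setTI in BO; rewrite setTI in BD.
apply/seteqP; split => // x _.
have [c [cc c0 c1]] := hp b x.
have cI : connected (c @` `[0, 1]).
  by apply: connected_continuous_connected cc; exact: segment_connected.
have in0 : (c @` `[0, 1]) b by exists 0 => //; rewrite /= in_itv /= lexx ler01.
have in1 : (c @` `[0, 1]) x by exists 1 => //; rewrite /= in_itv /= lexx ler01.
suff E : (c @` `[0, 1]) `&` B = c @` `[0, 1] by have := in1; rewrite -E => -[].
apply: cI; first by exists b.
- by exists O => //; rewrite BO.
- by exists D => //; rewrite {1}BD.
Qed.

Section LiftedChart.
Variables (R : realType) (S X : topologicalType) (p : X -> S) (A : set (chart R S)).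
Hypotheses (pcov : covering_map p) (hA : oriented_smooth_atlas A).

Lemma lift_chart x : exists2 c, lift_atlas p A c & chart_dom c x.
Proof.
have [cp _ _] := pcov; have [hch hex _] := hA.
have [d Ad dx] := hex (p x); have [oD _ _ _] := hch d Ad.
have [V [W [oV Vx Wx oW [_ inj _ _]]]] := cover_sheet pcov x.
exists (Chart (W `&` p @^-1` (chart_dom d)) (chart_map d \o p)) => //.
split => /=.
- apply: openI => //; exact: (open_comp (fun x _ => cp x) oD).
- by move=> y z; rewrite !inE => -[Wy _] [Wz _]; apply: inj; rewrite inE.
- by exists d => //; split => // _ [z [_ dz] <-].
Qed.

Lemma lift_is_chart c : lift_atlas p A c -> is_chart c.
Proof.
have [cp _ _] := pcov; have [hch _ _] := hA.
move=> [oc inj [d Ad [sub E]]]; have [oD injd cd opd] := hch d Ad.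
split => //.
- move=> x y; rewrite !inE => xc yc; rewrite E /= => /injd; rewrite !inE => h.
  by apply: inj; rewrite ?inE //; apply: h; apply: sub; [exists x|exists y].
- move=> x xc; rewrite E; apply: (cvg_comp _ _ (cp x)).
  by apply: cd; apply: sub; exists x.
- move=> O oO Oc; rewrite E -image_comp.
  by apply: opd; [exact: cover_open|move=> _ [x Ox <-]; apply: sub; exists x => //; exact: Oc].
Qed.

End LiftedChart.

Lemma chart_inverse (R : realType) (X : topologicalType) (c : chart R X) x0 : is_chart c ->
  chart_dom c x0 -> open (chart_image c) /\ exists psi : 'rV[R]_2 -> X,
  (forall x, chart_dom c x -> psi (chart_map c x) = x) /\
  forall y, chart_image c y -> [/\ chart_dom c (psi y), chart_map c (psi y) = y & {for y, continuous psi}].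
Proof.
move=> [oc inj _ op] hx0; split; first exact: op.
have ex y : exists x, chart_image c y -> chart_dom c x /\ chart_map c x = y.
  have [[x hx <-]|n] := pselect (chart_image c y); first by exists x.
  by exists x0 => h; case: n.
have [psi hpsi] := choice ex.
have inv x : chart_dom c x -> psi (chart_map c x) = x.
  move=> hx; have [|h1 h2] := hpsi (chart_map c x); first by exists x.
  by apply: inj; rewrite ?inE.
exists psi; split => // y hy; have [h1 h2] := hpsi y hy; split => //.
move=> B nB; have : nbhs (psi y) (B `&` chart_dom c).
  by apply: filterI => //; exact: open_nbhs_nbhs.
rewrite nbhsE => -[B' [oB' B'y] sub].
have o2 : open (chart_map c @` B') by apply: op => // z /sub [].
apply: filterS (open_nbhs_nbhs (conj o2 _)); last by exists (psi y).
by move=> _ [z B'z <-]; have [Bz cz] := sub z B'z; rewrite /= inv.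
Qed.

(** * Incidence on the universal cover *)

Section FittedSurface.
Variable R : realType.
Local Notation V := 'rV[R]_4.
Implicit Types (o v : V).

Lemma box_near e o1 o : 0 < e -> e <= 1 -> ballC o1 -> box e o1 o -> `|o - o1| <= 3 * e.
Proof.
move=> e0 e1 [p1 t1] [h1 h2].
have -> : o - o1 = (o - (1 - e) *: o1) - e *: o1 by apply: vec_ext; rewrite !coordE; ring.
apply: le_trans (ler_normB _ _) _.
have n1 := psd_norm (pd_psd h1); have n2 := psd_norm p1.
have t2 := psd_tr (pd_psd h2).
have trN (a b : V) : tr (a - b) = tr a - tr b by rewrite /tr !coordE; ring.
rewrite trN trZ t1 in n1; rewrite trN trZ t1 in t2.
rewrite normrZ ger0_norm ?(ltW e0) //.
have : e * `|o1| <= e * 1 by rewrite ler_wpM2l ?(ltW e0) // -t1.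
lra.
Qed.

Lemma box_scale (e k : R) o1 o : 0 < k -> box e o1 o -> box e (k *: o1) (k *: o).
Proof.
move=> k0 [h1 h2]; split.
  have -> : k *: o - (1 - e) *: (k *: o1) = k *: (o - (1 - e) *: o1).
    by apply: vec_ext; rewrite !coordE; ring.
  exact: pdZ.
have -> : (1 + e) *: (k *: o1) - k *: o = k *: ((1 + e) *: o1 - o).
  by apply: vec_ext; rewrite !coordE; ring.
exact: pdZ.
Qed.

Lemma box_mono (e e' : R) o1 o : e <= e' -> pd o1 -> box e o1 o -> box e' o1 o.
Proof.
move=> ee h [h1 h2]; split.
  have -> : o - (1 - e') *: o1 = (o - (1 - e) *: o1) + (e' - e) *: o1.
    by apply: vec_ext; rewrite !coordE; ring.
  by apply: pdDl => //; apply: psdZ; [rewrite subr_ge0|exact: pd_psd].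
have -> : (1 + e') *: o1 - o = ((1 + e) *: o1 - o) + (e' - e) *: o1.
  by apply: vec_ext; rewrite !coordE; ring.
by apply: pdDl => //; apply: psdZ; [rewrite subr_ge0|exact: pd_psd].
Qed.

Variables (S X : topologicalType) (p : X -> S) (A : set (chart R S)) (u : X -> geodesic R).
Hypotheses (pcov : covering_map p) (hA : oriented_smooth_atlas A)
  (hfit : fitting_immersion (lift_atlas p A) u).

Definition orthX o x := orthv o (plane (u x)).

Lemma orthXZ k o x : k != 0 -> orthX (k *: o) x <-> orthX o x.
Proof.
move=> k0; split=> h q /h; rewrite pairZl => /eqP; last by move=> /eqP ->; rewrite mulr0.
by rewrite mulf_eq0 (negbTE k0) => /eqP.
Qed.

(** The size [e] is relative to [o1], which makes the property invariant under the group. *)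
Definition liftable (e : R) x1 := forall o1, pd o1 -> orthX o1 x1 -> exists l : V -> X,
  l o1 = x1 /\ forall o, box e o1 o -> orthX o (l o) /\ {for o, continuous l}.

Lemma liftable_mono e e' x : e <= e' -> liftable e' x -> liftable e x.
Proof.
move=> ee h o1 po1 xo1; have [l [l1 l2]] := h o1 po1 xo1.
by exists l; split => // o ho; apply: l2; exact: box_mono ho.
Qed.

Lemma fit_at x : exists e : R, [/\ 0 < e, e <= 1 &
  [/\ exists2 W, nbhs x W & forall o x' x'', pd o -> W x' -> W x'' ->
        orthX o x' -> orthX o x'' -> x' = x'',
    \forall x1 \near x, liftable e x1,
    forall o1 (G : set V), orthX o1 x -> nbhs o1 G ->
      \forall x' \near x, exists2 o, G o & orthX o x' &
    forall v, ~ orthX v x -> \forall q \near (v, x), ~ orthX q.1 q.2]].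
Proof.
have [c Ac xc] := lift_chart pcov hA x.
have hc := lift_is_chart pcov hA Ac.
have [U [hU fU]] := hfit Ac.
have [oO [psi [psi1 psi2]]] := chart_inverse hc xc.
have [oc inj cc _] := hc.
set y0 := chart_map c x.
have Oy0 : chart_image c y0 by exists x.
have [r [d [L [r0 d0 rO [uniq sec lsc clo]]]]] := fit_local fU oO Oy0.
have E x' o : chart_dom c x' -> orthX o x' = orthv o (U (chart_map c x')).
  by move=> hx'; rewrite /orthX -hU.
have nc : \forall x' \near x, chart_dom c x' by exact: open_nbhs_nbhs.
have nball (s : R) : 0 < s -> \forall x' \near x, ball y0 s (chart_map c x').
  by move=> s0; apply: (cc x xc); exact: nbhsx_ballx.
(* By [box_near], a box of size e has radius at most 3e around a trace-one form, hence at most d /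
   2. *)
exists (Num.min 1 (d / 6)); split; first by rewrite lt_min ltr01 divr_gt0.
  by rewrite ge_min lexx.
set e := Num.min 1 (d / 6).
have e0 : 0 < e by rewrite lt_min ltr01 divr_gt0.
have e1 : e <= 1 by rewrite ge_min lexx.
have ed : 3 * e <= d / 2.
  have : e <= d / 6 by rewrite ge_min lexx orbT.
  lra.
split.
- exists (chart_dom c `&` (fun x' => ball y0 r (chart_map c x'))).
    by apply: filterI => //; exact: nball.
  move=> o x' x'' po [c1 b1] [c2 b2]; rewrite !E // => z1 z2.
  by apply: inj; rewrite ?inE //; exact: (uniq o) (pd_psd po) (pd_neq0 po) b1 b2 z1 z2.
- have nb := nball (r / 2) (divr_gt0 r0 (ltr0Sn R 1)); near=> x1 => o1 po1.
  have c1 : chart_dom c x1 by near: x1.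
  have b1 : ball y0 (r / 2) (chart_map c x1) by near: x1; exact: nb.
  have t0 : 0 < (tr o1)^-1 by rewrite invr_gt0 pd_tr.
  set k := (tr o1)^-1 in t0.
  have bo1 : ballC (k *: o1) by apply: ballC_scale; [exact: pd_psd|exact: pd_neq0].
  move=> /(orthXZ o1 x1 (lt0r_neq0 t0)).2; rewrite E // => z1.
  have [l [l1 l2 l3]] := sec _ _ b1 bo1 z1.
  exists (fun o => psi (l (k *: o))); split; first by rewrite l1 psi1.
  move=> o /(box_scale t0) bx; have n1 := box_near e0 e1 bo1 bx.
  have nd : `|k *: o - k *: o1| < d by lra.
  have [bl zl] := l2 _ (ltW nd); have [h1 h2 h3] := psi2 _ (rO _ bl).
  split; first by apply/(orthXZ _ _ (lt0r_neq0 t0)); rewrite E // h2.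
  apply: (@cvg_comp _ _ _ (fun o => l (k *: o)) psi _ (nbhs (l (k *: o)))); last exact: h3.
  have cs : (fun o' : V => k *: o') @ nbhs o --> k *: o.
    by apply: cvgZ; [exact: cvg_cst|exact: cvg_id].
  apply: (@cvg_comp _ _ _ (fun o' : V => k *: o') l _ (nbhs (k *: o))); first exact: cs.
  apply/cvgrPdist_le => /= eps eps0.
  have L1 : 0 < `|L| + 1 by rewrite ltr_wpDl.
  have near1 : \forall o' \near k *: o, `|o' - k *: o1| < d.
    have co : (fun o' : V => `|o' - k *: o1|) @ nbhs (k *: o) --> `|k *: o - k *: o1|.
      by apply: cvg_norm; exact: subr_cont.
    by apply: (cvgr_lt _ co).
  near=> o'.
  have n' : `|o' - k *: o1| <= d by apply/ltW; near: o'; exact: near1.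
  apply: le_trans (l3 _ _ (ltW nd) n') _.
  have : `|k *: o - o'| <= eps / (`|L| + 1).
    by near: o'; apply: (@cvgr_dist_le _ _ _ _ (nbhs_filter (k *: o)) id (k *: o) cvg_id); rewrite divr_gt0.
  rewrite ler_pdivlMr // => h'; apply: le_trans h'; rewrite mulrC ler_wpM2l //.
  by rewrite (le_trans (ler_norm _)) // lerDl.
- move=> o1 G; rewrite E // => z nG; have ls := lsc _ _ z nG.
  have ls' : \forall x' \near x, exists2 o, G o & orthv o (U (chart_map c x')) by exact: (cc x xc _ ls).
  near=> x'; have c1 : chart_dom c x' by near: x'.
  have [ o Go zo] : exists2 o, G o & orthv o (U (chart_map c x')) by near: x'; exact: ls'.
  by exists o => //; rewrite E.
- move=> v; rewrite E // => z; have cl := clo _ z.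
  have c2 : (fun q : V * X => (q.1, chart_map c q.2)) @ nbhs (v, x) --> (v, y0).
    have g1 : (fun q : V * X => q.1) @ nbhs (v, x) --> v by exact: (@cvg_fst V X (nbhs v) (nbhs x)).
    have g2 : (fun q : V * X => chart_map c q.2) @ nbhs (v, x) --> y0.
      exact: (cvg_comp _ _ (@cvg_snd V X (nbhs v) (nbhs x) _) (cc x xc)).
    exact: (cvg_pair g1 g2).
  have cl' : \forall q \near (v, x), ~ orthv q.1 (U (chart_map c q.2)) by exact: (c2 _ cl).
  have nc' : \forall q \near (v, x), chart_dom c q.2.
    exact: (@cvg_snd V X (nbhs v) (nbhs x) _ _ nc).
  near=> q; rewrite E; first by near: q; exact: cl'.
  by near: q; exact: nc'.
Unshelve. all: by end_near. Qed.

Lemma orthX_seg x a b t : orthX a x -> orthX b x -> orthX (seg a b t) x.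
Proof. by move=> ha hb q qP; rewrite /seg pairDl !pairZl ha ?hb // !mulr0 addr0. Qed.

End FittedSurface.

Section MixedPlane.
Variable R : realType.
Local Notation V := 'rV[R]_4.

Lemma plane_basis (P : {vspace V}) : \dim P = 2 -> exists e f, P = (<[e]> + <[f]>)%VS.
Proof.
move=> dP; have := span_basis (vbasisP P); have := size_tuple (vbasis P); rewrite {2}dP.
case: (tval (vbasis P)) => [|e [|f [|]]] //= _ <-.
by exists e, f; rewrite !span_cons span_nil addv0.
Qed.

(* Remove from the identity its Lorentz projection to the negative plane dual to [P]. *)
Lemma mixed_pd_orth (P : {vspace V}) : mixed P -> exists2 o, pd o & orthv o P.
Proof.
move=> mP; have [dP _] := mP; have [e [f eP]] := plane_basis dP.
have [e0 ind] : e != 0 /\ forall k, f != k *: e by apply: span2_indep; rewrite -eP.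
have neg q : q \in P -> q != 0 -> bil (dual q) (dual q) < 0.
  by move=> qP q0; rewrite bil_dual; exact: mixed_neg mP qP q0.
have eE : e \in P by rewrite eP; apply: (subvP (addvSl _ _)); exact: memv_line.
have fE : f \in P by rewrite eP; apply: (subvP (addvSr _ _)); exact: memv_line.
have comb a b : a *: e + b *: f \in P by rewrite memvD ?memvZ.
have dc a b : dual (a *: e + b *: f) = a *: dual e + b *: dual f.
  by apply: vec_ext; rewrite /dual !coordE //; ring.
have ne := neg e eE e0.
have f0 : f != 0 by have := ind 0; rewrite scale0r.
have nf := neg f fE f0.
set E := bil (dual e) (dual e) in ne; set F := bil (dual f) (dual f) in nf.
set H := bil (dual e) (dual f).
have quad a b : bil (dual (a *: e + b *: f)) (dual (a *: e + b *: f)) =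
    a ^+ 2 * E + 2 * a * b * H + b ^+ 2 * F.
  rewrite dc !(bilDl, bilDr, bilZl, bilZr) (bilC (dual f) (dual e)) -/E -/F -/H; ring.
have D0 : 0 < E * F - H ^+ 2.
  have nz : (- H) *: e + E *: f != 0.
    apply: contraNneq (ind (H / E)) => h; apply/eqP.
    have : E *: f = H *: e by apply/eqP; rewrite -subr_eq0 -scaleNr addrC h.
    by move=> /(congr1 (fun v => E^-1 *: v)); rewrite !scalerA mulVf ?scale1r ?lt_eqF // mulrC.
  have := neg _ (comb _ _) nz; rewrite quad => h; rewrite -(nmulr_rlt0 _ ne); lra.
set D := E * F - H ^+ 2 in D0.
have Dn : D != 0 by rewrite gt_eqF.
pose al := (tr (dual e) * F - tr (dual f) * H) / D.
pose be := (tr (dual f) * E - tr (dual e) * H) / D.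
pose w := al *: e + be *: f.
pose o := idv R - dual w.
have we : bil (dual w) (dual e) = tr (dual e).
  by rewrite dc !(bilDl, bilZl) (bilC (dual f)) -/E -/H /al /be; move: Dn; rewrite /D => Dn; field.
have wf : bil (dual w) (dual f) = tr (dual f).
  by rewrite dc !(bilDl, bilZl) -/F -/H /al /be; move: Dn; rewrite /D => Dn; field.
have oe : bil o (dual e) = 0 by rewrite /o bilDl bilNl we bilC bil_idv subrr.
have of_ : bil o (dual f) = 0 by rewrite /o bilDl bilNl wf bilC bil_idv subrr.
have ow : bil o (dual w) = 0 by rewrite dc bilDr !bilZr oe of_ !mulr0 addr0.
have ww : bil (dual w) (dual w) <= 0.
  have [->|w0] := eqVneq w 0; first by rewrite bil_dual /bil /cp /cr /cs /ct !mxE; lra.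
  exact: ltW (neg w (comb _ _) w0).
have tw : tr (dual w) = bil (dual w) (dual w).
  by have := ow; rewrite /o bilDl bilNl bilC bil_idv => /eqP; rewrite subr_eq0 => /eqP.
have oo : bil o o = 2 - bil (dual w) (dual w).
  rewrite {2}/o bilDr bilNr ow bil_idv subr0 /o /tr !cpD !crD !cpN !crN -tw /tr /idv !vecE; ring.
have to : tr o = 2 - bil (dual w) (dual w).
  by rewrite /o /tr !cpD !crD !cpN !crN -tw /tr /idv !vecE; ring.
exists o; last by apply/(orthv_span o eP); rewrite !pair_dual.
have o1 : 0 < bil o o by rewrite oo; lra.
have t1 : 0 < tr o by rewrite to; lra.
have pr : 0 < cp o * cr o.
  by move: o1; rewrite /bil; have := sqr_ge0 (cs o); have := sqr_ge0 (ct o); lra.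
have p0 : 0 < cp o.
  rewrite ltNge; apply/negP => pn; move: t1 pr; rewrite /tr => t1.
  have r0 : 0 <= cr o by lra.
  by rewrite ltNge mulr_le0_ge0.
by split => //; rewrite -(pmulr_rgt0 _ p0).
Qed.

End MixedPlane.

Section ActContinuous.
Variables (R : realType) (T : finType) (C : necklace R T).
Local Notation V := 'rV[R]_4.

Lemma cvg_bil_r (a o : V) : bil o' a @[o' --> o] --> bil o a.
Proof.
by apply: (@cvg_bil R V (nbhs o) _ id (fun=> a) o a); [exact: cvg_id|exact: cvg_cst].
Qed.

Lemma refl_cont (c : circle R) : continuous (refl c).
Proof.
move=> o; have h1 : (fun o' : V => o') @ nbhs o --> o by exact: cvg_id.
have h2 : (fun o' : V => power c o' / csq c) @ nbhs o --> power c o / csq c.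
  by apply: cvgM; [exact: cvg_bil_r|exact: cvg_cst].
have h3 : (fun o' : V => (power c o' / csq c) *: normal c) @ nbhs o --> (power c o / csq c) *: normal c.
  by apply: cvgZr_tmp.
exact: (cvgD h1 h3).
Qed.

Lemma act_cont w : continuous (act C w).
Proof.
elim: w => [|i w IH] o; first exact: cvg_id.
exact: (cvg_comp _ _ (IH o) (@refl_cont (C i) (act C w o))).
Qed.

End ActContinuous.

(** * The section given by an equivariant fitting immersion *)

Section FittingSection.
Variables (R : realType) (g : nat) (C : necklace R (bead_letter g)).
Hypothesis hC : nextto C =2 @bead_next g.
Local Notation V := 'rV[R]_4.
Local Notation G := (surface_group g).
Variables (S X : topologicalType) (A : set (chart R S)) (p : X -> S) (actX : G -> X -> X)
  (u : X -> geodesic R).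
Hypotheses (hS : closed_oriented_surface A) (hp : universal_cover R p)
  (hd : deck_action p actX) (hu : equivariant actX (bead_rep hC) u)
  (hfit : fitting_immersion (lift_atlas p A) u).
Local Notation ox := (orthX u).

Let pcov : covering_map p := hp.1.
Let hA : oriented_smooth_atlas A. Proof. by case: hS. Qed.

Lemma actXK a x : actX a^-1%g (actX a x) = x.
Proof. by case: hd => -[h1 hM] _ _ _; rewrite -hM mulVg h1. Qed.

Lemma actX_fix a x : actX a x = x -> a = 1%g.
Proof. by case: hd => _ _ _ h; exact: h. Qed.

Lemma orthX_gact a o x : ox o x -> ox (gact C a o) (actX a x).
Proof.
move=> h q qP.
have dt : \det (rho_mx C a^-1%g) = 1 by exact: rho_det.
rewrite -(pair_act _ _ dt) -/(gact C a^-1%g (gact C a o)) (gactK hC); apply: h.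
by have := hu a^-1%g (actX a x) q; rewrite actXK => ->.
Qed.

Lemma pd_gact a o : pd o -> pd (gact C a o).
Proof. by rewrite gact_word; exact: pd_act. Qed.

Lemma gact_box e a o1 o : box e o1 o -> box e (gact C a o1) (gact C a o).
Proof.
have B x y : act C (phiw (repr a)) (x - y) = act C (phiw (repr a)) x - act C (phiw (repr a)) y.
  by rewrite actD -scaleN1r actZ scaleN1r.
by rewrite !gact_word => -[h1 h2]; split; rewrite -actZ -B; exact: pd_act.
Qed.

Lemma gact_cont a : continuous (gact C a).
Proof.
have -> : gact C a = act C (phiw (repr a)) by apply/funext => o; exact: gact_word.
exact: act_cont.
Qed.

Lemma liftable_act e a x : liftable u e x -> liftable u e (actX a x).
Proof.
move=> h o1 po1 xo1.
have xo := @orthX_gact a^-1%g _ _ xo1; rewrite actXK in xo.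
have [l [l1 l2]] := h _ (@pd_gact a^-1%g _ po1) xo.
exists (fun o => actX a (l (gact C a^-1%g o))); split; first by rewrite l1.
move=> o /(@gact_box _ a^-1%g _ _)/l2 [h1 h2]; split.
  by have := @orthX_gact a _ _ h1; rewrite (gactVK hC).
have cA : continuous (actX a) by case: hd.
apply: (@cvg_comp _ _ _ (fun o => l (gact C a^-1%g o)) (actX a) _ (nbhs (l (gact C a^-1%g o)))).
  exact: (cvg_comp _ _ (@gact_cont a^-1%g o) h2).
exact: cA.
Qed.

(* Compactness of [S] and equivariance make the size of the liftable boxes uniform. *)
Lemma liftable_uniform : exists e, [/\ 0 < e, e <= 1 & forall x, liftable u e x].
Proof.
have [_ cS _ _] := hS; have [cp sp _] := pcov.
have [_ _ hdeck _] := hd.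
pose Q (e : R) (s : S) := forall x, p x = s -> liftable u e x.
have N := (@compact_near_coveringP S [set: S]).1 cS.
have H : \forall e \near (0 : R)^'+, [set: S] `<=` Q e.
  apply: N => s _; have [x xs] := sp s.
  have [e [e0 e1 [_ nl _ _]]] := fit_at pcov hA hfit x.
  have [ O [oO Ox] sO] : exists2 O, open_nbhs x O & O `<=` liftable u e.
    by move: nl; rewrite -nbhs_nearE nbhsE.
  have np : nbhs s (p @` O).
    by apply: open_nbhs_nbhs; split; [exact: cover_open|exists x].
  exists (p @` O, [set e' | e' <= e]) => /=.
    by split => //; exact: nbhs_right_le.
  move=> [s' e'] /= [[x' Ox' <-] ee'] y py.
  have [a <-] := (hdeck x' y).1 (esym py).
  by apply: liftable_act; apply: liftable_mono ee' _; exact: sO.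
have pos : \forall e \near (0 : R)^'+, 0 < e by exact: nbhs_right_gt.
have le1 : \forall e \near (0 : R)^'+, e <= 1 by exact: nbhs_right_le.
have [e [[h0 h1] h2]] := filter_ex (filterI (filterI pos le1) H).
by exists e; split => // x; exact: (h2 (p x)).
Qed.

Lemma fitting_section : exists L : V -> X, forall o, pd o ->
  {for o, continuous L} /\ forall x, ox o x <-> x = L o.
Proof.
have [e [e0 e1 hl]] := liftable_uniform.
have hX : hausdorff_space X by apply: (cover_hausdorff pcov); case: hS.
have cX : connected [set: X] by exact: path_connected_connected hp.2.
have [x0 _] : [set: X] !=set0 by case: hp.2.
have ex x : exists2 o, pd o & ox o x := mixed_pd_orth (plane_mixed (u x)).
have [ o0 po0 z0] := ex x0.
apply: (@global_section_unique R X ox e e0 e1 hX _ _ o0 x0 po0 z0 cX ex).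
- by move=> o1 x1; exact: hl.
- by move=> x; have [e' [_ _ [h _ _ _]]] := fit_at pcov hA hfit x.
- by move=> x a b t; exact: orthX_seg.
- by move=> x; have [e' [_ _ [_ _ h _]]] := fit_at pcov hA hfit x.
Qed.

Lemma orthX_closed v x : ~ ox v x -> \forall q \near (v, x), ~ ox q.1 q.2.
Proof. by have [e [_ _ [_ _ _ h]]] := fit_at pcov hA hfit x; exact: h. Qed.

(** A sheet of the covering meets each fibre at most once, and the action is free. *)
Lemma deck_proper (x : X) : exists2 W : set X, nbhs x W & forall y a b, W (actX a y) -> W (actX b y) -> a = b.
Proof.
have [[a1 aM] _ hdeck _] := hd.
have [V0 [W [_ _ Wx oW [_ inj _ _]]]] := cover_sheet pcov x.
exists W; first exact: open_nbhs_nbhs.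
move=> y a b Wa Wb.
have pe c : p (actX c y) = p y.
  by apply/hdeck; exists c^-1%g; exact: actXK.
have E : actX a y = actX b y by apply: inj; rewrite ?inE // !pe.
have : (b^-1 * a)%g = 1%g by apply: (@actX_fix _ y); rewrite aM E actXK.
by move=> h; rewrite -[a]mul1g -(mulgV b) -mulgA h mulg1.
Qed.

End FittingSection.

(** * Endpoints *)

Section LinearDependence.
Variable R : realType.
Local Notation V := 'rV[R]_4.
Implicit Types (o v w q : V).

Lemma dependent5 (F : 'I_5 -> V) : exists c : 'I_5 -> R,
  (exists i, c i != 0) /\ \sum_i c i *: F i = 0.
Proof.
pose M : 'M[R]_(5, 4) := \matrix_i F i.
have : kermx M != 0.
  rewrite kermx_eq0 /row_free; apply: contraTN (rank_leq_col M) => /eqP ->.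
  by rewrite -ltnNge.
move=> /rowV0Pn [c /sub_kermxP cM c0].
exists (fun i => c 0 i); split.
  apply/existsP; apply: contraNT c0; rewrite negb_exists => /forallP h.
  by apply/eqP/rowP => i; rewrite mxE; apply/eqP; have := h i; rewrite negbK.
rewrite -[RHS]cM mulmx_sum_row; apply: eq_bigr => i _; congr (_ *: _).
by rewrite rowK.
Qed.

Definition flat w : V := vec (cr w) (cp w) (- 2 * cs w) (- 2 * ct w).

Lemma bil_flat q w : bil q w = \sum_k q 0 k * flat w 0 k.
Proof.
have sum4 (F : 'I_4 -> R) : \sum_k F k = F 0 + F 1 + F 2%:R + F 3%:R.
  rewrite !big_ord_recl big_ord0 addr0 !addrA.
  by congr (_ + F _ + F _ + F _); apply/val_inj.
rewrite sum4 -/(cp q) -/(cr q) -/(cs q) -/(ct q) -/(cp (flat w)) -/(cr (flat w)).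
rewrite -/(cs (flat w)) -/(ct (flat w)) /flat !vecE /bil; ring.
Qed.

Lemma orthogonal3 (F : 'I_3 -> V) : exists2 q, q != 0 & forall i, bil q (F i) = 0.
Proof.
pose M : 'M[R]_(4, 3) := \matrix_(k, j) flat (F j) 0 k.
have : kermx M != 0.
  rewrite kermx_eq0 /row_free; apply: contraTN (rank_leq_col M) => /eqP ->.
  by rewrite -ltnNge.
move=> /rowV0Pn [c /sub_kermxP cM c0].
exists c => // i; rewrite bil_flat.
have E := congr1 (fun m : 'rV[R]_3 => m 0 i) cM; rewrite !mxE in E; rewrite -[RHS]E.
by apply: eq_bigr => k _; rewrite !mxE.
Qed.

Lemma timelike_psd v : 0 <= bil v v -> psd v \/ psd (- v).
Proof.
move=> h; have hpr : 0 <= cp v * cr v.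
  by move: h; rewrite /bil; have := sqr_ge0 (cs v); have := sqr_ge0 (ct v); lra.
have [p0|p0|p0] := ltgtP 0 (cp v).
- by left; split => //; [exact: ltW|rewrite -(pmulr_rge0 _ p0)].
- right; split; rewrite ?bilNl ?bilNr ?opprK // ?cpN ?crN ?oppr_ge0; first exact: ltW.
  by rewrite -(nmulr_rge0 _ p0).
- have [r0|r0] := leP 0 (cr v); [left|right]; split; rewrite ?bilNl ?bilNr ?opprK //.
  + by rewrite -p0.
  + by rewrite cpN -p0 oppr0.
  + by rewrite crN oppr_ge0 ltW.
Qed.

Lemma pd_bil_gt0 o v : pd o -> psd v -> v != 0 -> 0 < bil o v.
Proof.
move=> ho hv v0; have [c c0 h] := pd_bil_lower ho.
by apply: lt_le_trans (h _ hv); rewrite mulr_gt0 // psd_tr_gt0.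
Qed.

Lemma psd_of_bil o v : pd o -> 0 <= bil v v -> 0 < bil o v -> psd v.
Proof.
move=> ho hv ov; have [//|h] := timelike_psd hv; exfalso.
have v0 : - v != 0.
  by rewrite oppr_eq0; apply: contraTneq ov => ->; rewrite /bil /cp /cr /cs /ct !mxE; lra.
by have := pd_bil_gt0 ho h v0; rewrite bilNr oppr_gt0 ltNge ltW.
Qed.

Lemma orthogonal_neg o q : pd o -> q != 0 -> bil q o = 0 -> bil q q < 0.
Proof.
move=> ho q0 qo; rewrite ltNge; apply/negP => h.
have [hq|hq] := timelike_psd h.
  by have := pd_bil_gt0 ho hq q0; rewrite bilC qo ltxx.
have q0' : - q != 0 by rewrite oppr_eq0.
by have := pd_bil_gt0 ho hq q0'; rewrite bilNr bilC qo oppr0 ltxx.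
Qed.

Definition nullC v := [/\ psd v, tr v = 1 & bil v v = 0].

Lemma tr1_neq0 v : tr v = 1 -> v != 0.
Proof. by move=> h; apply/eqP => v0; move: h; rewrite v0 /tr /cp /cr !mxE; lra. Qed.

Lemma nullC_normalize v : psd v -> v != 0 -> bil v v = 0 -> nullC ((tr v)^-1 *: v).
Proof.
move=> hv v0 h; have [h1 h2] := ballC_scale hv v0.
by split => //; rewrite bilZl bilZr h !mulr0.
Qed.

(* The other isotropic vector of the plane spanned by [o] and the isotropic [v]; [antipoint]
   is its normalization of trace 1. *)
Definition antipode o v := (2 * bil o v / bil o o) *: o - v.
Definition antipoint o v := (tr (antipode o v))^-1 *: antipode o v.

Lemma antipode_bil o v : pd o -> bil o (antipode o v) = bil o v.
Proof. by case=> _ _ d; rewrite /antipode bilDr bilNr bilZr; field; rewrite gt_eqF. Qed.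

Lemma antipode_null o v : pd o -> bil v v = 0 -> bil (antipode o v) (antipode o v) = 0.
Proof.
case=> _ _ d h; rewrite /antipode !(bilDl, bilDr, bilNl, bilNr, bilZl, bilZr) h (bilC v o).
by field; rewrite gt_eqF.
Qed.

Lemma antipodeK o v : pd o -> antipode o (antipode o v) = v.
Proof. by move=> h; rewrite {1}/antipode antipode_bil // /antipode opprB addrC subrK. Qed.

Lemma antipode_psd o v : pd o -> nullC v -> psd (antipode o v) /\ antipode o v != 0.
Proof.
move=> ho [h1 h2 h3]; have ov : 0 < bil o v by apply: pd_bil_gt0 => //; exact: tr1_neq0.
split; first by apply: (psd_of_bil ho); rewrite ?antipode_null ?antipode_bil.
apply/eqP => E; move: ov; rewrite -(antipode_bil v ho) E /bil /cp /cr /cs /ct !mxE; lra.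
Qed.

Lemma antipoint_null o v : pd o -> nullC v -> nullC (antipoint o v).
Proof.
by move=> ho hv; have [h1 h2] := antipode_psd ho hv; apply: nullC_normalize => //; case: hv => _ _ /antipode_null->.
Qed.

Lemma antipointK o v : pd o -> nullC v -> antipoint o (antipoint o v) = v.
Proof.
move=> ho hv; have [h1 h2] := antipode_psd ho hv; have t0 := psd_tr_gt0 h1 h2.
have oppZ k x : antipode o (k *: x) = k *: antipode o x.
  by apply: vec_ext; rewrite /antipode bilZr !coordE; ring.
have tv : tr v = 1 by case: hv.
rewrite /antipoint oppZ antipodeK // trZ tv mulr1 invrK scalerA mulfV ?scale1r //.
by rewrite gt_eqF.
Qed.

Lemma antipoint_decomp o v : pd o -> nullC v -> exists a b, [/\ 0 <= a, 0 <= b & o = a *: v + b *: antipoint o v].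
Proof.
move=> ho hv; have [h1 h2] := antipode_psd ho hv; have t0 := psd_tr_gt0 h1 h2.
have [hv1 hv2 hv3] := hv; have ov : 0 < bil o v by apply: pd_bil_gt0 => //; exact: tr1_neq0.
have oo : 0 < bil o o by case: ho.
exists (bil o o / (2 * bil o v)), (bil o o / (2 * bil o v) * tr (antipode o v)); split.
- by rewrite divr_ge0 ?mulr_ge0 // ltW.
- by rewrite mulr_ge0 ?(ltW t0) // divr_ge0 ?mulr_ge0 // ltW.
- set k := bil o o / _.
  have -> : (k * tr (antipode o v)) *: antipoint o v = k *: antipode o v.
    by rewrite /antipoint scalerA -mulrA mulfV ?mulr1 // gt_eqF.
  rewrite -scalerDr /antipode addrC subrK scalerA (_ : _ * _ = 1) ?scale1r //.
  by rewrite /k; field; rewrite !gt_eqF.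
Qed.

Lemma antipoint_cont o v : pd o -> nullC v -> (fun q : V * V => antipoint q.1 q.2) @ nbhs (o, v) --> antipoint o v.
Proof.
move=> ho hv; have [h1 h2] := antipode_psd ho hv; have t0 := psd_tr_gt0 h1 h2.
have oo : 0 < bil o o by case: ho.
have f1 : (fun q : V * V => q.1) @ nbhs (o, v) --> o by exact: (@cvg_fst V V (nbhs o) (nbhs v)).
have f2 : (fun q : V * V => q.2) @ nbhs (o, v) --> v by exact: (@cvg_snd V V (nbhs o) (nbhs v)).
have b1 : (fun q : V * V => bil q.1 q.1) @ nbhs (o, v) --> bil o o by exact: cvg_bil.
have b2 : (fun q : V * V => 2 * bil q.1 q.2) @ nbhs (o, v) --> 2 * bil o v.
  by apply: cvgM; [exact: cvg_cst|exact: cvg_bil].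
have b3 : (fun q : V * V => 2 * bil q.1 q.2 / bil q.1 q.1) @ nbhs (o, v) --> 2 * bil o v / bil o o.
  by apply: cvgM => //; apply: cvgV => //; rewrite gt_eqF.
have b4 : (fun q : V * V => antipode q.1 q.2) @ nbhs (o, v) --> antipode o v.
  have b5 : (fun q : V * V => (2 * bil q.1 q.2 / bil q.1 q.1) *: q.1) @ nbhs (o, v) --> (2 * bil o v / bil o o) *: o.
    exact: cvgZ.
  exact: (cvgB b5 f2).
have b6 : (fun q : V * V => tr (antipode q.1 q.2)) @ nbhs (o, v) --> tr (antipode o v).
  exact: (cvg_comp _ _ b4 (@tr_cont R _)).
have b7 : (fun q : V * V => (tr (antipode q.1 q.2))^-1) @ nbhs (o, v) --> (tr (antipode o v))^-1.
  by apply: cvgV => //; rewrite gt_eqF.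
exact: (cvgZ b7 b4).
Qed.

Lemma nullC_compact : compact nullC.
Proof.
have -> : nullC = ballC (R := R) `&` [set v | bil v v = 0].
  by apply/seteqP; split => v; [case|case=> -[]].
apply: compact_closedI; first exact: ballC_compact.
exact: (@closed_eqr R V (fun v => bil v v) 0 (@bil_cont R)).
Qed.

Section OnePlane.
Variables (P : {vspace V}) (o : V).
Hypotheses (mP : mixed P) (ho : pd o) (oP : orthv o P).

(** The forms orthogonal to the plane contain [o] and a direction [q] that is Lorentz orthogonal to
    [o], hence spacelike; a suitable multiple of [q] added to [o] is isotropic. *)
Lemma endpoint_exists : exists2 v, nullC v & orthv v P.
Proof.
have [dP _] := mP; have [e [f eP]] := plane_basis dP.
have [q q0 hq] := orthogonal3 (fun i : 'I_3 => [:: o; dual e; dual f]`_i).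
have qo : bil q o = 0 := hq 0.
have qe : bil q (dual e) = 0 := hq 1.
have qf : bil q (dual f) = 0 := hq 2%:R.
have n := orthogonal_neg ho q0 qo; have oo : 0 < bil o o by case: ho.
pose c := Num.sqrt (bil o o / - bil q q).
have c2 : c ^+ 2 = bil o o / - bil q q by rewrite sqr_sqrtr // divr_ge0 ?oppr_ge0 // ltW.
pose v := o + c *: q.
have vv : bil v v = 0.
  have -> : bil v v = bil o o + c ^+ 2 * bil q q.
    by rewrite /v !(bilDl, bilDr, bilZl, bilZr) (bilC o q) qo; ring.
  by rewrite c2; field; rewrite lt_eqF.
have ov : bil o v = bil o o by rewrite /v bilDr bilZr (bilC o q) qo mulr0 addr0.
have hv : psd v by apply: (psd_of_bil ho); rewrite ?vv ?ov.
have v0 : v != 0.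
  by apply/eqP => E; move: oo; rewrite -ov E /bil /cp /cr /cs /ct !mxE; lra.
exists ((tr v)^-1 *: v); first exact: nullC_normalize.
have [oe of_] := (orthv_span o eP).1 oP.
apply/(orthv_span _ eP); rewrite !pairZl /v !pairDl !pairZl oe of_ !pair_dual qe qf.
by rewrite !mulr0 addr0 mulr0.
Qed.

Lemma endpoint_antipoint v : orthv v P -> orthv (antipoint o v) P.
Proof.
move=> hv q qP; rewrite /antipoint pairZl /antipode pairDl pairNl pairZl (oP qP) (hv q qP); ring.
Qed.

(** Five vectors of a space of dimension 4 are dependent. The part of the relation that comes from
    the plane is some [dual q] which is also a combination of [o], [v], [w], all orthogonal to [q];
    so q is isotropic, and zero as the plane is mixed. Then [w] is an isotropic vector of the span
    of [o] and [v]. *)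
Lemma endpoint_unique v w : nullC v -> nullC w -> orthv v P -> orthv w P -> w = v \/ w = antipoint o v.
Proof.
move=> hv hw vP wP; have [dP _] := mP; have [e [f eP]] := plane_basis dP.
have [e0 ind] : e != 0 /\ forall k, f != k *: e by apply: span2_indep; rewrite -eP.
have [c [[i0 ci0] hc]] := dependent5 (fun i : 'I_5 => [:: o; v; w; dual e; dual f]`_i).
move: hc; rewrite !big_ord_recl big_ord0 addr0 /=.
set c0 := c _; set c1 := c _; set c2 := c _; set c3 := c _; set c4 := c _ => hc.
have cz : ~ [/\ c0 = 0, c1 = 0, c2 = 0 & c3 = 0 /\ c4 = 0].
  move=> [z0 z1 z2 [z3 z4]]; move/eqP: ci0; apply.
  case: i0 => -[|[|[|[|[|]]]]] // h.
  - by rewrite -z0; congr c; apply/val_inj.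
  - by rewrite -z1; congr c; apply/val_inj.
  - by rewrite -z2; congr c; apply/val_inj.
  - by rewrite -z3; congr c; apply/val_inj.
  - by rewrite -z4; congr c; apply/val_inj.
pose q := c3 *: e + c4 *: f.
have qP : q \in P.
  rewrite eP; apply: memv_add; rewrite memvZ ?memv_line //.
have dq : dual q = c3 *: dual e + c4 *: dual f.
  by apply: vec_ext; rewrite /dual !coordE //; ring.
have dE : dual q = - (c0 *: o + c1 *: v + c2 *: w).
  apply/eqP; rewrite -addr_eq0 dq addrC -hc; apply/eqP.
  by rewrite !addrA.
have qq : bil q q = 0.
  rewrite -bil_dual {2}dE bilNr !bilDr !bilZr !(bilC (dual q)) -!pair_dual.
  by rewrite (oP qP) (vP q qP) (wP q qP); ring.
have q0 : q = 0.
  by apply/eqP; apply/negPn/negP => q0; have := mixed_neg mP qP q0; rewrite qq ltxx.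
have z4 : c4 = 0.
  apply/eqP; apply/negPn/negP => n4; have := ind (- c3 / c4); apply/negP; rewrite negbK; apply/eqP.
  have : c4 *: f = - c3 *: e by apply/eqP; rewrite -subr_eq0 scaleNr opprK addrC -/q q0.
  by move=> /(congr1 (fun x => c4^-1 *: x)); rewrite !scalerA mulVf // scale1r mulrC.
have z3 : c3 = 0.
  move/eqP: q0; rewrite /q z4 scale0r addr0 scaler_eq0 (negbTE e0) orbF => /eqP //.
move: hc; rewrite z3 z4 !scale0r !addr0 addrA => hc.
have [pv tv vv] := hv; have [pw tw ww] := hw; have oo : 0 < bil o o by case: ho.
have v0 := tr1_neq0 tv; have ov := pd_bil_gt0 ho pv v0.
have n2 : c2 != 0.
  apply/eqP => z2; move: hc; rewrite z2 scale0r addr0 => hc.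
  have h1 : c0 * bil o v = 0.
    by have := congr1 (bil v) hc; rewrite bilDr !bilZr vv (bilC v o) /bil /cp /cr /cs /ct !mxE; lra.
  have z0 : c0 = 0 by move/eqP: h1; rewrite mulf_eq0 (gt_eqF ov) orbF => /eqP.
  move: hc; rewrite z0 scale0r add0r => /eqP; rewrite scaler_eq0 (negbTE v0) orbF => /eqP z1.
  exact: cz.
pose a := - c0 / c2; pose b := - c1 / c2.
have wE : w = a *: o + b *: v.
  have : c2 *: w = - c0 *: o + - c1 *: v.
    by apply/eqP; rewrite -subr_eq0 !scaleNr opprD !opprK addrC hc.
  move=> /(congr1 (fun x => c2^-1 *: x)); rewrite scalerDr !scalerA mulVf // scale1r => ->.
  by rewrite /a /b ![_ / c2]mulrC.
have h2 : a * (a * bil o o + 2 * b * bil o v) = 0.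
  move: ww; rewrite wE !(bilDl, bilDr, bilZl, bilZr) vv (bilC v o); lra.
move/eqP: h2; rewrite mulf_eq0 => /orP[/eqP a0|/eqP h2].
  left; rewrite wE a0 scale0r add0r; have : b = 1.
    by have := tw; rewrite wE a0 scale0r add0r trZ tv mulr1.
  by move=> ->; rewrite scale1r.
right; have aE : a = - (b * (2 * bil o v / bil o o)).
  have : a * bil o o = - (2 * b * bil o v) by lra.
  by move=> /(congr1 (fun x => x / bil o o)); rewrite mulfK ?gt_eqF // => ->; field; rewrite gt_eqF.
have wo : w = (- b) *: antipode o v.
  by apply: vec_ext; rewrite wE aE /antipode !coordE; ring.
have [po oo0] := antipode_psd ho hv; have t0 := psd_tr_gt0 po oo0.
rewrite /antipoint {1}wo; congr (_ *: _).
have : - b * tr (antipode o v) = 1 by rewrite -trZ -wo.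
by move=> /(congr1 (fun x => x / tr (antipode o v))); rewrite mulfK ?gt_eqF // mul1r.
Qed.

End OnePlane.
End LinearDependence.

(** * Continuity of the endpoints and their distribution on two sides *)

Section Endpoints.
Variable R : realType.
Local Notation V := 'rV[R]_4.
Variables (X : topologicalType) (P : X -> {vspace V}) (L : V -> X).
Implicit Types (o v w : V).
Hypotheses (mP : forall x, mixed (P x))
  (hL : forall o, pd o -> {for o, continuous L} /\ forall x, orthv o (P x) <-> x = L o)
  (clo : forall v x, ~ orthv v (P x) -> \forall q \near (v, x), ~ orthv q.1 (P q.2)).

Definition endpt o v := nullC v /\ orthv v (P (L o)).

Let oL o : pd o -> orthv o (P (L o)). Proof. by move=> po; apply/(hL po).2. Qed.

Lemma endpt_ex o : pd o -> exists v, endpt o v.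
Proof. by move=> po; have [v h1 h2] := endpoint_exists (mP (L o)) po (oL po); exists v. Qed.

Lemma endpt_antipoint o v : pd o -> endpt o v -> endpt o (antipoint o v).
Proof. by move=> po [h1 h2]; split; [exact: antipoint_null|exact: endpoint_antipoint (oL po) _ h2]. Qed.

Lemma endpt_unique o v w : pd o -> endpt o v -> endpt o w -> w = v \/ w = antipoint o v.
Proof. by move=> po [h1 h2] [h3 h4]; exact: (endpoint_unique (mP (L o)) po (oL po)). Qed.

(** Upper semicontinuity of the pair of endpoints: outside the interior of [U] the normalized
    isotropic vectors are compact, and not being an endpoint is an open condition. *)
Lemma endpt_near o (U : set V) : pd o -> (forall v, endpt o v -> nbhs v U) ->
  \forall o' \near o, forall v, endpt o' v -> U v.
Proof.
move=> po hU; have [cL _] := hL po.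
pose K := nullC (R := R) `&` ~` (U^°).
have cK : compact K.
  by apply: compact_closedI; [exact: nullC_compact|apply: open_closedC; exact: open_interior].
have N := (@compact_near_coveringP V K).1 cK.
pose Q o' v := ~ orthv v (P (L o')).
have H : \forall o' \near o, K `<=` Q o'.
  apply: (N V (nbhs o) Q _) => v [nv nU].
  have nv' : ~ orthv v (P (L o)) by move=> h; apply: nU; exact: hU.
  have g1 : (fun q : V * V => q.1) @ nbhs (v, o) --> v by exact: (@cvg_fst V V (nbhs v) (nbhs o)).
  have g2 : (fun q : V * V => L q.2) @ nbhs (v, o) --> L o.
    exact: (cvg_comp _ _ (@cvg_snd V V (nbhs v) (nbhs o) _) cL).
  have g3 : (fun q : V * V => (q.1, L q.2)) @ nbhs (v, o) --> (v, L o) by exact: (cvg_pair g1 g2).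
  exact: (g3 _ (clo nv')).
near=> o' => v [nv ov]; apply: contrapT => nUv.
have Kv : K v by split => // /interior_subset.
have H' : K `<=` Q o' by near: o'; exact: H.
exact: (H' v Kv).
Unshelve. all: by end_near. Qed.

Section Sides.
Variables (Wp Wm : V -> Prop).
Hypotheses (Wcov : forall o v, pd o -> endpt o v -> Wp v \/ Wm v)
  (Wdisj : forall v, nullC v -> Wp v -> Wm v -> False)
  (oWp : forall v, nullC v -> Wp v -> \forall v' \near v, nullC v' -> Wp v')
  (oWm : forall v, nullC v -> Wm v -> \forall v' \near v, nullC v' -> Wm v')
  (exp : exists2 v, nullC v & Wp v) (exm : exists2 v, nullC v & Wm v).

Let hit (W : V -> Prop) o := exists2 v, endpt o v & W v.

(** An endpoint for a nearby [o'] is close to [v] or to its antipode; in the second case its own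
    antipode is close to [v]. *)
Lemma hit_open (W : V -> Prop) o : (forall v, nullC v -> W v -> \forall v' \near v, nullC v' -> W v') ->
  pd o -> hit W o -> \forall o' \near o, pd o' -> hit W o'.
Proof.
move=> oW po [v ev Wv]; have nv : nullC v by case: ev.
have nW := oW v nv Wv.
have nw := antipoint_null po nv.
have := antipoint_cont po nw; rewrite antipointK // => cn.
have [[Q1 Q2] [/= nQ1 nQ2] sub] := cn _ nW.
have H : \forall o' \near o, forall w, endpt o' w ->
   ((fun v' => nullC v' -> W v') `|` Q2) w.
  apply: endpt_near => // w ew.
  have [->|->] := endpt_unique po ev ew; first by apply: filterS nW => x hx; left.
  by apply: filterS nQ2 => x hx; right.
near=> o' => po'; have [w ew] := endpt_ex po'.
have nw' : nullC w by case: ew.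
have H' : forall w, endpt o' w -> ((fun v' => nullC v' -> W v') `|` Q2) w by near: o'; exact: H.
have [h|h] := H' w ew; first by exists w => //; exact: h.
exists (antipoint o' w); first exact: endpt_antipoint.
by apply: (sub (o', w)); [split => //=; near: o'|exact: antipoint_null].
Unshelve. all: by end_near. Qed.

(* When [o] tends to the isotropic vector [v], an endpoint of the geodesic through [o]
   tends to [v]. *)
Lemma hit_ex (W : V -> Prop) : (forall v, nullC v -> W v -> \forall v' \near v, nullC v' -> W v') ->
  (exists2 v, nullC v & W v) -> exists2 o, pd o & hit W o.
Proof.
move=> oW [v nv Wv]; have [e /= e0 he] := (@nbhs_ballP R V v _).1 (oW v nv Wv).
have [pv tv vv] := nv.
pose d := e ^+ 2 / 32; have d0 : 0 < d by rewrite divr_gt0 ?exprn_gt0.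
pose o := d *: idv R + v.
have po : pd o by apply: pdDl => //; apply: pdZ => //; exact: pd_idv.
have [a ea] := endpt_ex po; have eb := endpt_antipoint po ea.
have na : nullC a by case: ea.
have nb : nullC (antipoint o a) by case: eb.
have [al [be [al0 be0 E]]] := antipoint_decomp po na.
move: eb nb E; move: (antipoint o a) => b eb nb E.
have [pa ta _] := na; have [pb tb _] := nb.
have bo : bil v o = d by rewrite /o bilDr bilZr bil_idv tv vv; ring.
have tro : 1 <= al + be.
  have : tr o = al + be by rewrite E trD !trZ ta tb !mulr1.
  rewrite /o trD trZ tv => <-; rewrite lerDr mulr_ge0 ?(ltW d0) //; exact/ltW/pd_tr/pd_idv.
have bE : al * bil v a + be * bil v b = d by rewrite -bo {1}E bilDr !bilZr.
have va : 0 <= bil v a by exact: psd_bil.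
have vb : 0 <= bil v b by exact: psd_bil.
have close c : nullC c -> bil v c <= 2 * d -> nullC c -> W c.
  move=> [pc tc cc] hb; apply: he; rewrite -ball_normE /ball_ /=.
  have := psd_bil_dist (etrans tv (esym tc)) pv pc => h.
  have e2 : 2 * d = (e / 4) ^+ 2 by rewrite /d; field.
  have sq (x y z : R) : x ^+ 2 + y ^+ 2 + z ^+ 2 <= (e / 4) ^+ 2 -> [/\ `|x| <= e / 4, `|y| <= e / 4 & `|z| <= e / 4].
    move=> hx; have := sqr_ge0 x; have := sqr_ge0 y; have := sqr_ge0 z => z2 y2 x2.
    have e4 : 0 <= e / 4 by rewrite divr_ge0 // ltW.
    by split; rewrite -ler_sqr ?nnegrE // real_normK ?num_real //; lra.
  have hb' := le_trans h hb; rewrite e2 in hb'; have [h1 h2 h3] := sq _ _ _ hb'.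
  have h4 : `|cr v - cr c| <= e / 4.
    have -> : cr v - cr c = - (cp v - cp c) by move: tv tc; rewrite /tr; lra.
    by rewrite normrN.
  apply: le_lt_trans (_ : e / 4 < e); last by lra.
  apply: norm_le; first by rewrite divr_ge0 // ltW.
  by move=> i; case: (ord4P i) => ->; rewrite !mxE; [exact: h1|exact: h4|exact: h2|exact: h3].
exists o => //.
have [ha|ha] := leP (1 / 2) al.
  exists a => //; apply: close => //.
  have : 1 / 2 * bil v a <= al * bil v a by rewrite ler_wpM2r.
  have := mulr_ge0 be0 vb; lra.
exists b => //; apply: close => //.
have : 1 / 2 * bil v b <= be * bil v b by rewrite ler_wpM2r //; lra.
have := mulr_ge0 al0 va; lra.
Qed.

Let not_hit W W' o : (forall v, nullC v -> W v -> W' v -> False) ->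
  (forall o v, pd o -> endpt o v -> W v \/ W' v) ->
  (forall v, nullC v -> W' v -> \forall v' \near v, nullC v' -> W' v') ->
  pd o -> ~ hit W o -> \forall o' \near o, ~ hit W o'.
Proof.
move=> dj cov oW' po nh.
have H : \forall o' \near o, forall v, endpt o' v -> nullC v -> W' v.
  apply: (@endpt_near o (fun v => nullC v -> W' v)) => // v ev; have nv : nullC v by case: ev.
  by have [h|h] := cov o v po ev; [case: nh; exists v|exact: oW'].
near=> o' => -[v ev Wv]; have nv : nullC v by case: ev.
have H' : forall v, endpt o' v -> nullC v -> W' v by near: o'; exact: H.
exact: (dj v nv Wv (H' v ev nv)).
Unshelve. all: by end_near. Qed.

(** Having an endpoint in [W] is an open condition, its negation is open too, and it holds somewhere
    by [hit_ex]; the cone is convex. *)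
Let hit_all W W' : (forall v, nullC v -> W v -> W' v -> False) ->
  (forall o v, pd o -> endpt o v -> W v \/ W' v) ->
  (forall v, nullC v -> W v -> \forall v' \near v, nullC v' -> W v') ->
  (forall v, nullC v -> W' v -> \forall v' \near v, nullC v' -> W' v') ->
  (exists2 v, nullC v & W v) -> forall o, pd o -> hit W o.
Proof.
move=> dj cov oW oW' ex o po; have [ o1 po1 h1] := hit_ex oW ex.
have := @loc_const_01 R (fun t => hit W (seg o1 o t)).
rewrite seg0 seg1; apply => // t ht; have ps := seg_pd po1 po ht.
have cs := @seg_contt R o1 o t.
have [h|h] := pselect (hit W (seg o1 o t)).
  have H := cs _ (hit_open oW ps h); near=> s => hs; split => // _.
  have Hs : pd (seg o1 o s) -> hit W (seg o1 o s) by near: s; exact: H.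
  by apply: Hs; exact: seg_pd.
have H := cs _ (not_hit dj cov oW' ps h); near=> s => hs.
have Hs : ~ hit W (seg o1 o s) by near: s; exact: H.
by split.
Unshelve. all: by end_near. Qed.

Lemma sides o : pd o -> exists z, [/\ endpt o z, Wp z & Wm (antipoint o z)].
Proof.
move=> po; have [z ez Wz] := hit_all Wdisj Wcov oWp oWm exp po.
have [w ew Ww] : hit Wm o.
  apply: (@hit_all Wm Wp) => //; first by move=> v nv h1 h2; exact: Wdisj h2 h1.
  by move=> o' v po' ev; have [] := Wcov po' ev; [right|left].
exists z; split => //.
have [E|<- //] := endpt_unique po ez ew.
by exfalso; apply: (@Wdisj z) => //; [case: ez|rewrite -E].
Qed.

(** A nearby endpoint is close to [z t] or lies in [Wm]; the chosen one lies in [Wp], which leaves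
    the first case. *)
Lemma sides_continuous (c : R -> V) (z : R -> V) t :
  (\forall s \near t, pd (c s)) -> c @ nbhs t --> c t ->
  (\forall s \near t, [/\ endpt (c s) (z s), Wp (z s) & Wm (antipoint (c s) (z s))]) ->
  z @ nbhs t --> z t.
Proof.
move=> pc cc hz U nU; have pt := nbhs_singleton pc; have [e1 e2 e3] := nbhs_singleton hz.
have nz : nullC (z t) by case: e1.
have H : \forall o' \near c t, forall v, endpt o' v -> (U `|` (fun v => nullC v -> Wm v)) v.
  apply: endpt_near => // v ev; have [->|->] := endpt_unique pt e1 ev.
    by apply: filterS nU; left.
  by apply: filterS (oWm (antipoint_null pt nz) e3); right.
have H' := cc _ H.
have : \forall s \near t, U (z s); last by [].
near=> s.
have [h1 h2 h3] : [/\ endpt (c s) (z s), Wp (z s) & Wm (antipoint (c s) (z s))] by near: s.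
have H2 : forall v, endpt (c s) v -> (U `|` (fun v => nullC v -> Wm v)) v by near: s; exact: H'.
have ns : nullC (z s) by case: h1.
by have [//|h] := H2 _ h1; exfalso; exact: (Wdisj ns h2 (h ns)).
Unshelve. all: by end_near. Qed.

End Sides.
End Endpoints.

(** * The two sides of the limit set *)

Section ChamberSides.
Variables (R : realType) (T : finType) (C : necklace R T).
Local Notation V := 'rV[R]_4.
Implicit Types (d v : V).

Lemma power_cont i : continuous (power (C i)).
Proof. by move=> o; exact: cvg_bil_r. Qed.

(** At most two mirrors pass through [d], and they commute. The reflections in them fix [d], so they
    bring nearby points into the chamber without taking them far from [d]. *)
Lemma chamber_near d (N : set V) : psd d -> d != 0 -> chamber C d -> nbhs d N ->
  \forall d' \near d, exists w, chamber C (act C w d') /\ N (act C w d').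
Proof.
move=> hd d0 cd nN.
have strict (J : pred T) : (forall k, ~~ J k -> power (C k) d < 0) ->
    \forall d' \near d, forall k, ~~ J k -> power (C k) d' < 0.
  move=> h.
  have S k : \forall d' \near d, ~~ J k -> power (C k) d' < 0.
    have [Jk|Jk] := boolP (J k); first by near=> d'.
    have n := cvgr_lt _ (@power_cont k d) _ (h k Jk).
    by near=> d' => _; near: d'; exact: n.
  exact: (@filter_forall V T (fun k d' => ~~ J k -> power (C k) d' < 0) (nbhs d) _ S).
(* The case [i == j] is that of a single mirror through [d]. *)
have two i j : power (C i) d = 0 -> power (C j) d = 0 -> (i == j) || nextto C i j ->
    (forall k, k != i -> k != j -> power (C k) d < 0) ->
    \forall d' \near d, exists w, chamber C (act C w d') /\ N (act C w d').
  move=> pi pj ij neg.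
  have fi : refl (C i) d = d by exact: refl_id.
  have fj : refl (C j) d = d by exact: refl_id.
  pose J k := (k == i) || (k == j).
  have neg' k : ~~ J k -> power (C k) d < 0 by rewrite negb_or => /andP[]; exact: neg.
  have G0 : \forall d' \near d, N d' /\ forall k, ~~ J k -> power (C k) d' < 0.
    by apply: filterI => //; exact: strict.
  have back k : refl (C k) d = d -> forall Q : set V, nbhs d Q -> \forall d' \near d, Q (refl (C k) d').
    by move=> fk Q nQ; have := @refl_cont R (C k) d; rewrite /continuous_at fk; apply.
  have G1 := back i fi _ G0; have G2 := back j fj _ G0; have G3 := back i fi _ G2.
  near=> d'.
  have H0 : N d' /\ forall k, ~~ J k -> power (C k) d' < 0 by near: d'; exact: G0.
  have H1 : N (refl (C i) d') /\ forall k, ~~ J k -> power (C k) (refl (C i) d') < 0.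
    by near: d'; exact: G1.
  have H2 : N (refl (C j) d') /\ forall k, ~~ J k -> power (C k) (refl (C j) d') < 0.
    by near: d'; exact: G2.
  have H3 : N (refl (C j) (refl (C i) d')) /\
     forall k, ~~ J k -> power (C k) (refl (C j) (refl (C i) d')) < 0.
    by near: d'; exact: G3.
  have fin x : power (C i) x <= 0 -> power (C j) x <= 0 ->
     (forall k, ~~ J k -> power (C k) x < 0) -> chamber C x.
    move=> h1 h2 h3 k; have [|Jk] := boolP (J k); last exact/ltW/h3.
    by move=> /orP[/eqP->|/eqP->].
  have [a|a] := leP (power (C i) d') 0.
    have [b|b] := leP (power (C j) d') 0.
      by exists [::]; split => /=; [apply: fin => //; exact: H0.2|exact: H0.1].
    exists [:: j]; split => /=; [apply: fin; [|by rewrite power_self oppr_le0 ltW|exact: H2.2]|exact: H2.1].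
    move: ij => /orP[/eqP E|h]; last by rewrite power_next.
    by move: b; rewrite -E ltNge a.
  have a' : power (C i) (refl (C i) d') <= 0 by rewrite power_self oppr_le0 ltW.
  have [b|b] := leP (power (C j) (refl (C i) d')) 0.
    by exists [:: i]; split => /=; [apply: fin => //; exact: H1.2|exact: H1.1].
  exists [:: j; i]; split => /=; [apply: fin; [|by rewrite power_self oppr_le0 ltW|exact: H3.2]|exact: H3.1].
  move: ij => /orP[/eqP E|h]; last by rewrite power_next.
  by move: b; rewrite -E ltNge a'.
have [/existsP [i /eqP pi]|] := boolP [exists i, power (C i) d == 0]; last first.
  rewrite negb_exists => /forallP h.
  have G0 : \forall d' \near d, forall k, ~~ pred0 k -> power (C k) d' < 0.
    by apply: strict => k _; rewrite lt_neqAle h cd.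
  near=> d'; exists [::]; split => /=; last by near: d'.
  have H : forall k, ~~ pred0 k -> power (C k) d' < 0 by near: d'; exact: G0.
  by move=> k; exact/ltW/H.
have far k : k != i -> ~~ nextto C i k -> power (C k) d < 0.
  by move=> ki nk; apply: (far_neg _ nk) => //; rewrite ?pi // eq_sym.
have [/existsP [j /andP[nij /eqP pj]]|] := boolP [exists j, nextto C i j && (power (C j) d == 0)].
  apply: (two i j) => //; first by rewrite nij orbT.
  move=> k ki kj; have [nik|] := boolP (nextto C i k); last exact: far.
  have nji : nextto C j i by rewrite next_sym.
  by apply: (far_neg _ (next_trig nji nik)) => //; rewrite ?pj // eq_sym.
rewrite negb_exists => /forallP h; apply: (two i i) => //; first by rewrite eqxx.
move=> k ki _; have [nik|] := boolP (nextto C i k); last exact: far.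
by rewrite lt_neqAle cd andbT; have := h k; rewrite nik.
Unshelve. all: by end_near. Qed.

Variable (Q : V -> Prop).

Definition side (v : V) := exists w, chamber C (act C w v) /\ Q (act C w v).

Lemma side_open : (forall v, psd v -> v != 0 -> bil v v = 0 -> chamber C v -> Q v ->
    \forall v' \near v, psd v' -> bil v' v' = 0 -> chamber C v' -> Q v') ->
  forall v, nullC v -> side v -> \forall v' \near v, nullC v' -> side v'.
Proof.
move=> hQ v [pv tv vv] [w [cw Qw]].
have pw := psd_act C w pv; have w0 := act_neq0 C w (tr1_neq0 tv).
have ww : bil (act C w v) (act C w v) = 0 by rewrite bil_act.
have n := chamber_near pw w0 cw (hQ _ pw w0 ww cw Qw).
have n' := @act_cont R T C w v _ n.
near=> v' => -[pv' tv' vv'].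
have [w' [h1 h2]] : exists w', chamber C (act C w' (act C w v')) /\
   (psd (act C w' (act C w v')) -> bil (act C w' (act C w v')) (act C w' (act C w v')) = 0 ->
    chamber C (act C w' (act C w v')) -> Q (act C w' (act C w v'))) by near: v'; exact: n'.
exists (w' ++ w); rewrite act_cat; split => //; apply: h2 => //; last by rewrite !bil_act.
by do 2!apply: psd_act.
Unshelve. all: by end_near. Qed.

End ChamberSides.

Section SidesDisjoint.
Variables (R : realType) (T : finType) (C : necklace R T) (Q : 'rV[R]_4 -> Prop).

(** Two translates of [v] in the chamber coincide by [chamber_fixed], so [Q] is decided by either of
    them. *)
Lemma side_disjoint v : nullC v -> side C (fun v => ~ Q v) v -> side C Q v -> False.
Proof.
move=> [pv tv vv] [w [cw Qw]] [w' [cw' Qw']].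
have E : act C w' v = act C (w' ++ rev w) (act C w v) by rewrite act_cat act_revK.
have := @chamber_fixed R T C (w' ++ rev w) _ (psd_act C w pv) (act_neq0 C w (tr1_neq0 tv)) cw.
by rewrite -E => /(_ cw') e; apply: Qw; rewrite -e.
Qed.

Lemma side_cover v : tame C v -> side C (fun v => ~ Q v) v \/ side C Q v.
Proof. by move=> [w cw]; have [h|h] := pselect (Q (act C w v)); [right|left]; exists w. Qed.

End SidesDisjoint.

Lemma stepw_rev g c (w : seq (bead_letter g)) : stepw (stepw c (rev w)) w = c.
Proof.
elim: w c => //= a w IH c.
by rewrite rev_cons /stepw -cats1 foldl_cat /= stepK; exact: IH.
Qed.

(** * Endpoints lie in the domain of discontinuity *)

Section Tame.
Variables (R : realType) (g : nat) (C : necklace R (bead_letter g)).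
Hypothesis hC : nextto C =2 @bead_next g.
Local Notation V := 'rV[R]_4.
Local Notation G := (surface_group g).
Variables (X : topologicalType) (P : X -> {vspace V}) (L : V -> X) (actX : G -> X -> X).
Hypotheses (hL : forall o, pd o -> {for o, continuous L} /\ forall x, orthv o (P x) <-> x = L o)
  (eqv : forall a o x, orthv o (P x) -> orthv (gact C a o) (P (actX a x)))
  (proper : forall x : X, exists2 W : set X, nbhs x W &
     forall y a b, W (actX a y) -> W (actX b y) -> a = b).

(** Near each point of the compact set at most one group element [a] occurs; finitely many such
    neighbourhoods suffice. *)
Lemma translate_bounded (f : V -> V) (h : G -> R) (K : set V) x : compact K ->
  (forall m, K m -> pd (f m)) -> continuous f ->
  \forall M \near +oo, forall m, K m -> forall a, actX a x = L (f m) -> h a < M.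
Proof.
move=> cK pK cf.
pose Q (M : R) m := forall a, actX a x = L (f m) -> h a < M.
have N := (@compact_near_coveringP V K).1 cK.
have H : \forall M \near (+oo : set_system R), K `<=` Q M.
  apply: (N R (pinfty_nbhs R) Q _) => m Km.
  have [cL _] := hL (pK m Km).
  have [W nW inj] := proper (L (f m)).
  have nm : \forall m' \near m, W (L (f m')) by exact: (cvg_comp _ _ (cf m) cL _ nW).
  have [[a0 Wa]|no] := pselect (exists a, W (actX a x)).
    exists ([set m' | W (L (f m'))], [set M | h a0 < M]) => /=.
      by split => //; exact: nbhs_pinfty_gt (num_real (h a0)).
    move=> [m' M] /= [Wm hM] a E.
    have e : a = a0 by apply: (inj x) => //; rewrite E.
    by rewrite e.
  exists ([set m' | W (L (f m'))], setT) => /=; first by split => //; exact: filterT.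
  by move=> [m' M] /= [Wm _] a E; case: no; exists a; rewrite E.
exact: H.
Qed.

(* Otherwise the geodesic would cross infinitely many translates of one compact set, against
   the proper discontinuity of the deck action. *)
Lemma endpt_tame o v : pd o -> endpt P L o v -> tame C v.
Proof.
move=> po [[pv tv vv] ov]; apply: contrapT => nt.
have [w0 cw0] := tame_pd C po.
pose o2 := act C w0 o; pose v2 := act C w0 v.
have po2 : pd o2 by exact: pd_act.
have pv2 : psd v2 by exact: psd_act.
have nt2 : ~ tame C v2 by move=> h; apply: nt; exact: tame_act h.
have [k k0 hk] := crossing_bil C.
(* It contains the sums of two trace-one forms of the cone whose pairing is at least [k], as
   produced by a crossing. *)
pose K : set V := [set m | (psd m /\ tr m = 2) /\ 2 * k <= bil m m].
have cK : compact K.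
  apply: (@rV_compact_sub _ _ _ 2).
    apply: closedI; first by apply: closedI; [exact: psd_closed|exact: (@closed_eqr R V (@tr R) 2 (@tr_cont R))].
    exact: (@closed_ge_fun R V (fun v => bil v v) (2 * k) (@bil_cont R)).
  by move=> m [[h1 <-] _]; exact: psd_norm.
have pK m : K m -> pd m.
  move=> [[h1 h2] h3]; have b0 : 0 < bil m m by apply: lt_le_trans h3; rewrite mulr_gt0.
  have [p0 r0 _] := h1; split => //; rewrite lt_def ?p0 ?r0 andbT; apply/eqP => z;
    move: b0; rewrite /bil z ?mul0r ?mulr0; have := sqr_ge0 (cs m); have := sqr_ge0 (ct m); lra.
have B (c : bool * bool) : \forall M \near (+oo : set_system R), forall m, K m -> forall a,
    actX a (L o) = L (act C (tree g c) m) -> tr (act C (rev (tree g c)) (gact C a o)) < M.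
  apply: (@translate_bounded (act C (tree g c)) (fun a : G => tr (act C (rev (tree g c)) (gact C a o)))) => //.
    by move=> m /pK; exact: pd_act.
  exact: act_cont.
have [M HM] := filter_ex (@filter_forall R (bool * bool)%type (fun c M => forall m, K m -> forall a,
    actX a (L o) = L (act C (tree g c) m) -> tr (act C (rev (tree g c)) (gact C a o)) < M)
    (pinfty_nbhs R) _ B).
have [w [cr Mw]] := untame_crossing_unbounded M po2 pv2 cw0 nt2.
have hb := hk _ _ _ (pd_psd po2) pv2 cr.
set W := w ++ w0.
have aE : act C w o2 = act C W o by rewrite /W act_cat.
have bE : act C w v2 = act C W v by rewrite /W act_cat.
rewrite aE bE in hb; rewrite aE in Mw.
set a := act C W o in hb Mw; set b := act C W v in hb.
have ta : 0 < tr a by apply: pd_tr; exact: pd_act.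
have pa : psd a by exact/pd_psd/pd_act.
have pb : psd b by exact: psd_act.
have tb : 0 < tr b by apply: psd_tr_gt0 => //; apply: act_neq0; exact: tr1_neq0.
(* Combining [o] with the endpoint [v] of its geodesic, [m] lies on that geodesic, so [L m = L o];
   and [act C W m] is in the compact set. *)
pose m := (tr a)^-1 *: o + (tr b)^-1 *: v.
have mE : act C W m = (tr a)^-1 *: a + (tr b)^-1 *: b by rewrite actD !actZ.
have Km : K (act C W m).
  rewrite mE; split; first split.
  - by apply: psdD; apply: psdZ => //; rewrite invr_ge0 ltW.
  - by rewrite trD !trZ !mulVf ?gt_eqF //; ring.
  - have haa : 0 <= bil a a by case: pa.
    have hbb : 0 <= bil b b by case: pb.
    have -> : bil ((tr a)^-1 *: a + (tr b)^-1 *: b) ((tr a)^-1 *: a + (tr b)^-1 *: b) =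
       (tr a)^-1 ^+ 2 * bil a a + (tr b)^-1 ^+ 2 * bil b b + 2 * (bil a b / (tr a * tr b)).
      by rewrite !(bilDl, bilDr, bilZl, bilZr) (bilC b a); field; rewrite !gt_eqF.
    have h1 : k <= bil a b / (tr a * tr b) by rewrite ler_pdivlMr // mulr_gt0.
    have h2 : 0 <= (tr a)^-1 ^+ 2 * bil a a by rewrite mulr_ge0 ?sqr_ge0.
    have h3 : 0 <= (tr b)^-1 ^+ 2 * bil b b by rewrite mulr_ge0 ?sqr_ge0.
    lra.
(* Starting from this coset, [W] ends at the trivial one, where the tree word is empty; so [psi c W]
   acts as [W] followed by the tree word of [c]. *)
pose c := stepw (false, false) (rev W).
pose gm := psi c W.
have gE x : gact C gm x = act C (tree g c) (act C W x).
  by rewrite /gm (psi_word hC) /c stepw_rev /= cats0 act_cat.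
have pm : pd m by have := pK _ Km => /(pd_act C (rev W)); rewrite act_revK.
have Lo : orthv o (P (L o)) by apply/(hL po).2.
have Lm : L o = L m.
  apply/(hL pm).2 => q qP; rewrite /m pairDl !pairZl (Lo q qP) (ov q qP); ring.
have E : actX gm (L o) = L (act C (tree g c) (act C W m)).
  have pgm : pd (gact C gm m) by rewrite gE; do 2!apply: pd_act.
  rewrite -gE; apply/(hL pgm).2; apply: eqv; rewrite Lm; exact/(hL pm).2.
have := HM c _ Km gm E; rewrite gE act_revK -/a ltNge.
by rewrite Mw.
Qed.

End Tame.

(** * The spiral necklace *)

Section Corners.
Local Open Scope nat_scope.

(* The cells of the band are squares of side 4; its corners are listed along its
   boundary curve, in coordinates shifted by (30, 14) so as to be natural numbers. *)
Definition corners : seq (nat * nat) := [::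
  (0, 8); (4, 8); (8, 8); (12, 8); (16, 8); (20, 8); (20, 12); (16, 12); (12, 12);
  (8, 12); (4, 12); (4, 16); (4, 20); (4, 24); (8, 24); (12, 24); (16, 24); (20, 24);
  (24, 24); (28, 24); (32, 24); (36, 24); (40, 24); (44, 24); (48, 24); (52, 24);
  (56, 24); (56, 20); (56, 16); (56, 12); (56, 8); (56, 4); (52, 4); (48, 4); (44, 4);
  (40, 4); (36, 4); (32, 4); (28, 4); (28, 8); (28, 12); (28, 16); (28, 20); (24, 20);
  (20, 20); (16, 20); (12, 20); (8, 20); (8, 16); (12, 16); (16, 16); (20, 16); (24, 16);
  (24, 12); (24, 8); (24, 4); (24, 0); (28, 0); (32, 0); (36, 0); (40, 0); (44, 0);
  (48, 0); (52, 0); (56, 0); (60, 0); (60, 4); (60, 8); (60, 12); (60, 16); (60, 20);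
  (60, 24); (60, 28); (56, 28); (52, 28); (48, 28); (44, 28); (40, 28); (36, 28);
  (32, 28); (28, 28); (24, 28); (20, 28); (16, 28); (12, 28); (8, 28); (4, 28); (0, 28);
  (0, 24); (0, 20); (0, 16); (0, 12)
].

(* Corners carry the circles x_i, edge midpoints the circles y_i. *)
Definition center (t : bool) (i : nat) : nat * nat :=
  let a := nth (0, 0) corners i in
  if t then let b := nth (0, 0) corners (i.+1 %% 92) in ((a.1 + b.1)./2, (a.2 + b.2)./2)
  else a.

Definition centers : seq (bool * nat * (nat * nat)) :=
  [seq (t, i, center t i) | t <- [:: false; true], i <- iota 0 92].

Lemma mem_centers t i : i < 92 -> (t, i, center t i) \in centers.
Proof. by move=> h; apply/allpairsP; exists (t, i); split => //; [case: t|rewrite mem_iota]. Qed.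

Definition consecutive (p q : bool * nat) : bool :=
  let xy i j := [|| i == j, i == j.+1 | (i == 0) && (j == 91)] in
  if p.1 then ~~ q.1 && xy q.2 p.2 else q.1 && xy p.2 q.2.

Definition apart (k a b : nat) : bool := (a + k <= b) || (b + k <= a).

(** A distance of 4 separates any two discs, as 2 sqrt(3) < 4. Two midpoint discs have radius 1 and
    may also be apart by 2 in both coordinates. *)
Definition far_ok : bool := all (fun p => all (fun q =>
  [|| p.1 == q.1, consecutive p.1 q.1, apart 4 p.2.1 q.2.1, apart 4 p.2.2 q.2.2 |
    [&& p.1.1, q.1.1, apart 2 p.2.1 q.2.1 & apart 2 p.2.2 q.2.2]]) centers) centers.

Definition next_ok : bool := all (fun p => all (fun q => consecutive p.1 q.1 ==>
  ((p.2.1 == q.2.1) && ((p.2.2 == q.2.2 + 2) || (q.2.2 == p.2.2 + 2)) ||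
   (p.2.2 == q.2.2) && ((p.2.1 == q.2.1 + 2) || (q.2.1 == p.2.1 + 2)))) centers) centers.

Lemma far_okP : far_ok. Proof. by vm_compute. Qed.
Lemma next_okP : next_ok. Proof. by vm_compute. Qed.

(* The band is the union of these rectangles [(x0, x1, y0, y1)], the neighbourhoods of
   the sides of the core polyline. *)
Definition band : seq (nat * nat * nat * nat) :=
  [:: (0, 20, 8, 12); (0, 4, 8, 28); (0, 60, 24, 28); (56, 60, 0, 28); (24, 60, 0, 4);
      (24, 28, 0, 20); (8, 28, 16, 20)].

Definition outside (b : nat * nat * nat * nat) (c : nat * nat) : bool :=
  let: (x0, x1, y0, y1) := b in [|| c.1 <= x0, x1 <= c.1, c.2 <= y0 | y1 <= c.2].

Definition disjoint_rect (b b' : nat * nat * nat * nat) : bool :=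
  let: (x0, x1, y0, y1) := b in let: (x0', x1', y0', y1') := b' in
  [|| x1 <= x0', x1' <= x0, y1 <= y0' | y1' <= y0].

Lemma core_okP : all (fun b => all (fun c => outside b c.2) centers) band.
Proof. by vm_compute. Qed.

(** The rectangle [-2, 26] x [-7, 7] in real coordinates. A margin of 2, more than the radii, leaves
    the room [0, 24] x [-5, 5] to the right of 0. *)
Definition free_rect := (28, 56, 7, 21).
Lemma free_okP : all (fun c => outside free_rect c.2) centers &&
  all (disjoint_rect (30, 54, 9, 19)) band.
Proof. by vm_compute. Qed.

Lemma origin_okP : all (fun c => outside (28, 32, 12, 16) c.2) centers &&
  all (disjoint_rect (29, 31, 13, 15)) band.
Proof. by vm_compute. Qed.

Lemma bounded_okP : all (fun c => (c.2.1 <= 60) && (c.2.2 <= 28)) centers &&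
  all (fun b => let: (x0, x1, y0, y1) := b in (x1 <= 60) && (y1 <= 28)) band.
Proof. by vm_compute. Qed.

Definition placed (t : bool) : seq (nat * nat) := [seq c.2 | c <- centers & c.1.1 == t].

Definition covers (b : nat * nat * nat * nat) (p q : nat * nat) : bool :=
  let: (x0, x1, y0, y1) := b in [&& x0 < p.1, q.1 < x1, y0 < p.2 & q.2 < y1].

Definition along (h : bool) (a b n : nat) : nat * nat := if h then (a + n, b) else (a, b + n).

(** An edge joins two corners at distance 4. Either it carries a midpoint circle, or it is interior
    to the band and its middle part lies in another rectangle. *)
Definition edge_ok (h : bool) (a b : nat) : bool :=
  [&& along h a b 0 \in placed false, along h a b 4 \in placed false &
    (along h a b 2 \in placed true) ||
    has (fun r => covers r (along h a b 1) (along h a b 3)) band].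

Definition sides_ok : bool := all (fun r => let: (x0, x1, y0, y1) := r in
  [&& (x0 <= x1) && (x1 == x0 + 4 * ((x1 - x0) %/ 4)), (y0 <= y1) && (y1 == y0 + 4 * ((y1 - y0) %/ 4)),
   all (fun k => edge_ok true (x0 + 4 * k) y0 && edge_ok true (x0 + 4 * k) y1) (iota 0 ((x1 - x0) %/ 4)) &
   all (fun k => edge_ok false x0 (y0 + 4 * k) && edge_ok false x1 (y0 + 4 * k)) (iota 0 ((y1 - y0) %/ 4))]) band.

Lemma sides_okP : sides_ok. Proof. by vm_compute. Qed.

End Corners.

(** * The spiral necklace over the reals *)

Section Spiral.
Variable R : realType.
Local Notation V := 'rV[R]_4.
Implicit Types (v : V).

Definition grid_x (n : nat) : R := n%:R - 30.
Definition grid_y (n : nat) : R := n%:R - 14.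

(** Consecutive centres are at distance 2, so the squared radii 3 and 1 make the circles orthogonal:
    3 + 1 = 2^2. *)
Definition spiral_circle (a : bead_letter 91) : circle R :=
  Circle (grid_x (center a.1 a.2).1) (grid_y (center a.1 a.2).2) (if a.1 then 1 else 3).

Lemma consecutiveE (a b : bead_letter 91) : consecutive (a.1, a.2 : nat) (b.1, b.2 : nat) = bead_next a b.
Proof. by case: a b => [[] i] [[] j]. Qed.

Lemma apart_sqr (k a b : nat) : apart k a b -> k%:R ^+ 2 <= (a%:R - b%:R : R) ^+ 2.
Proof.
have sq (z : R) : k%:R <= z -> k%:R ^+ 2 <= z ^+ 2.
  by have := ler0n R k => k0 kz; rewrite ler_sqr ?nnegrE //; lra.
rewrite /apart => /orP[]; rewrite -(ler_nat R) natrD => h.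
  have := sq (- (a%:R - b%:R)); rewrite sqrrN; apply; lra.
apply: sq; lra.
Qed.

Let memc (a : bead_letter 91) : (a.1, a.2 : nat, center a.1 a.2) \in centers.
Proof. exact/mem_centers/ltn_ord. Qed.

Lemma csq_spiral a : 0 < csq (spiral_circle a) <= 3.
Proof. by rewrite /=; case: (a.1); lra. Qed.

Lemma far_arith (D p q : R) : 0 < p -> p <= 3 -> 0 < q -> q <= 3 ->
  16 <= D \/ [/\ p = 1, q = 1 & 8 <= D] -> 0 < D - p - q /\ 4 * p * q < (D - p - q) ^+ 2.
Proof.
move=> p0 p3 q0 q3 [D16|[-> -> D8]].
  split; first by lra.
  have h1 : p * q <= 3 * 3 by apply: ler_pM => //; lra.
  have h2 : 10 ^+ 2 <= (D - p - q) ^+ 2 by rewrite ler_sqr ?nnegrE; lra.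
  by apply: lt_le_trans h2; rewrite -mulrA; lra.
split; first by lra.
have h2 : 6 ^+ 2 <= (D - 1 - 1) ^+ 2 by rewrite ler_sqr ?nnegrE; lra.
by apply: lt_le_trans h2; lra.
Qed.

Lemma spiral_far (a b : bead_letter 91) : a != b -> ~~ bead_next a b ->
  0 < bil (normal (spiral_circle a)) (normal (spiral_circle b)) /\
  4 * csq (spiral_circle a) * csq (spiral_circle b) < bil (normal (spiral_circle a)) (normal (spiral_circle b)) ^+ 2.
Proof.
move=> ab nab; have := allP (allP far_okP _ (memc a)) _ (memc b).
rewrite /= consecutiveE (negbTE nab) /= => h.
have ab' : ((a.1, a.2 : nat) == (b.1, b.2 : nat)) = false.
  apply: contraNF ab => /eqP [e1 e2]; apply/eqP.
  by case: a b e1 e2 {h nab} => [a1 a2] [b1 b2] /= -> /val_inj ->.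
rewrite ab' /= in h.
have [/andP[ra0 ra3] /andP[rb0 rb3]] := conj (csq_spiral a) (csq_spiral b).
have ra1 : a.1 -> csq (spiral_circle a) = 1 by rewrite /=; case: (a.1).
have rb1 : b.1 -> csq (spiral_circle b) = 1 by rewrite /=; case: (b.1).
pose D : R := ((center a.1 a.2).1%:R - (center b.1 b.2).1%:R) ^+ 2 +
  ((center a.1 a.2).2%:R - (center b.1 b.2).2%:R) ^+ 2.
have E : bil (normal (spiral_circle a)) (normal (spiral_circle b)) =
    D - csq (spiral_circle a) - csq (spiral_circle b).
  by rewrite bil_normal /D /spiral_circle /= /grid_x /grid_y; ring.
have big : 16 <= D \/ [/\ a.1, b.1 & 8 <= D].
  have s1 := sqr_ge0 ((center a.1 a.2).1%:R - (center b.1 b.2).1%:R : R).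
  have s2 := sqr_ge0 ((center a.1 a.2).2%:R - (center b.1 b.2).2%:R : R).
  move/or3P: h => [/apart_sqr h|/apart_sqr h|/and4P[ta tb /apart_sqr h /apart_sqr h']].
  - by left; rewrite /D; lra.
  - by left; rewrite /D; lra.
  - by right; split => //; rewrite /D; lra.
rewrite E; apply: far_arith => //.
by case: big => [|[/ra1 -> /rb1 ->]]; [left|right].
Qed.

Lemma spiral_orth (a b : bead_letter 91) : bead_next a b ->
  bil (normal (spiral_circle a)) (normal (spiral_circle b)) = 0.
Proof.
move=> nab; have := allP (allP next_okP _ (memc a)) _ (memc b).
rewrite /= consecutiveE nab /= => h; rewrite bil_normal /=.
have XB n m : grid_x n - grid_x m = n%:R - m%:R by rewrite /grid_x; lra.
have YB n m : grid_y n - grid_y m = n%:R - m%:R by rewrite /grid_y; lra.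
rewrite !XB !YB; move: (center a.1 a.2) (center b.1 b.2) h => [a1 a2] [b1 b2] /= h.
have ty : a.1 = ~~ b.1 by move: nab; rewrite /bead_next; case: (a.1); case: (b.1).
rewrite ty; move/orP: h => [/andP[/eqP -> /orP[]/eqP ->]|/andP[/eqP -> /orP[]/eqP ->]];
  rewrite natrD; case: (b.1) => /=; ring.
Qed.

(** Up to scale, the point at height sqrt(e) above 0. *)
Definition axis (e : R) : V := vec e 1 0 0.

Lemma pd_axis e : 0 < e -> pd (axis e).
Proof. by move=> e0; split; rewrite /axis ?vecE // /bil !vecE; lra. Qed.

Lemma axis_out a : power (spiral_circle a) (axis 4) < 0.
Proof.
have /andP[_ h] := csq_spiral a; rewrite powerE /axis !vecE.
have := sqr_ge0 (ccx (spiral_circle a)); have := sqr_ge0 (ccy (spiral_circle a)); lra.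
Qed.

Lemma bead_next_sym : symmetric (@bead_next 91).
Proof. by case=> [[] i] [[] j]. Qed.
Lemma bead_next_irr : irreflexive (@bead_next 91).
Proof. by case=> [[] i]. Qed.
Lemma bead_next_trig (i j k : bead_letter 91) : bead_next i j -> bead_next j k -> ~~ bead_next i k.
Proof. by case: i j k => [[] i] [[] j] [[] k]. Qed.

Definition spiral : necklace R (bead_letter 91) :=
  Necklace (fun a => proj1 (andP (csq_spiral a))) bead_next_sym bead_next_irr bead_next_trig
    spiral_orth spiral_far (pd_axis (ltr0Sn R 3)) axis_out.

Definition clear (x y : R) := forall a : bead_letter 91,
  csq (spiral_circle a) <= (x - ccx (spiral_circle a)) ^+ 2 + (y - ccy (spiral_circle a)) ^+ 2.

Definition in_rect (b : nat * nat * nat * nat) (x y : R) :=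
  let: (x0, x1, y0, y1) := b in grid_x x0 < x /\ x < grid_x x1 /\ grid_y y0 < y /\ y < grid_y y1.
Definition in_rect_closed (b : nat * nat * nat * nat) (x y : R) :=
  let: (x0, x1, y0, y1) := b in grid_x x0 <= x /\ x <= grid_x x1 /\ grid_y y0 <= y /\ y <= grid_y y1.
Definition in_band (x y : R) := exists2 b, b \in band & in_rect b x y.

Lemma outside_dist (m : R) x0 x1 y0 y1 c (x y : R) : 0 <= m -> outside (x0, x1, y0, y1) c ->
  grid_x x0 + m <= x -> x <= grid_x x1 - m -> grid_y y0 + m <= y -> y <= grid_y y1 - m ->
  m ^+ 2 <= (x - grid_x c.1) ^+ 2 + (y - grid_y c.2) ^+ 2.
Proof.
move=> m0 ho h1 h2 h3 h4.
have s1 := sqr_ge0 (x - grid_x c.1); have s2 := sqr_ge0 (y - grid_y c.2).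
have sq (z : R) : m <= z -> m ^+ 2 <= z ^+ 2 by move=> mz; rewrite ler_sqr ?nnegrE //; lra.
case/or4P: ho; rewrite -(ler_nat R) => h.
- by have := sq (x - grid_x c.1); rewrite /grid_x in h1 *; lra.
- by have := sq (- (x - grid_x c.1)); rewrite sqrrN; rewrite /grid_x in h2 *; lra.
- by have := sq (y - grid_y c.2); rewrite /grid_y in h3 *; lra.
- by have := sq (- (y - grid_y c.2)); rewrite sqrrN; rewrite /grid_y in h4 *; lra.
Qed.

Lemma clear_outside (m : R) x0 x1 y0 y1 (x y : R) : 0 <= m -> 3 <= m ^+ 2 ->
  all (fun c => outside (x0, x1, y0, y1) c.2) centers ->
  grid_x x0 + m <= x -> x <= grid_x x1 - m -> grid_y y0 + m <= y -> y <= grid_y y1 - m -> clear x y.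
Proof.
move=> m0 m3 ho h1 h2 h3 h4 a; have /andP[_ h] := csq_spiral a.
apply: le_trans h _; apply: le_trans m3 _.
by apply: (outside_dist m0 _ h1 h2 h3 h4); exact: (allP ho _ (memc a)).
Qed.

Lemma not_in_band x0 x1 y0 y1 (x y : R) : all (disjoint_rect (x0, x1, y0, y1)) band ->
  grid_x x0 <= x -> x <= grid_x x1 -> grid_y y0 <= y -> y <= grid_y y1 -> ~ in_band x y.
Proof.
move=> dj h1 h2 h3 h4 [b /(allP dj)]; case: b => [[[a0 a1] b0] b1] /=.
case/or4P; rewrite -(ler_nat R) => h [g1 [g2 [g3 g4]]].
- by rewrite /grid_x in h2 g1; lra.
- by rewrite /grid_x in h1 g2; lra.
- by rewrite /grid_y in h4 g3; lra.
- by rewrite /grid_y in h3 g4; lra.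
Qed.

Lemma free_right (x y : R) : 0 <= x <= 24 -> -5 <= y <= 5 -> clear x y /\ ~ in_band x y.
Proof.
move=> /andP[h1 h2] /andP[h3 h4]; have /andP[f1 f2] := free_okP; split.
  by apply: (@clear_outside 2 _ _ _ _ _ _ _ _ f1); rewrite /grid_x /grid_y; lra.
by apply: (not_in_band f2); rewrite /grid_x /grid_y; lra.
Qed.

Lemma free_origin (x y : R) : - (1 / 5) <= x <= 1 / 5 -> - (1 / 5) <= y <= 1 / 5 -> clear x y /\ ~ in_band x y.
Proof.
move=> /andP[h1 h2] /andP[h3 h4]; have /andP[f1 f2] := origin_okP; split.
  (* The centres keep a distance of 2 from 0 in one coordinate, and (9 / 5)^2 still exceeds the
     squared radius 3; this leaves 1 / 5. *)
  by apply: (@clear_outside (9 / 5) _ _ _ _ _ _ _ _ f1); rewrite /grid_x /grid_y; lra.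
by apply: (not_in_band f2); rewrite /grid_x /grid_y; lra.
Qed.

Lemma free_out (x y : R) : ~ (- 33 < x < 33 /\ - 17 < y < 17) -> clear x y /\ ~ in_band x y.
Proof.
move=> far; have /andP[f1 f2] := bounded_okP; split.
  move=> a; have /andP[_ h] := csq_spiral a; apply: le_trans h _.
  have /andP[] := allP f1 _ (memc a); rewrite -2!(ler_nat R) /=.
  have := ler0n R (center a.1 a.2).1; have := ler0n R (center a.1 a.2).2.
  move: (center a.1 a.2) => [c d] /= d0 c0 c60 d28; rewrite /grid_x /grid_y.
  have s1 := sqr_ge0 (x - (c%:R - 30)); have s2 := sqr_ge0 (y - (d%:R - 14)).
  have sq (z : R) : 3 <= z -> 3 <= z ^+ 2 by move=> z3; nra.
  have [x1|x1] := leP x (- 33); first by have := sq (- (x - (c%:R - 30))); rewrite sqrrN; lra.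
  have [x2|x2] := leP 33 x; first by have := sq (x - (c%:R - 30)); lra.
  have [y1|y1] := leP y (- 17); first by have := sq (- (y - (d%:R - 14))); rewrite sqrrN; lra.
  have [y2|y2] := leP 17 y; first by have := sq (y - (d%:R - 14)); lra.
  by case: far; split; apply/andP.
move=> [b /(allP f2)]; case: b => [[[a0 a1] b0] b1] /andP[].
have := ler0n R a0; have := ler0n R b0; rewrite -!(ler_nat R) /= => u1 u2 u3 u4 [g1 [g2 [g3 g4]]].
by apply: far; rewrite /grid_x /grid_y in g1 g2 g3 g4; split; apply/andP; split; lra.
Qed.

Lemma core_band x0 x1 y0 y1 (x y : R) : (x0, x1, y0, y1) \in band ->
  grid_x x0 + 2 <= x -> x <= grid_x x1 - 2 -> grid_y y0 + 2 <= y -> y <= grid_y y1 - 2 -> clear x y /\ in_band x y.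
Proof.
move=> hb h1 h2 h3 h4; split.
  by apply: (@clear_outside 2 _ _ _ _ _ _ _ _ (allP core_okP _ hb)) => //; lra.
by exists (x0, x1, y0, y1) => //=; do !split; lra.
Qed.

Lemma unit_interval (m : nat) (a x : R) : (0 < m)%N -> a <= x -> x <= a + 4 * m%:R ->
  exists2 k, (k < m)%N & a + 4 * k%:R <= x <= a + 4 * k%:R + 4.
Proof.
elim: m => // m IH _ h1 h2.
have [h|h] := leP x (a + 4 * m%:R).
  case: m IH h2 h => [|m] IH h2 h; first by exists 0%N => //; rewrite mulr0 in h *; lra.
  by have [k km hk] := IH isT h1 h; exists k => //; rewrite ltnS ltnW.
by exists m => //; move: h2; rewrite -natr1; lra.
Qed.

Lemma clear_placed t p (x y : R) : clear x y -> p \in placed t ->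
  (if t then 1 else 3) <= (x - grid_x p.1) ^+ 2 + (y - grid_y p.2) ^+ 2.
Proof.
move=> cl; rewrite /placed => /mapP [[[t' i] c]]; rewrite mem_filter => /andP[/eqP tt'].
rewrite /centers => /allpairsP [[t2 i2] [_ + [E1 E2 E3]]]; rewrite mem_iota add0n => /andP[_ i92] ->.
have /= E1' : t' = t2 := E1; have := cl (t2, Ordinal i92); rewrite E3 /= -E1'.
by move: tt' => /= ->.
Qed.

(* A boundary edge of the band is covered by the discs at its ends and at its middle. *)
Lemma edge_in_band (h : bool) (a b : nat) (x y : R) : edge_ok h a b -> clear x y ->
  (if h then grid_x a <= x <= grid_x a + 4 /\ y = grid_y b else grid_y b <= y <= grid_y b + 4 /\ x = grid_x a) -> in_band x y.
Proof.
rewrite /edge_ok => /and3P[p0 p4 p2] cl.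
have c0 : 3 <= (x - grid_x (along h a b 0).1) ^+ 2 + (y - grid_y (along h a b 0).2) ^+ 2 := clear_placed cl p0.
have c4 : 3 <= (x - grid_x (along h a b 4).1) ^+ 2 + (y - grid_y (along h a b 4).2) ^+ 2 := clear_placed cl p4.
have c2 : (1 <= (x - grid_x (along h a b 2).1) ^+ 2 + (y - grid_y (along h a b 2).2) ^+ 2) \/
   has (fun r => covers r (along h a b 1) (along h a b 3)) band.
  by case/orP: p2 => [h2|]; [left; exact: (clear_placed cl h2)|right].
case: h c0 c4 c2 {p0 p4 p2} => c0 c4 c2 [/andP[k1 k2] k3].
  have {}c0 : 3 <= (x - (a%:R - 30)) ^+ 2.
    by move: c0; rewrite k3 /along /grid_x !natrD subrr expr0n /= !addr0.
  have {}c4 : 3 <= (x - (a%:R - 30) - 4) ^+ 2.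
    move: c4; rewrite k3 /along /grid_x !natrD subrr expr0n /= !addr0; congr (_ <= _ ^+ 2); ring.
  rewrite /grid_x in k1 k2.
  (* As 3 / 2 < sqrt(3), the discs at the ends leave only the part between 3 / 2 and 5 / 2. *)
  have l1 : 3 / 2 < x - (a%:R - 30) by rewrite ltNge; apply/negP => n; nra.
  have l2 : x - (a%:R - 30) < 5 / 2 by rewrite ltNge; apply/negP => n; nra.
  case: c2 => [c2|/hasP [[[[x0 x1] y0] y1] hb /and4P[]]].
    have {}c2 : 1 <= (x - (a%:R - 30) - 2) ^+ 2.
      move: c2; rewrite k3 /along /grid_x !natrD subrr expr0n /= !addr0; congr (_ <= _ ^+ 2); ring.
    by nra.
  rewrite -!(ltr_nat R) /along !natrD => q1 q2 q3 q4.
  by exists (x0, x1, y0, y1) => //=; rewrite k3 /grid_x /grid_y; do !split; lra.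
have {}c0 : 3 <= (y - (b%:R - 14)) ^+ 2.
  by move: c0; rewrite k3 /along /grid_y !natrD subrr expr0n /= !addr0 add0r.
have {}c4 : 3 <= (y - (b%:R - 14) - 4) ^+ 2.
  move: c4; rewrite k3 /along /grid_y !natrD subrr expr0n /= add0r; congr (_ <= _ ^+ 2); ring.
rewrite /grid_y in k1 k2.
have l1 : 3 / 2 < y - (b%:R - 14) by rewrite ltNge; apply/negP => n; nra.
have l2 : y - (b%:R - 14) < 5 / 2 by rewrite ltNge; apply/negP => n; nra.
case: c2 => [c2|/hasP [[[[x0 x1] y0] y1] hb /and4P[]]].
  have {}c2 : 1 <= (y - (b%:R - 14) - 2) ^+ 2.
    move: c2; rewrite k3 /along /grid_y !natrD subrr expr0n /= add0r; congr (_ <= _ ^+ 2); ring.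
  by nra.
rewrite -!(ltr_nat R) /along !natrD => q1 q2 q3 q4.
by exists (x0, x1, y0, y1) => //=; rewrite k3 /grid_x /grid_y; do !split; lra.
Qed.

Lemma side_in_band (h : bool) (m a b : nat) (x y : R) :
  (forall k, (k < m)%N -> if h then edge_ok true (a + 4 * k) b else edge_ok false b (a + 4 * k)) ->
  clear x y -> (0 < m)%N ->
  (if h then grid_x a <= x <= grid_x (a + 4 * m) /\ y = grid_y b else grid_y a <= y <= grid_y (a + 4 * m) /\ x = grid_x b) ->
  in_band x y.
Proof.
case: h => hk cl m0 [/andP[h1 h2] h3].
  have [|k km /andP[k1 k2]] := @unit_interval m (grid_x a) x m0 h1.
    by move: h2; rewrite /grid_x natrD natrM; lra.
  by apply: (edge_in_band (hk k km) cl); split => //; rewrite /grid_x natrD natrM in k1 k2 *; apply/andP; split; lra.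
have [|k km /andP[k1 k2]] := @unit_interval m (grid_y a) y m0 h1.
  by move: h2; rewrite /grid_y natrD natrM; lra.
by apply: (edge_in_band (hk k km) cl); split => //; rewrite /grid_y natrD natrM in k1 k2 *; apply/andP; split; lra.
Qed.

(** Outside the discs the band is relatively closed as well as open, since the discs cover its
    boundary; this is what separates the two sides of the necklace. *)
Lemma closed_in_band b (x y : R) : b \in band -> clear x y -> in_rect_closed b x y -> in_band x y.
Proof.
move=> hb cl; have := allP sides_okP _ hb.
case: b hb => [[[x0 x1] y0] y1] hb; cbv beta iota => /and4P[/andP[_ /eqP ex] /andP[_ /eqP ey] /allP okx /allP oky].
move: ex ey okx oky; set m := (_ %/ 4)%N; set n := ((y1 - y0) %/ 4)%N => ex ey okx oky.
move=> [g1 [g2 [g3 g4]]].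
have okx' k : (k < m)%N -> edge_ok true (x0 + 4 * k) y0 && edge_ok true (x0 + 4 * k) y1.
  by move=> km; apply: okx; rewrite mem_iota.
have oky' k : (k < n)%N -> edge_ok false x0 (y0 + 4 * k) && edge_ok false x1 (y0 + 4 * k).
  by move=> kn; apply: oky; rewrite mem_iota.
have [mn0 n0] : (0 < m)%N /\ (0 < n)%N.
  move: hb ex ey; rewrite /m /n !inE.
  by do ![case/orP] => [||||||]; move=> /eqP [-> -> -> ->].
have side h a b c := @side_in_band h c a b x y.
have [e1|n1] := eqVneq y (grid_y y0).
  apply: (side true x0 y0 m) => //; first by move=> k /okx' /andP[].
  by split => //; rewrite -ex g1.
have [e2|n2] := eqVneq y (grid_y y1).
  apply: (side true x0 y1 m) => //; first by move=> k /okx' /andP[].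
  by split => //; rewrite -ex g1.
have [e3|n3] := eqVneq x (grid_x x0).
  apply: (side false y0 x0 n) => //; first by move=> k /oky' /andP[].
  by split => //; rewrite -ey g3.
have [e4|n4] := eqVneq x (grid_x x1).
  apply: (side false y0 x1 n) => //; first by move=> k /oky' /andP[].
  by split => //; rewrite -ey g3.
exists (x0, x1, y0, y1) => //=; rewrite !lt_neqAle g1 g2 g3 g4 n2 n4.
by rewrite [grid_x x0 == _]eq_sym n3 [grid_y y0 == _]eq_sym n1.
Qed.

End Spiral.

(** * The planar obstruction *)

Section Planar.
Variable R : realType.
Implicit Types (x y : R).

Definition orect (a b c d x y : R) := a < x /\ x < b /\ c < y /\ y < d.
Definition crect (a b c d x y : R) := a <= x /\ x <= b /\ c <= y /\ y <= d.

(* Off the core polyline, [room] can only be left through the [gate] and [hall] only through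
   the [door]; the primed versions are their closures. *)
Definition room x y := [\/ orect (-28) (-20) (-4) 12 x y, orect (-28) 28 4 12 x y |
  orect (-4) 28 (-12) 12 x y].
Definition room' x y := [\/ crect (-28) (-20) (-4) 12 x y, crect (-28) 28 4 12 x y |
  crect (-4) 28 (-12) 12 x y].
Definition hall x y := orect (-28) 28 (-4) 12 x y \/ orect (-4) 28 (-12) 12 x y.
Definition hall' x y := crect (-28) 28 (-4) 12 x y \/ crect (-4) 28 (-12) 12 x y.
Definition gate x y := [/\ x = -20, -4 <= y & y <= 4].
Definition door x y := [/\ y = -4, -12 <= x & x <= -4].

(** The core polyline has the vertices (-12, -4), (-28, -4), (-28, 12), (28, 12), (28, -12), (-4,
    -12), (-4, 4), (-20, 4). *)
Definition off_core x y :=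
  [/\ ~ (-28 <= x /\ x <= -12 /\ y = -4), ~ (-4 <= y /\ y <= 12 /\ x = -28),
      ~ (-28 <= x /\ x <= 28 /\ y = 12), ~ (-12 <= y /\ y <= 12 /\ x = 28) &
   [/\ ~ (-4 <= x /\ x <= 28 /\ y = -12), ~ (-12 <= y /\ y <= 4 /\ x = -4) &
       ~ (-20 <= x /\ x <= -4 /\ y = 4)]].

Lemma avoid_core x y : ~ (clear x y /\ in_band x y) -> off_core x y.
Proof.
move=> h.
have H (x0 x1 y0 y1 : nat) : (x0, x1, y0, y1) \in band -> grid_x R x0 + 2 <= x /\ x <= grid_x R x1 - 2 /\ grid_y R y0 + 2 <= y /\ y <= grid_y R y1 - 2 -> False.
  by move=> hb [h1 [h2 [h3 h4]]]; apply: h; exact: (core_band hb).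
clear h; split; [| | | |split] => -[g1 [g2 g3]].
- by apply: (H 0%N 20%N 8%N 12%N isT); rewrite /grid_x /grid_y; clear H; do !split; lra.
- by apply: (H 0%N 4%N 8%N 28%N isT); rewrite /grid_x /grid_y; clear H; do !split; lra.
- by apply: (H 0%N 60%N 24%N 28%N isT); rewrite /grid_x /grid_y; clear H; do !split; lra.
- by apply: (H 56%N 60%N 0%N 28%N isT); rewrite /grid_x /grid_y; clear H; do !split; lra.
- by apply: (H 24%N 60%N 0%N 4%N isT); rewrite /grid_x /grid_y; clear H; do !split; lra.
- by apply: (H 24%N 28%N 0%N 20%N isT); rewrite /grid_x /grid_y; clear H; do !split; lra.
- by apply: (H 8%N 28%N 16%N 20%N isT); rewrite /grid_x /grid_y; clear H; do !split; lra.
Qed.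

Section OffCore.
Variables (x y : R).
Hypothesis oc : off_core x y.
Lemma off1 : -28 <= x -> x <= -12 -> y = -4 -> False. Proof. by case: oc => h _ _ _ _ *; apply: h. Qed.
Lemma off2 : -4 <= y -> y <= 12 -> x = -28 -> False. Proof. by case: oc => _ h _ _ _ *; apply: h. Qed.
Lemma off3 : -28 <= x -> x <= 28 -> y = 12 -> False. Proof. by case: oc => _ _ h _ _ *; apply: h. Qed.
Lemma off4 : -12 <= y -> y <= 12 -> x = 28 -> False. Proof. by case: oc => _ _ _ h _ *; apply: h. Qed.
Lemma off5 : -4 <= x -> x <= 28 -> y = -12 -> False. Proof. by case: oc => _ _ _ _ [h _ _] *; apply: h. Qed.
Lemma off6 : -12 <= y -> y <= 4 -> x = -4 -> False. Proof. by case: oc => _ _ _ _ [_ h _] *; apply: h. Qed.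
Lemma off7 : -20 <= x -> x <= -4 -> y = 4 -> False. Proof. by case: oc => _ _ _ _ [_ _ h] *; apply: h. Qed.
End OffCore.

Lemma room_closed x y : off_core x y -> ~ gate x y -> room' x y -> room x y.
Proof.
move=> oc ng [] [h1 [h2 [h3 h4]]].
- have [a|a] := leP x (-28); first by exfalso; apply: (off2 oc); lra.
  have [b|b] := leP y (-4); first by exfalso; apply: (off1 oc); lra.
  have [c|c] := leP 12 y; first by exfalso; apply: (off3 oc); lra.
  have [d|d] := ltP x (-20); first by apply: Or31; do !split; lra.
  have [e|e] := leP y 4; first by case: ng; split; lra.
  by apply: Or32; do !split; lra.
- have [a|a] := leP x (-28); first by exfalso; apply: (off2 oc); lra.
  have [b|b] := leP 28 x; first by exfalso; apply: (off4 oc); lra.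
  have [c|c] := leP 12 y; first by exfalso; apply: (off3 oc); lra.
  have [d|d] := ltP 4 y; first by apply: Or32; do !split; lra.
  have [e|e] := ltP x (-20); first by apply: Or31; do !split; lra.
  have [f|f] := leP x (-4); first by exfalso; apply: (off7 oc); lra.
  by apply: Or33; do !split; lra.
- have [b|b] := leP 28 x; first by exfalso; apply: (off4 oc); lra.
  have [c|c] := leP 12 y; first by exfalso; apply: (off3 oc); lra.
  have [d|d] := leP y (-12); first by exfalso; apply: (off5 oc); lra.
  have [e|e] := ltP (-4) x; first by apply: Or33; do !split; lra.
  have [f|f] := leP y 4; first by exfalso; apply: (off6 oc); lra.
  by apply: Or32; do !split; lra.
Qed.

Lemma hall_closed x y : off_core x y -> ~ door x y -> hall' x y -> hall x y.
Proof.
move=> oc ng [] [h1 [h2 [h3 h4]]].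
- have [a|a] := leP x (-28); first by exfalso; apply: (off2 oc); lra.
  have [b|b] := leP 28 x; first by exfalso; apply: (off4 oc); lra.
  have [c|c] := leP 12 y; first by exfalso; apply: (off3 oc); lra.
  have [d|d] := ltP (-4) y; first by left; do !split; lra.
  have [e|e] := leP x (-12); first by exfalso; apply: (off1 oc); lra.
  have [f|f] := leP x (-4); first by case: ng; split; lra.
  by right; do !split; lra.
- have [b|b] := leP 28 x; first by exfalso; apply: (off4 oc); lra.
  have [c|c] := leP 12 y; first by exfalso; apply: (off3 oc); lra.
  have [d|d] := leP y (-12); first by exfalso; apply: (off5 oc); lra.
  have [e|e] := ltP (-4) x; first by right; do !split; lra.
  have [f|f] := leP y 4; first by exfalso; apply: (off6 oc); lra.
  by left; do !split; lra.
Qed.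

Section Near.
Variables (T : topologicalType) (x y : T -> R) (t : T).
Hypotheses (cx : x @ nbhs t --> x t) (cy : y @ nbhs t --> y t).

Lemma near_orect a b c d : orect a b c d (x t) (y t) -> \forall s \near t, orect a b c d (x s) (y s).
Proof.
move=> [h1 [h2 [h3 h4]]].
have n1 := cvgr_gt _ cx _ h1; have n2 := cvgr_lt _ cx _ h2.
have n3 := cvgr_gt _ cy _ h3; have n4 := cvgr_lt _ cy _ h4.
near=> s; split; first by near: s; exact: n1.
split; first by near: s; exact: n2.
by split; near: s; [exact: n3|exact: n4].
Unshelve. all: by end_near. Qed.

Lemma near_crect a b c d : ~ crect a b c d (x t) (y t) -> \forall s \near t, ~ crect a b c d (x s) (y s).
Proof.
move=> h.
have [h1|h1] := ltP (x t) a.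
  have n := cvgr_lt _ cx _ h1; near=> s => -[g _].
  have : x s < a by near: s; exact: n.
  by rewrite ltNge g.
have [h2|h2] := ltP b (x t).
  have n := cvgr_gt _ cx _ h2; near=> s => -[_ [g _]].
  have : b < x s by near: s; exact: n.
  by rewrite ltNge g.
have [h3|h3] := ltP (y t) c.
  have n := cvgr_lt _ cy _ h3; near=> s => -[_ [_ [g _]]].
  have : y s < c by near: s; exact: n.
  by rewrite ltNge g.
have [h4|h4] := ltP d (y t).
  have n := cvgr_gt _ cy _ h4; near=> s => -[_ [_ [_ g]]].
  have : d < y s by near: s; exact: n.
  by rewrite ltNge g.
by case: h.
Unshelve. all: by end_near. Qed.

Lemma orect_crect a b c d u v : orect a b c d u v -> crect a b c d u v.
Proof. by move=> [h1 [h2 [h3 h4]]]; do !split; exact: ltW. Qed.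

Lemma room_const : off_core (x t) (y t) -> ~ gate (x t) (y t) ->
  \forall s \near t, room (x s) (y s) <-> room (x t) (y t).
Proof.
move=> oc ng; have [A|nA] := pselect (room (x t) (y t)).
  have : \forall s \near t, room (x s) (y s).
    case: A => /near_orect n.
    - by near=> s; apply: Or31; near: s; exact: n.
    - by near=> s; apply: Or32; near: s; exact: n.
    - by near=> s; apply: Or33; near: s; exact: n.
  by move=> n; near=> s; split=> // _; near: s; exact: n.
have nA' : ~ room' (x t) (y t) by move=> /(room_closed oc ng).
have m1 := near_crect (fun h => nA' (Or31 _ _ h)).
have m2 := near_crect (fun h => nA' (Or32 _ _ h)).
have m3 := near_crect (fun h => nA' (Or33 _ _ h)).
near=> s; split; last by move=> /nA.
case=> /orect_crect h; exfalso; move: h.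
- by near: s; exact: m1.
- by near: s; exact: m2.
- by near: s; exact: m3.
Unshelve. all: by end_near. Qed.

Lemma hall_const : off_core (x t) (y t) -> ~ door (x t) (y t) ->
  \forall s \near t, hall (x s) (y s) <-> hall (x t) (y t).
Proof.
move=> oc ng; have [A|nA] := pselect (hall (x t) (y t)).
  have : \forall s \near t, hall (x s) (y s).
    case: A => /near_orect n.
    - by near=> s; left; near: s; exact: n.
    - by near=> s; right; near: s; exact: n.
  by move=> n; near=> s; split=> // _; near: s; exact: n.
have nA' : ~ hall' (x t) (y t) by move=> /(hall_closed oc ng).
have m1 := near_crect (fun h => nA' (or_introl h)).
have m2 := near_crect (fun h => nA' (or_intror h)).
near=> s; split; last by move=> /nA.
case=> /orect_crect h; exfalso; move: h.
- by near: s; exact: m1.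
- by near: s; exact: m2.
Unshelve. all: by end_near. Qed.

End Near.

Section Path.
Variables (x y : R -> R).
Let D t := x t ^+ 2 + y t ^+ 2.
(** At the start |z| < 5 e = 1 / 2 puts z in the room. At the end e > 1200 puts z out of the hall,
    since e^2 < (33^2 + 17^2) |z|^2 and the hall has |z|^2 <= 28^2 + 12^2. *)
Let e (t : R) : R := 1 / 10 + t * 1200.
Let xw t := - (e t * x t / D t).
Let yw t := - (e t * y t / D t).
Hypotheses (cx : forall t : R, 0 <= t <= 1 -> x @ nbhs t --> x t)
  (cy : forall t : R, 0 <= t <= 1 -> y @ nbhs t --> y t)
  (D0 : forall t : R, 0 <= t <= 1 -> 0 < D t)
  (hz : forall t : R, 0 <= t <= 1 -> ~ (clear (x t) (y t) /\ in_band (x t) (y t)))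
  (hw : forall t : R, 0 <= t <= 1 -> ~ (clear (xw t) (yw t) /\ ~ in_band (xw t) (yw t))).

Let w_norm (t : R) : 0 <= t <= 1 -> (xw t ^+ 2 + yw t ^+ 2) * D t = e t ^+ 2.
Proof.
by move=> /D0; rewrite /xw /yw /D => d; field; rewrite gt_eqF.
Qed.

Let w_far (t : R) : 0 <= t <= 1 -> e t ^+ 2 < (33 * 33 + 17 * 17) * D t.
Proof.
move=> ht; rewrite -w_norm // ltr_pM2r ?D0 //.
have [/andP[h1 h2] /andP[h3 h4]] : - 33 < xw t < 33 /\ - 17 < yw t < 17.
  by apply: contrapT => /free_out; exact: hw.
have sq (z k : R) : - k < z -> z < k -> z ^+ 2 < k * k by move=> a b; nra.
have := sq _ _ h1 h2; have := sq _ _ h3 h4; lra.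
Qed.

Let w_near (t : R) : 0 <= t <= 1 -> D t < 25 * e t ^+ 2.
Proof.
move=> ht; rewrite -w_norm // mulrA -{1}(mul1r (D t)) ltr_pM2r ?D0 //.
have sq (z : R) : 1 / 5 < z -> 1 / 25 < z ^+ 2 by move=> a; nra.
have s1 := sqr_ge0 (xw t); have s2 := sqr_ge0 (yw t).
have [h1|h1] := ltP (1 / 5) (xw t); first by have := sq _ h1; lra.
have [h2|h2] := ltP (xw t) (- (1 / 5)).
  by have := sq (- xw t); rewrite sqrrN; lra.
have [h3|h3] := ltP (1 / 5) (yw t); first by have := sq _ h3; lra.
have [h4|h4] := ltP (yw t) (- (1 / 5)).
  by have := sq (- yw t); rewrite sqrrN; lra.
by case: (hw ht); apply: free_origin; apply/andP.
Qed.

Let off (t : R) : 0 <= t <= 1 -> off_core (x t) (y t).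
Proof. by move=> /hz; exact: avoid_core. Qed.

Let start : room (x 0) (y 0).
Proof.
have h0 : 0 <= (0 : R) <= 1 by apply/andP; split; lra.
have := w_near h0; rewrite /e mul0r addr0 /D => h.
by apply: Or33; do !split; nra.
Qed.

Let finish : ~ hall (x 1) (y 1).
Proof.
have h1 : 0 <= (1 : R) <= 1 by apply/andP; split; lra.
have := w_far h1; rewrite /e mul1r /D => h.
have b : (x 1) ^+ 2 + (y 1) ^+ 2 <= 28 * 28 + 12 * 12 -> False.
  move=> hb; have : (1200 : R) ^+ 2 < (33 * 33 + 17 * 17) * (28 * 28 + 12 * 12).
    apply: (@lt_le_trans _ _ ((33 * 33 + 17 * 17) * ((x 1) ^+ 2 + (y 1) ^+ 2))).
      apply: le_lt_trans h; rewrite ler_sqr ?nnegrE; lra.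
    by rewrite ler_wpM2l //; lra.
  lra.
have sq (z k : R) : - k < z -> z < k -> z ^+ 2 <= k * k by move=> a c; nra.
move=> [] [a1 [a2 [a3 a4]]]; apply: b; apply: lerD; apply: sq; lra.
Qed.

Let room_hall u v : room u v -> hall u v.
Proof.
move=> [] [h1 [h2 [h3 h4]]].
- by left; do !split; lra.
- by left; do !split; lra.
- by right; do !split; lra.
Qed.

(* The path [(x, y)] leaves the room through the gate, and the hall through the door at a
   later time.  At the door [w] is bounded, hence so was [e] at the gate, where [w] was
   therefore in the free part of the room. *)
Lemma no_path : False.
Proof.
have [[t0 [ht0 g0]]|ng] := pselect (exists t : R, 0 <= t <= 1 /\ gate (x t) (y t)); last first.
  apply: finish; apply: room_hall.
  apply: (@loc_const_01 R (fun t => room (x t) (y t))) => // t ht.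
  have n := room_const (cx ht) (cy ht) (off ht) (fun g => ng (ex_intro _ t (conj ht g))).
  by near=> s => _; near: s; exact: n.
have [t01 t02] := andP ht0.
pose c (s : R) := t0 + s * (1 - t0).
have c01 (s : R) : 0 <= s <= 1 -> 0 <= c s <= 1 /\ t0 <= c s.
  move=> /andP[s0 s1]; have := mulr_ge0 s0 (_ : 0 <= 1 - t0).
  have : s * (1 - t0) <= 1 * (1 - t0) by rewrite ler_wpM2r //; lra.
  by rewrite /c => h1 h2; have := h2 ltac:(lra); split; [apply/andP; split|]; lra.
have [[s [hs g1]]|nd] := pselect (exists s : R, 0 <= s <= 1 /\ door (x (c s)) (y (c s))).
  have [hc tc] := c01 s hs; move: (c s) hc tc g1 => t1 hc tc g1.
  have e01 : e t0 <= e t1 by rewrite /e; lra.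
  have e00 : 0 <= e t0 by rewrite /e; lra.
  (* At the door |z|^2 <= 160 and |w|^2 < 33^2 + 17^2, and 1378 * 161 < 480^2. *)
  have e480 : e t1 < 480.
    case: g1 => y1 x1 x2; have := w_far hc; rewrite /D y1 => h.
    have D160 : x t1 ^+ 2 + (-4) ^+ 2 <= 160 by nra.
    have : e t1 ^+ 2 < 480 ^+ 2.
      apply: lt_trans (_ : (33 * 33 + 17 * 17) * 161 < _); last by lra.
      by apply: lt_le_trans h _; rewrite ler_wpM2l //; lra.
    have gen (a b : R) : 0 <= b -> a ^+ 2 < b ^+ 2 -> a < b.
      by move=> b0 k; rewrite ltNge; apply/negP => k'; nra.
    apply: gen; lra.
  have [x0 y0 y1] := g0.
  (* With z = (-20, y), w is (20 e, - e y) / (400 + y^2); for e < 480 and |y| <= 4 its coordinates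
     are at most 24 and 4.8 in absolute value. *)
  apply: (hw ht0); apply: free_right.
    rewrite /xw /D x0 mulrN mulNr opprK.
    have d0 : 0 < (-20) ^+ 2 + y t0 ^+ 2 :> R by have := sqr_ge0 (y t0); lra.
    apply/andP; split; first by rewrite divr_ge0 ?(ltW d0) // mulr_ge0.
    by rewrite ler_pdivrMr //; have := sqr_ge0 (y t0); lra.
  rewrite /yw /D x0.
  have d0 : 0 < (-20) ^+ 2 + y t0 ^+ 2 :> R by have := sqr_ge0 (y t0); lra.
  have b1 : e t0 * y t0 <= e t0 * 4 by rewrite ler_wpM2l.
  have b2 : e t0 * (-4) <= e t0 * y t0 by rewrite ler_wpM2l.
  have s2 := sqr_ge0 (y t0).
  by rewrite lerN2 lerNl; apply/andP; split; [rewrite ler_pdivrMr //|rewrite ler_pdivlMr //]; lra.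
apply: finish; have c1 : c 1 = 1 by rewrite /c; ring.
have H : hall (x (c 1)) (y (c 1)).
  apply: (@loc_const_01 R (fun s => hall (x (c s)) (y (c s)))).
    move=> s hs; have [hc _] := c01 s hs.
    have cc : c @ nbhs s --> c s.
      apply: cvgD; [exact: cvg_cst|apply: cvgM; [exact: cvg_id|exact: cvg_cst]].
    have cxc : (x \o c) @ nbhs s --> x (c s) by exact: (cvg_comp _ _ cc (cx hc)).
    have cyc : (y \o c) @ nbhs s --> y (c s) by exact: (cvg_comp _ _ cc (cy hc)).
    have n := hall_const cxc cyc (off hc) (fun g => nd (ex_intro _ s (conj hs g))).
    by near=> s' => _; near: s'; exact: n.
  rewrite /c mul0r addr0; have [x0 y0 y1] := g0.
  have y2 : -4 < y t0.
    by rewrite ltNge; apply/negP => k; apply: (off1 (off ht0)); lra.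
  by left; do !split; rewrite ?x0; lra.
by rewrite c1 in H.
Unshelve. all: by end_near. Qed.

End Path.
End Planar.

(** * From isotropic vectors to points of the plane *)

Section Tube.
Variable R : realType.
Local Notation V := 'rV[R]_4.
Implicit Types (v z : V).
Local Notation C := (spiral R).

Definition px v := cs v / cr v.
Definition py v := ct v / cr v.
(** The boundary point at infinity is where [cr v] vanishes; it lies outside the band. *)
Definition tube v := 0 < cr v /\ in_band (px v) (py v).

Lemma null_plane v : psd v -> bil v v = 0 -> 0 < cr v -> cp v = cr v * (px v ^+ 2 + py v ^+ 2).
Proof.
move=> _ h r0; have h' : cp v * cr v = cs v ^+ 2 + ct v ^+ 2 by move: h; rewrite /bil; lra.
have : (cp v * cr v) / cr v = (cs v ^+ 2 + ct v ^+ 2) / cr v by rewrite h'.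
rewrite mulfK ?gt_eqF // => ->; rewrite /px /py; field; rewrite gt_eqF //.
Qed.

Lemma chamber_clear v : psd v -> bil v v = 0 -> 0 < cr v ->
  chamber C v <-> clear (px v) (py v).
Proof.
move=> hv h r0; have pE := null_plane hv h r0.
have E a : power (spiral_circle R a) v = cr v * (csq (spiral_circle R a) -
   ((px v - ccx (spiral_circle R a)) ^+ 2 + (py v - ccy (spiral_circle R a)) ^+ 2)).
  have sE : cs v = px v * cr v by rewrite /px divfK // gt_eqF.
  have tE : ct v = py v * cr v by rewrite /py divfK // gt_eqF.
  by rewrite powerE pE sE tE; ring.
split=> k a; first by have := k a; rewrite E pmulr_rle0 // subr_le0.
by have := k a; rewrite -subr_le0 -(pmulr_rle0 _ r0) -E.
Qed.

Lemma infinity_coord v : psd v -> bil v v = 0 -> cr v = 0 -> cs v = 0 /\ ct v = 0.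
Proof.
move=> _ h r0; move: h; rewrite /bil r0 mulr0 => h.
have s0 := sqr_ge0 (cs v); have t0 := sqr_ge0 (ct v).
by split; apply/eqP; rewrite -sqrf_eq0; apply/eqP; lra.
Qed.

Lemma chamber_infinity v : psd v -> bil v v = 0 -> cr v = 0 -> chamber C v.
Proof.
move=> hv h r0 a; have [s0 t0] := infinity_coord hv h r0; have [p0 _ _] := hv.
by rewrite powerE r0 s0 t0; lra.
Qed.

Lemma px_cont v : 0 < cr v -> px @ nbhs v --> px v.
Proof.
move=> r0; apply: cvgM; first exact: cs_cont.
by apply: cvgV; [rewrite gt_eqF|exact: cr_cont].
Qed.

Lemma py_cont v : 0 < cr v -> py @ nbhs v --> py v.
Proof.
move=> r0; apply: cvgM; first exact: ct_cont.
by apply: cvgV; [rewrite gt_eqF|exact: cr_cont].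
Qed.

Lemma tube_open v : tube v -> \forall v' \near v, tube v'.
Proof.
move=> [r0 [[[[x0 x1] y0] y1] hb h]].
have n0 := cvgr_gt _ (@cr_cont R v) _ r0.
have n1 := near_orect (px_cont r0) (py_cont r0) h.
near=> v'; split; first by near: v'; exact: n0.
by exists (x0, x1, y0, y1) => //; near: v'; exact: n1.
Unshelve. all: by end_near. Qed.

Lemma near_all (T : eqType) (W : Type) (F : set_system W) (s : seq T) (Q : T -> W -> Prop) :
  Filter F -> (forall b, b \in s -> \forall w \near F, Q b w) ->
  \forall w \near F, forall b, b \in s -> Q b w.
Proof.
move=> FF; elim: s => [|a s IH] h; first by near=> w.
have ha := h a (mem_head a s).
have hs : \forall w \near F, forall b, b \in s -> Q b w.
  by apply: IH => b hb; apply: h; rewrite inE hb orbT.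
near=> w => b; rewrite inE => /orP[/eqP->|]; first by near: w; exact: ha.
by move: b; near: w; exact: hs.
Unshelve. all: by end_near. Qed.

Lemma tube_closed v : psd v -> v != 0 -> bil v v = 0 -> chamber C v -> ~ tube v ->
  \forall v' \near v, psd v' -> bil v' v' = 0 -> chamber C v' -> ~ tube v'.
Proof.
move=> hv v0 h cv nt; have [p0 r0 _] := hv.
have [rp|rn] := ltP 0 (cr v); last first.
  have r00 : cr v = 0 by apply/eqP; rewrite eq_le rn.
  (* In the band cp <= (33^2 + 17^2) cr, since the band is bounded; this fails at infinity, hence in
     a neighbourhood of it. *)
  have pp : 0 < cp v - (33 * 33 + 17 * 17) * cr v.
    by have := psd_tr_gt0 hv v0; rewrite /tr r00; lra.
  have cc : (fun v' => cp v' - (33 * 33 + 17 * 17) * cr v') @ nbhs v --> cp v - (33 * 33 + 17 * 17) * cr v.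
    by apply: cvgB; [exact: cp_cont|apply: cvgM; [exact: cvg_cst|exact: cr_cont]].
  have n := cvgr_gt _ cc _ pp.
  near=> v' => hv' h' _ [r1 ib].
  have : 0 < cp v' - (33 * 33 + 17 * 17) * cr v' by near: v'; exact: n.
  have [/andP[a1 a2] /andP[a3 a4]] : - 33 < px v' < 33 /\ - 17 < py v' < 17.
    by apply: contrapT => /free_out [_]; apply.
  have sq (u k : R) : - k < u -> u < k -> u ^+ 2 < k * k by move=> a b; nra.
  have b1 := sq _ _ a1 a2; have b2 := sq _ _ a3 a4.
  rewrite (null_plane hv' h' r1) => hh.
  have : cr v' * (px v' ^+ 2 + py v' ^+ 2) <= cr v' * (33 * 33 + 17 * 17) by rewrite ler_wpM2l ?(ltW r1) //; lra.
  by rewrite leNgt; apply/negP; rewrite negbK; lra.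
have cl := (chamber_clear hv h rp).1 cv.
have nb : ~ in_band (px v) (py v) by move=> k; apply: nt.
have N : \forall v' \near v, forall b, b \in band -> ~ in_rect b (px v') (py v').
  apply: (@near_all _ V (nbhs v) band (fun b v' => ~ in_rect b (px v') (py v')) _) => -[[[x0 x1] y0] y1] hb.
  have nc : ~ in_rect_closed (x0, x1, y0, y1) (px v) (py v) by move=> /(closed_in_band hb cl).
  have n := near_crect (px_cont rp) (py_cont rp) nc.
  near=> v' => /orect_crect; near: v'; exact: n.
near=> v' => _ _ _ [_ [b hb]]; move: b hb; near: v'; exact: N.
Unshelve. all: by end_near. Qed.

Lemma plus_side v : psd v -> bil v v = 0 ->
  (0 < cr v -> clear (px v) (py v) /\ ~ in_band (px v) (py v)) ->
  chamber C v /\ ~ tube v.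
Proof.
move=> hv h k; have [rp|rn] := ltP 0 (cr v).
  have [cl nb] := k rp; split; first exact/chamber_clear.
  by case.
have r00 : cr v = 0 by case: hv => _ r0 _; apply/eqP; rewrite eq_le rn.
by split; [exact: chamber_infinity|rewrite /tube r00 ltxx => -[]].
Qed.

Local Notation Wp := (side C (fun v => ~ tube v)).
Local Notation Wm := (side C tube).

Lemma side_id (Q : V -> Prop) v : chamber C v -> Q v -> side C Q v.
Proof. by move=> cv qv; exists [::]. Qed.

Lemma minus_not_plus v : nullC v -> Wm v ->
  ~ (0 < cr v -> clear (px v) (py v) /\ ~ in_band (px v) (py v)).
Proof.
move=> nv hm k; have [pv _ vv] := nv; have [c1 c2] := plus_side pv vv k.
exact: (side_disjoint nv (side_id c1 c2) hm).
Qed.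

Lemma plus_not_minus v : nullC v -> Wp v -> 0 < cr v -> ~ (clear (px v) (py v) /\ in_band (px v) (py v)).
Proof.
move=> nv hp r0 [cl ib]; have [pv _ vv] := nv.
apply: (side_disjoint nv hp); apply: side_id; first exact/(chamber_clear pv vv r0).
by split.
Qed.

Lemma plus_exists : exists2 v, nullC v & Wp v.
Proof.
pose v : V := vec 0 1 0 0.
have hv : nullC v by split; [split|..]; rewrite /tr /bil /v ?vecE; lra.
exists v => //; have [pv _ vv] := hv.
have [c1 c2] : chamber C v /\ ~ tube v.
  apply: plus_side => // _; rewrite /px /py /v !vecE !mul0r.
  by apply: free_origin; apply/andP; split; lra.
exact: side_id.
Qed.

Lemma minus_exists : exists2 v, nullC v & Wm v.
Proof.
pose v : V := vec 32 1 (-4) (-4).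
have pv : psd v by split; rewrite /bil /v ?vecE; lra.
have vv : bil v v = 0 by rewrite /bil /v !vecE; lra.
have r1 : cr v = 1 by rewrite /v !vecE.
have v0 : v != 0 by apply/eqP => E; move: r1; rewrite E /cr mxE; lra.
exists ((tr v)^-1 *: v); first exact: nullC_normalize.
have [cl ib] : clear (px v) (py v) /\ in_band (px v) (py v).
  rewrite /px /py r1 !divr1 /v !vecE.
  by apply: (@core_band R 24 28 0 20); rewrite // /grid_x /grid_y; lra.
have t0 : 0 < (tr v)^-1 by rewrite invr_gt0 psd_tr_gt0.
exists [::]; split => /=.
  move=> i; rewrite powerZ pmulr_rle0 //; move: i; apply/(chamber_clear pv vv); rewrite ?r1 //.
have E f : (tr v)^-1 * f / ((tr v)^-1 * cr v) = f / cr v.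
  by rewrite r1 mulr1 divr1 mulrAC mulfV ?mul1r // gt_eqF.
by split; rewrite ?crZ ?r1 ?mulr1 // /px /py csZ ctZ crZ !E.
Qed.

Lemma axis_cont (e : R) : @axis R @ nbhs e --> axis e.
Proof.
have -> : @axis R = (fun e => e *: (vec 1 0 0 0 : V) + (vec 0 1 0 0 : V)).
  by apply/funext => s; apply: vec_ext; rewrite /axis !coordE; ring.
have h1 : (fun s : R => s *: (vec 1 0 0 0 : V)) @ nbhs e --> e *: (vec 1 0 0 0 : V).
  by apply: cvgZr_tmp; exact: cvg_id.
have h2 : (fun s : R => (vec 0 1 0 0 : V)) @ nbhs e --> (vec 0 1 0 0 : V) by exact: cvg_cst.
exact: (cvgD h1 h2).
Qed.

Lemma axis_sides (e : R) z : 0 < e -> nullC z -> Wp z -> Wm (antipoint (axis e) z) ->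
  let D := px z ^+ 2 + py z ^+ 2 in
  [/\ 0 < cr z, 0 < D, ~ (clear (px z) (py z) /\ in_band (px z) (py z)) &
    let xw := - (e * px z / D) in let yw := - (e * py z / D) in
    ~ (clear xw yw /\ ~ in_band xw yw)].
Proof.
move=> e0 nz hp hm D; have [pz tz zz] := nz; have [p0 r0 _] := pz.
have po := pd_axis e0; have nw := antipoint_null po nz; have [ow0 ow1] := antipode_psd po nz.
set k := (tr (antipode (axis e) z))^-1.
have k0 : 0 < k by rewrite invr_gt0 psd_tr_gt0.
have oE : antipode (axis e) z = vec (e * cr z) (cp z / e) (- cs z) (- ct z).
  have oo : bil (axis e) (axis e) = 2 * e by rewrite /bil /axis !vecE; ring.
  have oz : bil (axis e) z = e * cr z + cp z by rewrite /bil /axis !vecE; ring.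
  by apply: vec_ext; rewrite /antipode oo oz !coordE /axis ?vecE; field; rewrite ?gt_eqF.
have wE : antipoint (axis e) z = k *: vec (e * cr z) (cp z / e) (- cs z) (- ct z).
  by rewrite /antipoint -oE.
have nm := minus_not_plus nw hm.
have wc : [/\ cr (antipoint (axis e) z) = k * (cp z / e), px (antipoint (axis e) z) = - (e * cs z / cp z) &
    py (antipoint (axis e) z) = - (e * ct z / cp z)].
  rewrite wE /px /py crZ csZ ctZ !vecE; split => //.
    have [->|pn] := eqVneq (cp z) 0; first by rewrite mul0r !mulr0 invr0 !mulr0 oppr0.
    by field; rewrite pn !gt_eqF.
  have [->|pn] := eqVneq (cp z) 0; first by rewrite mul0r !mulr0 invr0 !mulr0 oppr0.
  by field; rewrite pn !gt_eqF.
have [wr wx wy] := wc; rewrite wr wx wy in nm.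
(* If z were 0, then w would be infinity, and conversely; both points are on the plus side, whereas
   w is on the minus side. *)
have pp : 0 < cp z.
  rewrite lt_def p0 andbT; apply/eqP => pz0; apply: nm; rewrite pz0 mul0r mulr0.
  by rewrite ltxx.
have rp : 0 < cr z.
  rewrite lt_def r0 andbT; apply/eqP => rz0; apply: nm => _.
  have [-> ->] := infinity_coord pz zz rz0; rewrite !mulr0 !mul0r oppr0.
  by apply: free_origin; apply/andP; split; lra.
have pE := null_plane pz zz rp; rewrite -/D in pE.
have D0 : 0 < D by rewrite -(pmulr_rgt0 _ rp) -pE.
split => //; first exact: plus_not_minus.
move=> xw yw h; apply: nm => _.
have -> : - (e * cs z / cp z) = xw.
  by rewrite /xw pE /px; field; rewrite !gt_eqF.
have -> : - (e * ct z / cp z) = yw.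
  by rewrite /yw pE /py; field; rewrite !gt_eqF.
exact: h.
Qed.

End Tube.

Theorem theorem1p2 (R : realType) :
  exists (g : nat) (rho : SL2_representation R (surface_group g)),
    [/\ (2 <= g)%N, quasi_fuchsian rho &
      forall (S X : topologicalType) (A : set (chart R S)) (p : X -> S)
             (act : surface_group g -> X -> X),
        closed_oriented_surface A -> universal_cover R p ->
        deck_action p act ->
        ~ exists u : X -> geodesic R,
            equivariant act rho u /\ fitting_immersion (lift_atlas p A) u].
Proof.
have hC : nextto (spiral R) =2 @bead_next 91 by [].
exists 91%N, (bead_rep hC); split => //; first exact: bead_rep_quasi_fuchsian.
move=> S X A p actX hS hp hd [u [hu hfit]].
have [L hL] := fitting_section hS hp hd hu hfit.
pose P x := plane (u x).
have mP x : mixed (P x) := plane_mixed (u x).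
have clo v x : ~ orthv v (P x) -> \forall q \near (v, x), ~ orthv q.1 (P q.2).
  exact: (orthX_closed hS hp hfit).
pose Wp := side (spiral R) (fun v => ~ tube v).
pose Wm := side (spiral R) (@tube R).
have Wcov o v : pd o -> endpt P L o v -> Wp v \/ Wm v.
  move=> po ev; apply: side_cover; apply: (endpt_tame hC hL _ _ po ev).
    by move=> a o' x; exact: (orthX_gact hd hu).
  by move=> x; exact: (deck_proper hp hd).
have Wdisj v : nullC v -> Wp v -> Wm v -> False by exact: side_disjoint.
have oWp v : nullC v -> Wp v -> \forall v' \near v, nullC v' -> Wp v'.
  by apply: side_open; exact: tube_closed.
have oWm v : nullC v -> Wm v -> \forall v' \near v, nullC v' -> Wm v'.
  apply: side_open => w _ _ _ _ /tube_open; apply: filterS => v' h _ _ _; exact: h.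
pose e (t : R) : R := 1 / 10 + t * 1200.
have ex t : exists z, 0 < e t -> [/\ endpt P L (axis (e t)) z, Wp z & Wm (antipoint (axis (e t)) z)].
  have [e0|n] := ltP 0 (e t); last by exists 0.
  have [z hz] := sides mP hL clo Wcov Wdisj oWp oWm (plus_exists R) (minus_exists R) (pd_axis e0).
  by exists z.
have [z hz] := choice ex.
have e0 (t : R) : 0 <= t <= 1 -> 0 < e t by move=> /andP[t0 t1]; rewrite /e; lra.
have fact (t : R) : 0 <= t <= 1 -> _ := fun ht => let: And3 h1 h2 h3 := hz t (e0 t ht) in
  axis_sides (e0 t ht) h1.1 h2 h3.
have ec (t : R) : e @ nbhs t --> e t.
  by apply: cvgD; [exact: cvg_cst|apply: cvgM; [exact: cvg_id|exact: cvg_cst]].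
(* Although [z] was obtained by choice, it is continuous, since each geodesic has a single endpoint
   on the plus side. *)
have zc (t : R) : 0 <= t <= 1 -> z @ nbhs t --> z t.
  move=> ht; have ne := cvgr_gt _ (ec t) _ (e0 t ht).
  apply: (sides_continuous mP hL clo Wdisj oWm (c := fun t : R => axis (e t))).
  - by near=> s; apply: pd_axis; near: s; exact: ne.
  - exact: (cvg_comp _ _ (ec t) (@axis_cont R (e t))).
  - near=> s; have es : 0 < e s by near: s; exact: ne.
    exact: hz s es.
apply: (@no_path R (fun t => px (z t)) (fun t => py (z t))).
- move=> t ht; have [r0 _ _ _] := fact t ht.
  exact: (cvg_comp _ _ (zc t ht) (px_cont r0)).
- move=> t ht; have [r0 _ _ _] := fact t ht.
  exact: (cvg_comp _ _ (zc t ht) (py_cont r0)).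
- by move=> t ht; have [_ h _ _] := fact t ht.
- by move=> t ht; have [_ _ h _] := fact t ht.
- by move=> t ht; have [_ _ _ h] := fact t ht.
Unshelve. all: by end_near. Qed.
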